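(* Let $\Sigma\subset\mathbb C$ be finite and $a\ne b$ in $\Sigma$. Then for every $c\in\Sigma$ and every $w\in\mathcal A_\Sigma$, $$\frac{d}{dz}\mathrm{Li}^{ab}_\Sigma(x_cw;z)=\frac{1}{z-c}\,\mathrm{Li}^{ab}_\Sigma(w;z),$$ and the local solution $H^{ab}_\Sigma$ of the equation $\frac{dH}{dz}=\Big(\sum_{c\in\Sigma}\frac{X_c}{z-c}\Big)H$ is given by $$H^{ab}_\Sigma(z)=\sum_W \mathrm{Li}^{ab}_\Sigma(w;z)\,W .$$ Moreover $H^{ab}_\Sigma(z)=\left(\frac{z-a}{b-a}\right)^{X_a}\Big(\sum_W\mathrm{Li}^{ab}_\Sigma(\mathrm{reg}^{ab}(w);z)\,W\Big)\left(\frac{z-b}{a-b}\right)^{X_b}$.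
   Context: Let $\Sigma\subset\mathbb C$ be finite. $\mathcal A_\Sigma=\mathbb C\langle x_c: c\in\Sigma\rangle$ is the free non-commutative polynomial algebra on letters $x_c$; monomials are words. The shuffle product $⧢$ is the bilinear product defined recursively by $w ⧢ 1=1 ⧢ w=w$ and $l_1w_1 ⧢ l_2w_2=l_1(w_1 ⧢ l_2w_2)+l_2(l_1w_1 ⧢ w_2)$ for letters $l_1,l_2$ and words $w_1,w_2$; $x^{⧢ j}$ is the $j$-th shuffle power. For $b\in\Sigma$, $\mathcal A^b_\Sigma$ is the span of $1$ and all words not ending in $x_b$; for distinct $a,b\in\Sigma$, $\mathcal A^{ab}_\Sigma$ is the span of $1$ and all words that neither start with $x_a$ nor end with $x_b$. Every $w\in\mathcal A_\Sigma$ is uniquely $\sum_{j\ge0}u_j ⧢ x_b^{⧢ j}$ with $u_j\in\mathcal A^b_\Sigma$, and uniquely $\sum_{i,j\ge0}x_a^{⧢ i} ⧢ v_{ij} ⧢ x_b^{⧢ j}$ with $v_{ij}\in\mathcal A^{ab}_\Sigma$; put $\mathrm{reg}^b(w)=u_0$, $\mathrm{reg}^{ab}(w)=v_{00}$ (linear maps). Put $\rho_b=\min_{c\in\Sigma\setminus\{b\}}|c-b|$. For a word $w=x_b^{k_1-1}x_{c_1}\cdots x_b^{k_r-1}x_{c_r}\in\mathcal A^b_\Sigma$ ($k_i\ge1$, $c_i\ne b$), $\mathrm{Li}^b_\Sigma(w;z)=(-1)^r\sum_{m_1>\dots>m_r>0}\prod_{i=1}^r\left(\frac{z-b}{c_i-b}\right)^{m_i-m_{i+1}}m_i^{-k_i}$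 ($m_{r+1}=0$) for $|z-b|<\rho_b$, $\mathrm{Li}^b_\Sigma(1;z)=1$, extended linearly and continued analytically in $\mathbb C\setminus\Sigma$. For distinct $a,b$, $\mathrm{Li}^{ab}_\Sigma(\cdot;z):\mathcal A_\Sigma\to$ functions is the unique linear map that is a $⧢$-homomorphism ($\mathrm{Li}^{ab}_\Sigma(u ⧢ v;z)=\mathrm{Li}^{ab}_\Sigma(u;z)\mathrm{Li}^{ab}_\Sigma(v;z)$), equals $\mathrm{Li}^b_\Sigma$ on $\mathcal A^b_\Sigma$, and satisfies $\mathrm{Li}^{ab}_\Sigma(x_b;z)=\log\frac{z-b}{a-b}$. All functions are single-valued branches on a fixed simply connected domain $U\subset\mathbb C\setminus\Sigma$ containing $\{0<|z-b|<\rho_b\}$ minus a ray from $b$, with fixed branches of the logarithms. $\mathbb C\langle\langle X_c:c\in\Sigma\rangle\rangle$ is the algebra of non-commutative formal power series; for a word $w=x_{c_1}\cdots x_{c_n}$, $W=X_{c_1}\cdots X_{c_n}$, and $\sum_W$ runs over all words. For a function $f$, $f^{X}=\exp(X\log f)=\sum_{n\ge0}(X\log f)^n/n!$. $H^{ab}_\Sigma$ denotes the unique $\mathbb C\langle\langle X_c\rangle\rangle$-valued solution on $U$ (coefficientwise holomorphic) of $\frac{dH}{dz}=\big(\sum_{c\in\Sigma}\frac{X_c}{z-c}\big)H$ satisfying $H(z)\left(\frac{z-b}{a-b}\right)^{-X_b}\to1$ coefficientwise as $z\to b$. *)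

(* Defs.v *)
(* Complex numbers are  R[i]  for an
   abstract  R : realType  (mathcomp-real-closed's [complex]), viewed through the
   regular-algebra alias  ^o  so that they form a normed C-module; derivatives
   [is_derive z 1 f df] / [derivable f z 1] for  f : C -> C  are then complex
   derivatives (increments range over C). *)
From HB Require Import structures.
From mathcomp Require Import all_boot all_order all_algebra.
From mathcomp Require Import all_classical all_reals all_analysis.
From mathcomp Require Import complex.
Import Order.TTheory GRing.Theory Num.Theory.
Import numFieldNormedType.Exports.

Set Implicit Arguments.
Unset Strict Implicit.
Unset Printing Implicit Defensive.

Local Open Scope ring_scope.
Local Open Scope classical_set_scope.

Notation Cplx R := ((R[i])^o).

Section PolylogDefs.
Variable R : realType.
Local Notation C := (Cplx R).

(* A letter x_c is represented by the complex number c itself; a word          *)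
(* x_{c_1}...x_{c_n} by the sequence [:: c_1; ...; c_n].  The alphabet is       *)
(* Sigma : seq C; [sigword Sigma w] says that w is a word over Sigma.           *)
(* An element of A_Sigma is represented by a finite formal linear combination *)
(* of words, i.e. a list of (coefficient, word) pairs; two such lists denote   *)
(* the same polynomial iff they have the same coefficients [coef].             *)
(* A formal series in C<<X_c>> is represented by its coefficient function.    *)

Definition sigword (Sigma : seq C) (w : seq C) : bool :=
  all (fun c => c \in Sigma) w.

Definition ncpoly := seq (C * seq C).

Definition sigpoly (Sigma : seq C) (p : ncpoly) : bool :=
  all (fun t => sigword Sigma t.2) p.

Definition coef (p : ncpoly) (w : seq C) : C := \sum_(t <- p | t.2 == w) t.1.

Definition pword (w : seq C) : ncpoly := [:: (1, w)].

Definition plcons (c : C) (p : ncpoly) : ncpoly := [seq (t.1, c :: t.2) | t <- p].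

Fixpoint shuffle (u : seq C) : seq C -> seq (seq C) :=
  match u with
  | [::] => fun v => [:: v]
  | l1 :: u1 =>
    fix sh (v : seq C) : seq (seq C) :=
      match v with
      | [::] => [:: u]
      | l2 :: v1 => [seq l1 :: x | x <- shuffle u1 v] ++ [seq l2 :: x | x <- sh v1]
      end
  end.

Definition pshuffle (p q : ncpoly) : ncpoly :=
  flatten [seq [seq (t.1 * s.1, x) | x <- shuffle t.2 s.2] | t <- p, s <- q].

Fixpoint pshpow (p : ncpoly) (n : nat) : ncpoly :=
  if n is n'.+1 then pshuffle p (pshpow p n') else pword [::].

Definition inAb (b : C) (w : seq C) : bool := ohead (rev w) != Some b.
Definition inAab (a b : C) (w : seq C) : bool := (ohead w != Some a) && inAb b w.

Definition lin (F : seq C -> C -> C) (p : ncpoly) (z : C) : C :=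
  \sum_(t <- p) t.1 * F t.2 z.

(* w = sum_{i,j<N} x_a^{⧢ i} ⧢ v i j ⧢ x_b^{⧢ j}  with  v i j in A^{ab}_Sigma
   (the v i j with i >= N or j >= N being zero) *)
Definition ab_decomp (Sigma : seq C) (a b : C) (p : ncpoly) (N : nat)
    (v : nat -> nat -> ncpoly) : Prop :=
  [/\ (0 < N)%N,
      (forall i j, sigpoly Sigma (v i j) && all (fun t => inAab a b t.2) (v i j))
    & forall w, coef p w =
        coef (flatten [seq pshuffle (pshuffle (pshpow (pword [:: a]) i) (v i j))
                                    (pshpow (pword [:: b]) j)
                      | i <- iota 0 N, j <- iota 0 N]) w].

Definition is_reg_ab (Sigma : seq C) (a b : C) (reg : seq C -> ncpoly) : Prop :=
  forall w, sigword Sigma w ->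
    exists N v, ab_decomp Sigma a b (pword w) N v /\
                forall u, coef (reg w) u = coef (v 0%N 0%N) u.

Definition series := seq C -> C.

Definition sone : series := fun w => (w == [::])%:R.

Definition smul (A B : series) : series :=
  fun w => \sum_(i < (size w).+1) A (take i w) * B (drop i w).

(* exp(X_c L) = sum_n (X_c L)^n / n! : coefficient L^n/n! on x_c^n, 0 elsewhere;
   f^{X_c} = sexp c (log f) *)
Definition sexp (c L : C) : series :=
  fun w => if w == nseq (size w) c then L ^+ size w / ((size w)`!)%:R else 0.

Definition Aser (Sigma : seq C) (z : C) : series :=
  fun w => if w is [:: c] then (if c \in Sigma then (z - c)^-1 else 0) else 0.

Definition slit_disk (Sigma : seq C) (b d : C) : set C :=
  [set z | 0 < `|z - b|
         /\ (forall c, c \in Sigma -> c != b -> `|z - b| < `|c - b|)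
         /\ ~ (exists t : R, 0 <= t /\ z = b + ((t%:C)%C : C) * d)].

Definition unit_square : set (R * R) :=
  [set p | (0 <= p.1 <= 1) /\ (0 <= p.2 <= 1)].

Definition simply_connected (U : set C) : Prop :=
  forall g : R -> C,
    {within [set t | 0 <= t <= 1], continuous g} ->
    (forall t, 0 <= t <= 1 -> U (g t)) -> g 0 = g 1 ->
    exists h : R * R -> C,
      [/\ {within unit_square, continuous h},
          (forall p, unit_square p -> U (h p)),
          (forall t, 0 <= t <= 1 -> h (0, t) = g t /\ h (1, t) = g 0)
        & (forall s, 0 <= s <= 1 -> h (s, 0) = h (s, 1))].

Definition is_log_branch (U : set C) (L g : C -> C) : Prop :=
  forall z, U z -> derivable L z 1 /\
    (fun N => \sum_(n < N) L z ^+ n / (n`!)%:R) @ \oo --> g z.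

(* w = x_b^{k_1-1} x_{c_1} ... x_b^{k_r-1} x_{c_r}  |->  [:: (k_1,c_1); ...] *)
Fixpoint parse (b : C) (k : nat) (w : seq C) : seq (nat * C) :=
  match w with
  | [::] => [::]
  | c :: w' => if c == b then parse b k.+1 w' else (k.+1, c) :: parse b 0 w'
  end.

(* Eterm s m = sum over m = m_1 > m_2 > ... > m_r > 0 (m_{r+1} = 0) of
   prod_i q_i^(m_i - m_{i+1}) m_i^(-k_i),  for s = [:: (k_1,q_1); ...; (k_r,q_r)] *)
Fixpoint Eterm (s : seq (nat * C)) (m : nat) : C :=
  match s with
  | [::] => (m == 0)%N%:R
  | (k, q) :: s' =>
    if m is 0 then 0
    else (m%:R ^+ k)^-1 * \sum_(m' < m) q ^+ (m - m') * Eterm s' m'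
  end.

Definition LibSum (b : C) (s : seq (nat * C)) (z : C) (N : nat) : C :=
  \sum_(m < N) Eterm [seq (kc.1, (z - b) / (kc.2 - b)) | kc <- s] m.

Definition is_Lib (Sigma : seq C) (b d : C) (U : set C) (G : seq C -> C -> C) : Prop :=
  forall w, sigword Sigma w -> inAb b w ->
    (forall z, U z -> derivable (G w) z 1) /\
    (forall z, slit_disk Sigma b d z ->
       LibSum b (parse b 0 w) z @ \oo --> (-1) ^+ size (parse b 0 w) * G w z).

Definition is_Liab (Sigma : seq C) (b : C) (U : set C) (G : seq C -> C -> C)
    (Lb : C -> C) (F : seq C -> C -> C) : Prop :=
  [/\ (forall u v, sigword Sigma u -> sigword Sigma v -> forall z, U z ->
         lin F (pshuffle (pword u) (pword v)) z = F u z * F v z),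
      (forall w, sigword Sigma w -> inAb b w -> forall z, U z -> F w z = G w z)
    & (forall z, U z -> F [:: b] z = Lb z)].

(* H solves dH/dz = (sum_c X_c/(z-c)) H on U (coefficientwise holomorphic) and
   H(z) ((z-b)/(a-b))^{-X_b} -> 1 coefficientwise as z -> b in U, where the
   power uses the fixed branch Lb of log((z-b)/(a-b)). *)
Definition is_Hab_solution (Sigma : seq C) (b : C) (U : set C) (Lb : C -> C)
    (H : C -> series) : Prop :=
  (forall w, sigword Sigma w -> forall z, U z ->
     is_derive z 1 (fun y => H y w) (smul (Aser Sigma z) (H z) w)) /\
  (forall w, sigword Sigma w ->
     (fun z => smul (H z) (sexp b (- Lb z)) w) @ within U (nbhs b) --> sone w).

End PolylogDefs.

(* Main.v *)
(** The words not ending in x_b give power series in z - b, which can be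
differentiated termwise on the slit disk; the identity principle carries
Li^b(x_c w)' = Li^b(w) / (z - c) over to U.  As functions are only assumed
complex differentiable, this uses Goursat's theorem and Cauchy's formula on
rectangles, which also show that derivatives are again differentiable.

The rest is algebra with characters of the shuffle product.  Shuffling w with x_b
produces w x_b and words with no more trailing x_b than w, so the derivation
formula extends to all words by induction on the number of trailing x_b.  The
product of two group-like series is group-like (deconcatenation is a shuffle
morphism), hence H (..)^{-X_b} is a character killing x_b; it tends to 1 because
Li^b(w) vanishes at b for every nonempty word w not ending in x_b.  Likewise
(..)^{-X_a} H (..)^{-X_b} is a character killing x_a and x_b, so on any word it
takes the value of H at the (i, j) = (0, 0) term of its regularization. *)
Require Import Defs.
From HB Require Import structures.
From mathcomp Require Import all_boot all_order all_algebra.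
From mathcomp Require Import all_classical all_reals all_analysis.
From mathcomp Require Import complex ring lra.
Import Order.TTheory GRing.Theory Num.Theory.
Import numFieldNormedType.Exports Normc.
Local Open Scope ring_scope.
Local Open Scope classical_set_scope.
Set Implicit Arguments.
Unset Strict Implicit.

(** * Complex modulus and derivative *)

Section Foundations.
Variable R : realType.
Local Notation C := (Cplx R).
Local Notation N := (@normc R).
Local Notation Re := (@complex.Re R).
Local Notation Im := (@complex.Im R).
Implicit Types (z w p : C) (f g : C -> C).

(** The contour integral of 1/(w - z) is never evaluated: Cauchy's formula keeps it as a factor, and
    only its nonvanishing is proved, by a sign argument. This suffices to solve for f and f', hence
    for holomorphy of derivatives, Weierstrass's theorem on limits and the identity principle. The
    logarithms are given only through the exponential series, so their derivatives come from the
    same termwise differentiation as those of the polylogarithms. Two things need care at b. The set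
    U is only known to contain the slit disk, so smallness of the series is carried to points of U
    near b by continuity. And H contains powers of log(z - b), which grow while other factors
    vanish; comparing their orders is avoided, because the shuffle relation with a character that
    kills x_b expresses the remaining values through values already known to tend to 0. *)

Lemma normCE (z : C) : `|z| = (N z)%:C%C.
Proof. by []. Qed.

Lemma normc_ge0 (z : C) : 0 <= N z.
Proof. by case: z => x y; rewrite /= sqrtr_ge0. Qed.

Lemma nbhsCP (p : C) (A : set C) :
  nbhs p A <-> exists2 r : R, 0 < r & forall z, N (z - p) < r -> A z.
Proof.
split.
- move/nbhs_ballP => [e /= e0 eA].
  (* A positive element of [R[i]] is real, so the radius of the ball comes from [R]. *)
  have er : e = (Re e)%:C%C.
    exact/esym/RRe_real/gtr0_real.
  rewrite er in e0 eA; rewrite ltcR in e0.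
  exists (Re e) => // z zr; apply: eA.
  by rewrite -ball_normE /ball_/= distrC normCE ltcR.
- case=> r r0 rA; apply/nbhs_ballP; exists (r%:C%C) => /=.
    by rewrite ltcR.
  move=> z; rewrite -ball_normE /= distrC normCE ltcR; exact: rA.
Qed.

Lemma normc_real (r : R) : N (r%:C)%C = `|r|.
Proof. by rewrite /= expr0n addr0 sqrtr_sqr. Qed.

Lemma normcBC (z w : C) : N (z - w) = N (w - z).
Proof. by rewrite -opprB normcN. Qed.

Lemma normcB3 (w z u : C) : N (z - u) <= N (z - w) + N (w - u).
Proof. by rewrite -[z - u](subrKA w) le_normcD. Qed.

Lemma normc_gt0 (z : C) : (0 < N z) = (z != 0).
Proof.
rewrite lt_neqAle normc_ge0 andbT; congr (~~ _); apply/eqP/eqP => [h|->].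
  by apply/eq0_normc.
by rewrite normc0.
Qed.

Lemma normcX (z : C) n : N (z ^+ n) = N z ^+ n.
Proof. by elim: n => [|n IH]; rewrite ?expr0 ?normc1// !exprS normcM IH. Qed.

Lemma normc_nat n : N (n%:R : C) = n%:R.
Proof.
have -> : (n%:R : C) = ((n%:R : R)%:C)%C by rewrite rmorph_nat.
by rewrite normc_real ger0_norm.
Qed.

Lemma normc_Re (z : C) : `|Re z| <= N z.
Proof. by have := normc_ge_Re z; rewrite normCE lecR. Qed.

Lemma normc_Im (z : C) : `|Im z| <= N z.
Proof.
by case: z => x y /=; rewrite -sqrtr_sqr ler_wsqrtr// lerDr sqr_ge0.
Qed.

Lemma cvgCP (T : Type) (F : set_system T) (FF : Filter F) (f : T -> C) (l : C) :
  f @ F --> l <-> forall e : R, 0 < e -> \forall x \near F, N (f x - l) < e.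
Proof.
split=> [h e e0|h A /nbhsCP[e e0 eA]].
  by apply: (h [set y | N (y - l) < e]); apply/nbhsCP; exists e.
by apply: filterS (h e e0) => x; exact: eA.
Qed.

(* The norm of [R[i]] takes values in [R[i]], which is not totally ordered;
   complex derivatives are therefore handled with the [R]-valued modulus [normc]. *)
Definition cder f z l := forall e : R, 0 < e -> exists2 d : R, 0 < d &
  forall w, N (w - z) < d -> N (f w - f z - l * (w - z)) <= e * N (w - z).

Lemma is_derive_cder f z l : is_derive z 1 f l <-> cder f z l.
Proof.
have E : (fun h : C => h^-1 *: (f (h *: 1 + z) - f z)) @ 0^' --> l <-> cder f z l.
  rewrite cvgCP; split => h e e0.
    have := h e e0; rewrite near_withinE => /nbhsCP[d d0 dP].
    exists d => // w wd.
    have [->|wz] := eqVneq w z; first by rewrite !subrr mulr0 subr0 normc0 mulr0.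
    have wz0 : w - z != 0 by rewrite subr_eq0.
    have := dP (w - z); rewrite subr0 => /(_ wd wz0).
    rewrite [_ *: 1]mulr1 subrK => /ltW H.
    rewrite (_ : f w - _ - _ = ((w - z)^-1 *: (f w - f z) - l) * (w - z)).
      by rewrite normcM ler_wpM2r// normc_ge0.
    by rewrite mulrBl [_ *: _]mulrC mulfVK.
  (* [cder] bounds with [<=] while the limit asks for [<]; halving [e] restores strictness. *)
  have [d d0 dP] := h (e / 2) ltac:(by rewrite divr_gt0).
  rewrite near_withinE; apply/nbhsCP; exists d => // k; rewrite subr0 => kd k0.
  have := dP (k + z); rewrite addrK => /(_ kd) H.
  rewrite [k *: 1]mulr1.
  rewrite (_ : _ - l = k^-1 * (f (k + z) - f z - l * k)); last first.
    by rewrite [RHS]mulrBr [k^-1 * (l * k)]mulrCA mulVf// mulr1.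
  rewrite normcM normcV.
  have Nk : 0 < N k by rewrite normc_gt0.
  rewrite ltr_pdivrMl//; apply: le_lt_trans H _.
  by rewrite mulrC ltr_pM2l// ltr_pdivrMr// ltr_pMr// ltr1n.
split=> [[dv dl]|h].
  by apply: E.1; rewrite -dl.
have cv := (E.2 h); apply: DeriveDef; first by apply/cvg_ex; exists l.
by apply: cvg_lim cv => //; exact: norm_hausdorff.
Qed.

Definition ccont f z := forall e : R, 0 < e -> exists2 d : R, 0 < d &
  forall w, N (w - z) < d -> N (f w - f z) <= e.

Lemma cder_ccont f z l : cder f z l -> ccont f z.
Proof.
move=> h e e0; have [d d0 dP] := h 1 ltr01.
have Nl := normc_ge0 l.
exists (Num.min d (e / (1 + N l))).
  by rewrite lt_min d0 divr_gt0// ltr_wpDr.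
move=> w; rewrite lt_min => /andP[/dP H].
rewrite ltr_pdivlMr ?ltr_wpDr// => H2.
have := le_normcD (f w - f z - l * (w - z)) (l * (w - z)); rewrite subrK normcM.
by nra.
Qed.

End Foundations.

(** * Contour integrals on rectangles *)

Section Contour.
Variable R : realType.
Local Notation C := (Cplx R).
Local Notation N := (@normc R).
Local Notation Re := (@complex.Re R).
Local Notation Im := (@complex.Im R).
Local Notation mu := (@lebesgue_measure R).
Implicit Types (f : C -> C) (g h : R -> C) (a b m x y t : R).

Lemma normc_le_ReIm (z : C) : N z <= `|Re z| + `|Im z|.
Proof.
case: z => x y /=.
rewrite -(@ler_pXn2r _ 2) ?nnegrE ?sqrtr_ge0 ?addr_ge0//.
rewrite sqr_sqrtr ?addr_ge0 ?sqr_ge0// sqrrD !real_normK ?num_real//.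
by rewrite -addrA lerD2l lerDr mulrn_wge0// mulr_ge0.
Qed.

Definition rcont g t := forall e : R, 0 < e -> exists2 d : R, 0 < d &
  forall s, `|s - t| < d -> N (g s - g t) <= e.

(** [p] stands for [Re] or [Im]: additive and bounded by the modulus, it turns continuity of [g]
    into continuity of a real function on a segment. *)
Lemma rcont_integrable (p : C -> R) g a b :
  {morph p : z w / z - w} -> (forall z, `|p z| <= N z) ->
  (forall t, a <= t <= b -> rcont g t) ->
  mu.-integrable `[a, b] (EFin \o (p \o g)).
Proof.
move=> pB pN gc; apply: continuous_compact_integrable; first exact: segment_compact.
apply: continuous_in_subspaceT => t /set_mem /=; rewrite in_itv/= => tab.
apply/cvgrPdist_le => /= e e0; have [d d0 dP] := gc t tab e e0.
near=> s; rewrite -pB; apply: le_trans (pN _) _; rewrite normcBC; apply: dP.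
by near: s; exists d => //= s /=; rewrite distrC.
Unshelve. all: by end_near. Qed.

Lemma Re_integrable g a b : (forall t, a <= t <= b -> rcont g t) ->
  mu.-integrable `[a, b] (EFin \o (Re \o g)).
Proof. by apply: rcont_integrable => [[? ?] [? ?]|z] //; exact: normc_Re. Qed.

Lemma Im_integrable g a b : (forall t, a <= t <= b -> rcont g t) ->
  mu.-integrable `[a, b] (EFin \o (Im \o g)).
Proof. by apply: rcont_integrable => [[? ?] [? ?]|z] //; exact: normc_Im. Qed.

Definition cint g a b : C :=
  ((\int[mu]_(t in `[a, b]) Re (g t)) +i* (\int[mu]_(t in `[a, b]) Im (g t)))%C.

Lemma eq_cint g h a b : (forall t, a <= t <= b -> g t = h t) -> cint g a b = cint h a b.
Proof.
by move=> gh; congr Complex; apply: eq_Rintegral => t /set_mem/=;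
  rewrite in_itv/= => /gh ->.
Qed.

Lemma cintD g h a b : (forall t, a <= t <= b -> rcont g t) ->
  (forall t, a <= t <= b -> rcont h t) ->
  cint (fun t => g t + h t) a b = cint g a b + cint h a b.
Proof.
move=> gc hc; rewrite /cint.
rewrite -[RHS]/(Complex _ _); congr Complex; rewrite -RintegralD//;
  try exact: Re_integrable; try exact: Im_integrable;
  by apply: eq_Rintegral => t _; case: (g t) => ? ?; case: (h t).
Qed.

Lemma cintZ (k : C) g a b : (forall t, a <= t <= b -> rcont g t) ->
  cint (fun t => k * g t) a b = k * cint g a b.
Proof.
move=> gc; case: k => x y; rewrite /cint -[RHS]/(Complex _ _).
have iR := Re_integrable gc; have iI := Im_integrable gc.
have iZ (p : R -> R) r : mu.-integrable `[a, b] (EFin \o p) ->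
    mu.-integrable `[a, b] (EFin \o (fun t => r * p t)).
  move=> ip; rewrite (_ : _ \o _ = fun x => (r%:E * (EFin \o p) x)%E).
    by apply: integrableZl.
  by apply/funext => t /=; rewrite EFinM.
congr Complex; rewrite -!RintegralZl// -?RintegralB -?RintegralD//; try exact: iZ.
- by apply: eq_Rintegral => t _; case: (g t).
- by apply: eq_Rintegral => t _; case: (g t).
Qed.

Lemma cint_split m g a b : (forall t, a <= t <= b -> rcont g t) -> a <= m <= b ->
  cint g a b = cint g a m + cint g m b.
Proof.
move=> gc /andP[am mb].
have sp (p : R -> R) : mu.-integrable `[a, b] (EFin \o p) ->
    \int[mu]_(t in `[a, b]) p t =
    \int[mu]_(t in `[a, m]) p t + \int[mu]_(t in `[m, b]) p t.
  move=> ip; have := @Rintegral_itvB R p (BLeft a) (BRight b) m ip.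
  rewrite !bnd_simp => /(_ am mb); rewrite Rintegral_itv_obnd_cbnd.
    by move=> <-; rewrite addrC subrK.
  by apply: integrableS ip => //; apply: subset_itvr; rewrite bnd_simp.
rewrite /cint -[RHS]/(Complex _ _); congr Complex; apply: sp.
  exact: Re_integrable.
exact: Im_integrable.
Qed.

Lemma Rint_cst (r a b : R) : a <= b -> \int[mu]_(t in `[a, b]) r = r * (b - a).
Proof.
move=> ab; rewrite Rintegral_cst//= lebesgue_measure_itv/= lte_fin.
have [//|ba] := ltP a b.
rewrite (_ : b = a) /= ?subrr ?mulr0//.
by apply/eqP; rewrite eq_le ab ba.
Qed.

Lemma cint_cst (k : C) a b : a <= b -> cint (fun=> k) a b = k * (b - a)%:C%C.
Proof.
move=> ab; rewrite /cint !Rint_cst//; case: k => x y; apply/eqP.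
by rewrite eq_complex/= !mulr0 subr0 add0r !eqxx.
Qed.

Lemma rcont_cst (r : C) t : rcont (fun=> r) t.
Proof. by move=> e e0; exists 1 => // s _; rewrite subrr normc0 ltW. Qed.

Lemma cint_Im_ge (d : R) g a b : a <= b -> (forall t, a <= t <= b -> rcont g t) ->
  (forall t, a <= t <= b -> d <= Im (g t)) -> d * (b - a) <= Im (cint g a b).
Proof.
move=> ab gc gd; rewrite -Rint_cst//=; apply: le_Rintegral => //.
- by apply: (@Im_integrable (fun=> 0 +i* d)%C) => t _; exact: rcont_cst.
- exact: Im_integrable.
all: by move=> t /=; rewrite in_itv/=; exact: gd.
Qed.

Lemma Rint_norm (p : R -> R) (M : R) a b : a <= b ->
  mu.-integrable `[a, b] (EFin \o p) ->
  (forall t, a <= t <= b -> `|p t| <= M) ->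
  `|\int[mu]_(t in `[a, b]) p t| <= M * (b - a).
Proof.
move=> ab ip pM; apply: le_trans (le_normr_Rintegral _ ip) _ => //.
rewrite -Rint_cst//; apply: le_Rintegral => //.
- exact: integrable_norm ip.
- by have := @Re_integrable (fun=> M +i* 0)%C a b (fun t _ => rcont_cst _ t).
all: by move=> t /=; rewrite in_itv/=; exact: pM.
Qed.

Lemma cint_norm (M : R) g a b : a <= b -> (forall t, a <= t <= b -> rcont g t) ->
  (forall t, a <= t <= b -> N (g t) <= M) -> N (cint g a b) <= 2 * M * (b - a).
Proof.
move=> ab gc gM; apply: le_trans (normc_le_ReIm _) _.
rewrite (_ : 2 * M * (b - a) = M * (b - a) + M * (b - a)); last by ring.
apply: lerD; apply: Rint_norm => //; try exact: Re_integrable;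
  try exact: Im_integrable.
- by move=> t tab; apply: le_trans (normc_Re _) (gM t tab).
- by move=> t tab; apply: le_trans (normc_Im _) (gM t tab).
Qed.

End Contour.

(** * Boundary integrals and nested rectangles *)

Section Rectangle.
Variable R : realType.
Local Notation C := (Cplx R).
Local Notation N := (@normc R).
Local Notation Re := (@complex.Re R).
Local Notation Im := (@complex.Im R).
Implicit Types (f g : C -> C) (x y t : R).

Definition rect x0 x1 y0 y1 : pred C :=
  fun z => (x0 <= Re z <= x1) && (y0 <= Im z <= y1).
Definition brect x0 x1 y0 y1 : pred C :=
  fun z => rect x0 x1 y0 y1 z &&
           [|| Re z == x0, Re z == x1, Im z == y0 | Im z == y1].

(* Contour integral over the boundary of a rectangle.  Opposite sides are paired,
   so that affine integrands cancel pointwise (lemma [rint_affine]). *)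
Definition rint f x0 x1 y0 y1 : C :=
  cint (fun t => f (t +i* y0)%C - f (t +i* y1)%C) x0 x1 +
  ('i%C : C) * cint (fun t => f (x1 +i* t)%C - f (x0 +i* t)%C) y0 y1.

Lemma rcontB (g h : R -> C) t : rcont g t -> rcont h t ->
  rcont (fun s => g s - h s) t.
Proof.
move=> gc hc e e0.
have [d1 d10 D1] := gc (e / 2) ltac:(by rewrite divr_gt0).
have [d2 d20 D2] := hc (e / 2) ltac:(by rewrite divr_gt0).
exists (Num.min d1 d2); rewrite ?lt_min ?d10// => s.
rewrite lt_min => /andP[/D1 H1 /D2 H2].
rewrite (_ : _ - _ = (g s - g t) - (h s - h t)); last by rewrite opprD opprK; ring.
by have := le_normcD (g s - g t) (- (h s - h t)); rewrite normcN; lra.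
Qed.

Lemma ccont_h f t y : ccont f (t +i* y)%C -> rcont (fun s => f (s +i* y)%C) t.
Proof.
move=> fc e e0; have [d d0 dP] := fc e e0; exists d => // s sd; apply: dP.
by rewrite [_ - _](_ : _ = (s - t)%:C%C) ?normc_real//; apply/eqP;
  rewrite eq_complex/= subrr !eqxx.
Qed.

Lemma ccont_v f x t : ccont f (x +i* t)%C -> rcont (fun s => f (x +i* s)%C) t.
Proof.
move=> fc e e0; have [d d0 dP] := fc e e0; exists d => // s sd; apply: dP.
rewrite [_ - _](_ : _ = (0 +i* (s - t))%C) /= ?expr0n ?add0r ?sqrtr_sqr//.
by apply/eqP; rewrite eq_complex/= subrr !eqxx.
Qed.

Section Fixed.
Variables (x0 x1 y0 y1 : R).
Hypotheses (x01 : x0 <= x1) (y01 : y0 <= y1).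

Lemma brect_S t : x0 <= t <= x1 -> brect x0 x1 y0 y1 (t +i* y0)%C.
Proof. by move=> ht; rewrite /brect /rect/= ht lexx y01 eqxx !orbT. Qed.
Lemma brect_N t : x0 <= t <= x1 -> brect x0 x1 y0 y1 (t +i* y1)%C.
Proof. by move=> ht; rewrite /brect /rect/= ht lexx y01 eqxx !orbT. Qed.
Lemma brect_W t : y0 <= t <= y1 -> brect x0 x1 y0 y1 (x0 +i* t)%C.
Proof. by move=> ht; rewrite /brect /rect/= ht lexx x01 eqxx. Qed.
Lemma brect_E t : y0 <= t <= y1 -> brect x0 x1 y0 y1 (x1 +i* t)%C.
Proof. by move=> ht; rewrite /brect /rect/= ht lexx x01 eqxx orbT. Qed.

Definition bcont f := forall z, brect x0 x1 y0 y1 z -> ccont f z.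

Lemma bcont_h f : bcont f -> forall t, x0 <= t <= x1 ->
  rcont (fun t => f (t +i* y0)%C - f (t +i* y1)%C) t.
Proof.
move=> fc t ht; apply: (@rcontB (fun t => f (t +i* y0)%C) (fun t => f (t +i* y1)%C));
  apply: ccont_h; apply: fc; [exact: brect_S|exact: brect_N].
Qed.

Lemma bcont_v f : bcont f -> forall t, y0 <= t <= y1 ->
  rcont (fun t => f (x1 +i* t)%C - f (x0 +i* t)%C) t.
Proof.
move=> fc t ht; apply: (@rcontB (fun t => f (x1 +i* t)%C) (fun t => f (x0 +i* t)%C));
  apply: ccont_v; apply: fc; [exact: brect_E|exact: brect_W].
Qed.

Lemma eq_rint f g : (forall z, brect x0 x1 y0 y1 z -> f z = g z) ->
  rint f x0 x1 y0 y1 = rint g x0 x1 y0 y1.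
Proof.
move=> fg; congr (_ + _ * _); apply: eq_cint => t ht; congr (_ - _); apply: fg.
- exact: brect_S.
- exact: brect_N.
- exact: brect_E.
- exact: brect_W.
Qed.

Lemma rintD f g : bcont f -> bcont g ->
  rint (fun z => f z + g z) x0 x1 y0 y1 = rint f x0 x1 y0 y1 + rint g x0 x1 y0 y1.
Proof.
move=> fc gc; rewrite /rint [RHS]addrACA -mulrDr; congr (_ + _ * _).
- rewrite -cintD; [|exact: bcont_h|exact: bcont_h].
  by apply: eq_cint => t _; rewrite opprD addrACA.
- rewrite -cintD; [|exact: bcont_v|exact: bcont_v].
  by apply: eq_cint => t _; rewrite opprD addrACA.
Qed.

Lemma rintZ (k : C) f : bcont f ->
  rint (fun z => k * f z) x0 x1 y0 y1 = k * rint f x0 x1 y0 y1.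
Proof.
move=> fc; rewrite /rint mulrDr [k * (_ * _)]mulrCA; congr (_ + _ * _).
- rewrite -cintZ; last exact: bcont_h.
  by apply: eq_cint => t _; rewrite mulrBr.
- rewrite -cintZ; last exact: bcont_v.
  by apply: eq_cint => t _; rewrite mulrBr.
Qed.

Lemma normc_i : N ('i%C : C) = 1.
Proof. by rewrite /= expr0n expr1n add0r sqrtr1. Qed.

(** The constant 4 is 2 for the pair of opposite sides times 2 from [cint_norm]. *)
Lemma rint_norm (M : R) f : bcont f ->
  (forall z, brect x0 x1 y0 y1 z -> N (f z) <= M) ->
  N (rint f x0 x1 y0 y1) <= 4 * M * ((x1 - x0) + (y1 - y0)).
Proof.
move=> fc fM; apply: le_trans (le_normcD _ _) _; rewrite normcM normc_i mul1r.
have B (u v : C) : N u <= M -> N v <= M -> N (u - v) <= 2 * M.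
  by move=> uM vM; have := le_normcD u (- v); rewrite normcN; lra.
rewrite mulrDr; apply: lerD.
- rewrite (_ : 4 * M = 2 * (2 * M)); last by ring.
  apply: cint_norm => //; first exact: bcont_h.
  by move=> t ht; apply: B; apply: fM; [exact: brect_S|exact: brect_N].
- rewrite (_ : 4 * M = 2 * (2 * M)); last by ring.
  apply: cint_norm => //; first exact: bcont_v.
  by move=> t ht; apply: B; apply: fM; [exact: brect_E|exact: brect_W].
Qed.

Lemma rint_affine (k l : C) : rint (fun z => k + l * z) x0 x1 y0 y1 = 0.
Proof.
rewrite /rint.
rewrite (@eq_cint _ _ (fun=> l * (0 +i* (y0 - y1))%C)); last first.
  move=> t _; rewrite opprD addrACA subrr add0r -mulrBr; congr (_ * _).
  by apply/eqP; rewrite eq_complex/= subrr !eqxx.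
rewrite (@eq_cint _ (fun t => _ - _) (fun=> l * (x1 - x0)%:C%C)); last first.
  move=> t _; rewrite opprD addrACA subrr add0r -mulrBr; congr (_ * _).
  by apply/eqP; rewrite eq_complex/= subrr !eqxx.
rewrite !cint_cst//; case: l => u v; apply/eqP; rewrite eq_complex/=.
by apply/andP; split; apply/eqP; ring.
Qed.

End Fixed.

Lemma rint_vsplit m f x0 x1 y0 y1 : y0 <= y1 -> x0 <= m <= x1 ->
  (forall z, rect x0 x1 y0 y1 z -> ccont f z) ->
  rint f x0 x1 y0 y1 = rint f x0 m y0 y1 + rint f m x1 y0 y1.
Proof.
move=> y01 /andP[xm mx] fc; have x01 := le_trans xm mx.
have bc : bcont x0 x1 y0 y1 f by move=> z /andP[/fc].
rewrite /rint (@cint_split _ m); [|by move=> t; apply: bcont_h|by rewrite xm].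
rewrite [RHS]addrACA -mulrDr -cintD.
- by congr (_ + _ * _); apply: eq_cint => t _; rewrite [RHS]addrC subrKA.
- apply: bcont_v => // z /andP[/andP[/andP[a b] c] _]; apply: fc.
  by rewrite /rect c a (le_trans b).
- apply: bcont_v => // z /andP[/andP[/andP[a b] c] _]; apply: fc.
  by rewrite /rect c b (le_trans _ a).
Qed.

Lemma rint_hsplit m f x0 x1 y0 y1 : x0 <= x1 -> y0 <= m <= y1 ->
  (forall z, rect x0 x1 y0 y1 z -> ccont f z) ->
  rint f x0 x1 y0 y1 = rint f x0 x1 y0 m + rint f x0 x1 m y1.
Proof.
move=> x01 /andP[ym my] fc; have y01 := le_trans ym my.
have bc : bcont x0 x1 y0 y1 f by move=> z /andP[/fc].
rewrite /rint [in X in _ + X](@cint_split _ m); [|by move=> t; apply: bcont_v|by rewrite ym].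
rewrite [RHS]addrACA mulrDr -cintD.
- by congr (_ + _); apply: eq_cint => t _; rewrite subrKA.
- apply: bcont_h => // z /andP[/andP[c /andP[a b]] _]; apply: fc.
  by rewrite /rect c a (le_trans b).
- apply: bcont_h => // z /andP[/andP[c /andP[a b]] _]; apply: fc.
  by rewrite /rect c b (le_trans _ a).
Qed.

(** [P x y n] speaks of the rectangle with lower left corner [(x, y)] and sides [w / 2 ^+ n],
    [h / 2 ^+ n]; the limit of the corners lies in all rectangles of the sequence. With [h = 0] this
    is bisection of a segment. *)
Lemma nested_quarters (P : R -> R -> nat -> Prop) (w h x0 y0 : R) :
  0 <= w -> 0 <= h -> P x0 y0 0%N ->
  (forall x y n, P x y n -> exists x' y', [/\ P x' y' n.+1,
     x <= x' <= x + w / 2 ^+ n.+1 & y <= y' <= y + h / 2 ^+ n.+1]) ->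
  exists qx qy, forall n, exists x y, [/\ P x y n,
     x <= qx <= x + w / 2 ^+ n & y <= qy <= y + h / 2 ^+ n].
Proof.
move=> w0 h0 P0 step.
(* The level and the proof of [P] belong to the state, so that one choice function can be
   iterated. *)
pose T := {p : R * R * nat | P p.1.1 p.1.2 p.2}.
have st (t : T) : exists t' : T, (sval t').2 = (sval t).2.+1 /\
   ((sval t).1.1 <= (sval t').1.1 <= (sval t).1.1 + w / 2 ^+ (sval t).2.+1 /\
   (sval t).1.2 <= (sval t').1.2 <= (sval t).1.2 + h / 2 ^+ (sval t).2.+1).
  case: t => -[[x y] n] /= p.
  have [x' [y' [p' hx hy]]] := step _ _ _ p.
  by exists (exist _ ((x', y'), n.+1) p').
have [st' Hst] := choice st.
pose s := fix s n : T := if n is n'.+1 then st' (s n') else exist _ ((x0, y0), 0%N) P0.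
have sn n : (sval (s n)).2 = n.
  by elim: n => // n IH; rewrite /= (proj1 (Hst (s n))) IH.
(* In each coordinate the left ends increase and the right ends decrease, so the supremum of the
   left ends lies in every interval. *)
have gen (X : nat -> R) (v : R) : 0 <= v ->
    (forall n, X n <= X n.+1 <= X n + v / 2 ^+ n.+1) ->
    exists q, forall n, X n <= q <= X n + v / 2 ^+ n.
  move=> v0 HX.
  have mono n k : X n <= X (n + k)%N.
    elim: k => [|k IH]; first by rewrite addn0.
    by rewrite addnS (le_trans IH)//; case/andP: (HX (n + k)%N).
  have ub n k : X (n + k)%N + v / 2 ^+ (n + k) <= X n + v / 2 ^+ n.
    elim: k => [|k IH]; first by rewrite addn0.
    rewrite addnS (le_trans _ IH)//; case/andP: (HX (n + k)%N) => _ H.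
    have -> : v / 2 ^+ (n + k) = v / 2 ^+ (n + k).+1 + v / 2 ^+ (n + k).+1.
      by rewrite exprS; field; rewrite expf_neq0.
    by rewrite addrA lerD2r.
  have le m n : X m <= X n + v / 2 ^+ n.
    have [mn|nm] := leqP m n.
      rewrite -(subnKC mn) (le_trans (mono m (n - m)%N))// lerDl.
      by rewrite divr_ge0// exprn_ge0.
    rewrite -(subnKC (ltnW nm)); apply: le_trans (ub n (m - n)%N).
    by rewrite lerDl divr_ge0// exprn_ge0.
  exists (sup (range X)) => n; apply/andP; split.
    apply: ub_le_sup; last by exists n.
    by exists (X 0%N + v / 2 ^+ 0) => _ [m _ <-].
  by apply: ge_sup; [by exists (X 0%N), 0%N|move=> _ [m _ <-]].
have S n : ((sval (s n)).1.1 <= (sval (s n.+1)).1.1 <= (sval (s n)).1.1 + w / 2 ^+ n.+1) /\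
    ((sval (s n)).1.2 <= (sval (s n.+1)).1.2 <= (sval (s n)).1.2 + h / 2 ^+ n.+1).
  by have := proj2 (Hst (s n)); rewrite sn.
have [qx Hx] := gen (fun n => (sval (s n)).1.1) w w0 (fun n => proj1 (S n)).
have [qy Hy] := gen (fun n => (sval (s n)).1.2) h h0 (fun n => proj2 (S n)).
exists qx, qy => n; exists (sval (s n)).1.1, (sval (s n)).1.2; split => //.
by have := svalP (s n); rewrite sn.
Qed.

End Rectangle.

(** * Cauchy theory *)

Section CauchyTheory.
Variable R : realType.
Local Notation C := (Cplx R).
Local Notation N := (@normc R).
Local Notation Re := (@complex.Re R).
Local Notation Im := (@complex.Im R).
Implicit Types (f g : C -> C) (x y t u v : R).

Lemma cderD f g z a b : cder f z a -> cder g z b -> cder (fun w => f w + g w) z (a + b).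
Proof. by rewrite -!is_derive_cder => fa gb; exact: is_deriveD. Qed.

Lemma cderN f z a : cder f z a -> cder (fun w => - f w) z (- a).
Proof. by rewrite -!is_derive_cder => fa; exact: is_deriveN. Qed.

Lemma cderB f g z a b : cder f z a -> cder g z b -> cder (fun w => f w - g w) z (a - b).
Proof. by move=> fa gb; apply: cderD => //; exact: cderN. Qed.

Lemma cder_cst (k : C) z : cder (fun=> k) z 0.
Proof. by rewrite -is_derive_cder; exact: is_derive_cst. Qed.

Lemma cder_id (z : C) : cder (fun w => w) z 1.
Proof. by rewrite -is_derive_cder; exact: is_derive_id. Qed.

Lemma cderM f g z a b : cder f z a -> cder g z b ->
  cder (fun w => f w * g w) z (f z * b + g z * a).
Proof. by rewrite -!is_derive_cder => fa gb; exact: is_deriveM. Qed.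

Lemma cderV f z a : f z != 0 -> cder f z a -> cder (fun w => (f w)^-1) z (- a / f z ^+ 2).
Proof.
rewrite -!is_derive_cder => f0 [fd fa]; split; first exact: derivableV.
by rewrite deriveV// fa; rewrite [LHS]mulrC mulrN mulNr.
Qed.

Lemma cder_near f g z a : (exists2 d : R, 0 < d & forall w, N (w - z) < d -> f w = g w) ->
  cder g z a -> cder f z a.
Proof.
move=> [d d0 fg] ga e e0; have [d' d'0 H] := ga e e0.
exists (Num.min d d'); first by rewrite lt_min d0.
move=> w; rewrite lt_min => /andP[/fg -> /H]; rewrite fg//.
by rewrite subrr normc0.
Qed.

Lemma cder_unique f z a b : cder f z a -> cder f z b -> a = b.
Proof. by rewrite -!is_derive_cder => -[_ <-] [_ <-]. Qed.

Lemma cder_exprn f z l n : cder f z l ->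
  cder (fun w => f w ^+ n) z (n%:R * f z ^+ n.-1 * l).
Proof.
move=> fd; elim: n => [|n IH].
  by rewrite mul0r mul0r; exact: cder_cst.
have := cderM fd IH.
rewrite (_ : _ + _ = n.+1%:R * f z ^+ n.+1.-1 * l).
  by apply: cder_near; exists 1 => // w _; rewrite exprS.
case: n {IH} => [|n] /=; first by rewrite !mul0r !mulr0 expr0 add0r !mul1r.
by rewrite -[n.+2%:R]natr1 !exprS; ring.
Qed.

Definition cderivable f z := exists l, cder f z l.

Lemma cderivable_ccont f z : cderivable f z -> ccont f z.
Proof. by move=> [l]; exact: cder_ccont. Qed.

Lemma cderivable_affine (k l : C) z : cderivable (fun z => k + l * z) z.
Proof.
exists (0 + (l * 1 + z * 0)); apply: cderD; first exact: cder_cst.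
by apply: cderM; [exact: cder_cst|exact: cder_id].
Qed.

Lemma ex_half_pow (K d : R) : 0 < d -> exists n, K / 2 ^+ n < d.
Proof.
move=> d0; exists (Num.bound (K / d)); rewrite ltr_pdivrMr ?exprn_gt0//.
rewrite mulrC -ltr_pdivrMr//.
have [/archi_boundP H|H] := leP 0 (K / d); last by rewrite (lt_le_trans H)// exprn_ge0.
apply: lt_trans H _; rewrite -natrX ltr_nat; exact: ltn_expl.
Qed.

(** The integrals over the four quarters add up to the whole, so one of them exceeds a quarter of
    the bound. *)
Lemma rint_quarter f x u y v (e : R) : 0 <= u -> 0 <= v ->
  (forall z, rect x (x + (u + u)) y (y + (v + v)) z -> ccont f z) ->
  e * 4 < N (rint f x (x + (u + u)) y (y + (v + v))) ->
  exists x' y', [/\ e < N (rint f x' (x' + u) y' (y' + v)),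
    x' = x \/ x' = x + u & y' = y \/ y' = y + v].
Proof.
move=> u0 v0 fc.
rewrite (@rint_vsplit _ (x + u)) //; last 2 first.
- by rewrite lerDl addr_ge0.
- by rewrite lerDl u0 addrA lerDl.
rewrite (@rint_hsplit _ (y + v)) //; last 3 first.
- by rewrite lerDl.
- by rewrite lerDl v0 addrA lerDl.
- by move=> z /andP[/andP[a b] c]; apply: fc; rewrite /rect a c (le_trans b)// addrA lerDl.
rewrite (@rint_hsplit _ (y + v) _ (x + u)) //; last 3 first.
- by rewrite addrA lerDl.
- by rewrite lerDl v0 addrA lerDl.
- by move=> z /andP[/andP[a b] c]; apply: fc; rewrite /rect b c (le_trans _ a)// lerDl.
rewrite [x + (u + u)]addrA [y + (v + v)]addrA addrA.
set A := rint f x (x + u) y (y + v); set B := rint f x (x + u) (y + v) (y + v + v).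
set D := rint f (x + u) (x + u + u) y (y + v).
set E := rint f (x + u) (x + u + u) (y + v) (y + v + v) => H.
have [hA|hA] := ltP e (N A); first by exists x, y; split; auto.
have [hB|hB] := ltP e (N B); first by exists x, (y + v); split; auto.
have [hD|hD] := ltP e (N D); first by exists (x + u), y; split; auto.
have [hE|hE] := ltP e (N E); first by exists (x + u), (y + v); split; auto.
have := le_normcD (A + B + D) E; have := le_normcD (A + B) D; have := le_normcD A B.
by move: H hA hB hD hE; lra.
Qed.

(* Repeated quartering: a nonzero integral would survive, relative to the squared
   size of the rectangles, up to a point where [f] is affine to first order. *)
Lemma goursat f x0 x1 y0 y1 : x0 <= x1 -> y0 <= y1 ->
  (forall z, rect x0 x1 y0 y1 z -> cderivable f z) -> rint f x0 x1 y0 y1 = 0.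
Proof.
move=> x01 y01 fd.
have fc z : rect x0 x1 y0 y1 z -> ccont f z by move=> /fd/cderivable_ccont.
apply: eq0_normc; apply/eqP; rewrite eq_le normc_ge0 andbT leNgt; apply/negP => H.
pose w := x1 - x0; pose h := y1 - y0; pose K := w + h + 1.
have w0 : 0 <= w by rewrite subr_ge0.
have h0 : 0 <= h by rewrite subr_ge0.
have K0 : 0 < K by rewrite ltr_wpDl// addr_ge0.
(* The 2 makes the inequality in [P] strict at level 0; the 1 in [K] keeps [K] positive for a
   degenerate rectangle. *)
pose e := N (rint f x0 x1 y0 y1) / (2 * K ^+ 2).
have e0 : 0 < e by rewrite divr_gt0// mulr_gt0// exprn_gt0.
pose P x y n := [/\ x0 <= x, x + w / 2 ^+ n <= x1, y0 <= y, y + h / 2 ^+ n <= y1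
  & e * (K / 2 ^+ n) ^+ 2 < N (rint f x (x + w / 2 ^+ n) y (y + h / 2 ^+ n))].
have half (a : R) n : a / 2 ^+ n = a / 2 ^+ n.+1 + a / 2 ^+ n.+1.
  by rewrite exprS; field; rewrite expf_neq0.
have [||||qx [qy Q]] := @nested_quarters _ P w h x0 y0 => //.
- rewrite /P !expr0 !divr1 /w /h ![_ + (_ - _)]addrC !subrK; split => //.
  rewrite (_ : e * _ = N (rint f x0 x1 y0 y1) / 2); last first.
    by rewrite /e; field; rewrite gt_eqF.
  by rewrite ltr_pdivrMr// ltr_pMr// ltr1n.
- move=> x y n [xl xr yl yr B].
  have u0 : 0 <= w / 2 ^+ n.+1 by rewrite divr_ge0// exprn_ge0.
  have v0 : 0 <= h / 2 ^+ n.+1 by rewrite divr_ge0// exprn_ge0.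
  move: xr yr B; rewrite (half w) (half h) (half K) => xr yr B.
  have [||x' [y' [B' hx hy]]] := @rint_quarter f x _ y _ (e * (K / 2 ^+ n.+1) ^+ 2) u0 v0.
  + move=> z /andP[/andP[a b] /andP[c d]]; apply: fc; apply/andP; split; apply/andP; split.
    * exact: le_trans a.
    * exact: le_trans xr.
    * exact: le_trans c.
    * exact: le_trans yr.
  + by apply: le_lt_trans B; rewrite le_eqVlt; apply/orP; left; apply/eqP; ring.
  exists x', y'; split; first split => //.
  + by case: hx => ->; lra.
  + by case: hx => ->; lra.
  + by case: hy => ->; lra.
  + by case: hy => ->; lra.
  + by case: hx => ->; apply/andP; split; lra.
  + by case: hy => ->; apply/andP; split; lra.
have q0 : rect x0 x1 y0 y1 (qx +i* qy)%C.
  have [x [y [[xl xr yl yr _] /andP[a b] /andP[c d]]]] := Q 0%N.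
  by apply/andP; split; apply/andP; split => /=; lra.
have [l fl] := fd _ q0.
(* The quarter absorbs the constant of [rint_norm]; with [u + v <= k] the bound becomes
   [e * k ^+ 2], against [P]. *)
have [d d0 D] := fl (e / 4) ltac:(by rewrite divr_gt0).
have [n Kd] := @ex_half_pow K d d0.
have [x [y [[xl xr yl yr B] /andP[qa qb] /andP[qc qd]]]] := Q n.
set q := (qx +i* qy)%C in q0 fl D.
have u0 : 0 <= w / 2 ^+ n by rewrite divr_ge0// exprn_ge0.
have v0 : 0 <= h / 2 ^+ n by rewrite divr_ge0// exprn_ge0.
have uv : w / 2 ^+ n + h / 2 ^+ n <= K / 2 ^+ n.
  by rewrite -mulrDl ler_pM2r ?invr_gt0 ?exprn_gt0// /K lerDl.
set u := w / 2 ^+ n in xr qb B u0 uv *; set v := h / 2 ^+ n in yr qd B v0 uv *.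
set k := K / 2 ^+ n in Kd B uv *.
have bc : bcont x (x + u) y (y + v) f.
  move=> z /andP[/andP[/andP[a b] /andP[c c']] _]; apply: fc.
  by apply/andP; split; apply/andP; split; lra.
have xu : x <= x + u by rewrite lerDl.
have yv : y <= y + v by rewrite lerDl.
(* Subtracting the tangent map of [f] at [q] does not change the integral and leaves only the
   first-order remainder. *)
have E : rint (fun z => f z + ((l * q - f q) + (- l) * z)) x (x + u) y (y + v) =
    rint f x (x + u) y (y + v).
  rewrite rintD ?rint_affine ?addr0//.
  by move=> z _; exact/cderivable_ccont/cderivable_affine.
have : N (rint f x (x + u) y (y + v)) <= 4 * (e / 4 * k) * ((x + u - x) + (y + v - y)).
  rewrite -E; apply: rint_norm => //.
    move=> z zb; apply: cderivable_ccont.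
    have [m fm] : cderivable f z.
      move: zb => /andP[/andP[/andP[a b] /andP[c c']] _]; apply: fd.
      by apply/andP; split; apply/andP; split; lra.
    have [m' gm] := cderivable_affine (l * q - f q) (- l) z.
    by exists (m + m'); exact: cderD.
  move=> z /andP[/andP[/andP[a b] /andP[c c']] _].
  have zq : N (z - q) <= k.
    apply: le_trans (normc_le_ReIm _) _; apply: le_trans uv; apply: lerD.
      rewrite [Re _](_ : _ = Re z - qx); last by case: (z).
      by rewrite ler_norml; apply/andP; split; lra.
    rewrite [Im _](_ : _ = Im z - qy); last by case: (z).
    by rewrite ler_norml; apply/andP; split; lra.
  rewrite (_ : _ + _ = f z - f q - l * (z - q)); last by ring.
  apply: le_trans (D _ (le_lt_trans zq Kd)) _.
  by rewrite ler_wpM2l// divr_ge0// ltW.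
apply/negP; rewrite -ltNge; apply: le_lt_trans B.
rewrite (_ : 4 * _ * _ = e * k * (u + v)); last by field.
rewrite [k ^+ 2]expr2 [e * (k * k)]mulrA; apply: ler_wpM2l => //.
by apply: mulr_ge0; [exact: ltW|lra].
Qed.

(* By Goursat only an arbitrarily small square around [z] contributes. *)
Lemma rint_punctured f x0 x1 y0 y1 (z : C) : x0 < Re z < x1 -> y0 < Im z < y1 ->
  (forall w, rect x0 x1 y0 y1 w -> ccont f w) ->
  (forall w, rect x0 x1 y0 y1 w -> w != z -> cderivable f w) ->
  rint f x0 x1 y0 y1 = 0.
Proof.
case: z => p q /= /andP[xp px] /andP[yq qy] fc fd; set z := (p +i* q)%C : C.
have cut (s : R) : 0 < s -> x0 <= p - s -> p + s <= x1 -> y0 <= q - s -> q + s <= y1 ->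
    rint f x0 x1 y0 y1 = rint f (p - s) (p + s) (q - s) (q + s).
  move=> s0 xs sx ys sy.
  rewrite (@rint_vsplit _ (p - s)) //; [|lra|apply/andP; split; lra].
  rewrite [X in X + _]goursat ?add0r; [|lra|lra|]; last first.
    move=> w wr; apply: fd.
      by move: wr => /andP[/andP[a b] c]; rewrite /rect c a andbT/=; lra.
    by apply: contraTneq wr => ->; rewrite /rect /=; apply/negP => /andP[/andP[]]; lra.
  rewrite (@rint_vsplit _ (p + s)) //; [|lra|apply/andP; split; lra|]; last first.
    by move=> w /andP[/andP[a b] c]; apply: fc; rewrite /rect c b andbT andbT; lra.
  rewrite [X in _ + X]goursat ?addr0; [|lra|lra|]; last first.
    move=> w wr; apply: fd.
      by move: wr => /andP[/andP[a b] c]; rewrite /rect c b andbT andbT; lra.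
    by apply: contraTneq wr => ->; rewrite /rect /=; apply/negP => /andP[/andP[]]; lra.
  rewrite (@rint_hsplit _ (q - s)) //; [|lra|apply/andP; split; lra|]; last first.
    move=> w /andP[/andP[a b] c]; apply: fc; rewrite /rect c andbT.
    by apply/andP; split; lra.
  rewrite [X in X + _]goursat ?add0r; [|lra|lra|]; last first.
    move=> w wr; apply: fd.
      move: wr => /andP[/andP[a b] /andP[c d]].
      by rewrite /rect; apply/andP; split; apply/andP; split; lra.
    by apply: contraTneq wr => ->; rewrite /rect /=; apply/negP => /andP[_ /andP[]]; lra.
  rewrite (@rint_hsplit _ (q + s)) //; [|lra|apply/andP; split; lra|]; last first.
    move=> w /andP[/andP[a b] /andP[c d]]; apply: fc.
    by rewrite /rect; apply/andP; split; apply/andP; split; lra.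
  rewrite [X in _ + X]goursat ?addr0; [by []|lra|lra|].
  move=> w wr; apply: fd.
    move: wr => /andP[/andP[a b] /andP[c d]].
    by rewrite /rect; apply/andP; split; apply/andP; split; lra.
  by apply: contraTneq wr => ->; rewrite /rect /=; apply/negP => /andP[_ /andP[]]; lra.
have zr : rect x0 x1 y0 y1 z by rewrite /rect/= !ltW.
have [d d0 D] := fc z zr 1 ltr01.
pose M := N (f z) + 1.
have M0 : 0 < M by rewrite ltr_wpDl// normc_ge0.
apply: eq0_normc; apply/eqP; rewrite eq_le normc_ge0 andbT leNgt; apply/negP => H.
pose r := N (rint f x0 x1 y0 y1).
(* [d / 4] keeps the square where [f] is within 1 of [f z]; [r / (32 * M)] makes the final bound
   [16 * M * s] at most [r / 2]; the other terms keep the square inside the rectangle. *)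
pose s := Num.min (d / 4) (Num.min (r / (32 * M))
  (Num.min (Num.min (p - x0) (x1 - p)) (Num.min (q - y0) (y1 - q)))).
have s0 : 0 < s.
  by rewrite !lt_min !subr_gt0 xp px yq qy divr_gt0//= divr_gt0// mulr_gt0.
have : s <= s by []; rewrite {2}/s !le_min => /and3P[sd sr /andP[/andP[s1 s2] /andP[s3 s4]]].
have E : rint f x0 x1 y0 y1 = rint f (p - s) (p + s) (q - s) (q + s).
  by apply: cut => //; lra.
have : r <= 4 * M * ((p + s - (p - s)) + (q + s - (q - s))).
  rewrite /r E; apply: rint_norm; [lra|lra| |].
    move=> w /andP[/andP[/andP[a b] /andP[c c']] _]; apply: fc.
    by apply/andP; split; apply/andP; split; lra.
  move=> w /andP[/andP[/andP[a b] /andP[c c']] _].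
  have : N (f w - f z) <= 1.
    apply: D; apply: (@le_lt_trans _ _ (s + s)); last by move: sd d0; lra.
    apply: le_trans (normc_le_ReIm _) _; apply: lerD.
      rewrite [Re _](_ : _ = Re w - p); last by case: (w).
      by rewrite ler_norml; apply/andP; split; lra.
    rewrite [Im _](_ : _ = Im w - q); last by case: (w).
    by rewrite ler_norml; apply/andP; split; lra.
  by have := le_normcD (f w - f z) (f z); rewrite subrK /M; lra.
rewrite (_ : 4 * M * _ = 16 * M * s); last by ring.
move: sr; rewrite ler_pdivlMr ?mulr_gt0// => sr.
by move: sr H; rewrite -/r; nra.
Qed.

Definition intr x0 x1 y0 y1 (z : C) := (x0 < Re z < x1) && (y0 < Im z < y1).

Section Transform.
Variables (x0 x1 y0 y1 : R).
Local Notation rc := (rect x0 x1 y0 y1).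
Local Notation br := (brect x0 x1 y0 y1).
Local Notation inr := (intr x0 x1 y0 y1).

Lemma brect_neq z w : inr z -> br w -> w != z.
Proof.
move=> /andP[/andP[a b] /andP[c d]] /andP[_ H]; apply: contraTneq H => ->.
by rewrite !negb_or (gt_eqF a) (lt_eqF b) (gt_eqF c) (lt_eqF d).
Qed.

Lemma cderivable_inv z w : w != z -> cderivable (fun w => (w - z)^-1) w.
Proof.
rewrite -subr_eq0 => wz; eexists; apply: (@cderV (fun w => w - z)) => //.
by apply: cderB; [exact: cder_id|exact: cder_cst].
Qed.

Lemma cderivableM f g w : cderivable f w -> cderivable g w ->
  cderivable (fun w => f w * g w) w.
Proof. by move=> [a fa] [b gb]; eexists; exact: cderM fa gb. Qed.

Lemma cderivableB f g w : cderivable f w -> cderivable g w ->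
  cderivable (fun w => f w - g w) w.
Proof. by move=> [a fa] [b gb]; eexists; exact: cderB fa gb. Qed.

Lemma cderivable_cst (k : C) w : cderivable (fun=> k) w.
Proof. by exists 0; exact: cder_cst. Qed.

Lemma cderivable_pow f n w : cderivable f w -> cderivable (fun w => f w ^+ n) w.
Proof. by move=> [a fa]; eexists; exact: cder_exprn fa. Qed.

(** Cauchy integrals: for holomorphic [f] and interior [z], the values at [n = 1, 2] are classically
    f(z) and f'(z) times 2πi. *)
Definition ct f n z := rint (fun w => f w * (w - z)^-1 ^+ n) x0 x1 y0 y1.

(** The difference quotient of [f] at [z], completed by [f'(z)], is continuous and differentiable
    off [z], so its boundary integral vanishes. *)
Lemma cauchy_formula f z : inr z -> (forall w, rc w -> cderivable f w) ->
  ct f 1 z = f z * ct (fun=> 1) 1 z.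
Proof.
move=> zi fd; have /andP[zx zy] := zi.
have zr : rc z.
  by move: zx zy => /andP[a b] /andP[c d]; rewrite /rect !ltW.
have x01 : x0 <= x1 by case/andP: zx => a b; apply/ltW/(lt_trans a).
have y01 : y0 <= y1 by case/andP: zy => a b; apply/ltW/(lt_trans a).
have [l fl] := fd z zr.
pose k w := if w == z then l else (f w - f z) * (w - z)^-1.
have kd w : rc w -> w != z -> cderivable k w.
  move=> wr wz; have [m km] : cderivable (fun w => (f w - f z) * (w - z)^-1) w.
    apply: cderivableM; last exact: cderivable_inv.
    by apply: cderivableB; [exact: fd|exact: cderivable_cst].
  exists m; apply: cder_near km; exists (N (w - z)); first by rewrite normc_gt0 subr_eq0.
  move=> u uw; rewrite /k; case: eqP => // uz.
  by move: uw; rewrite uz normcBC ltxx.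
have kc w : rc w -> ccont k w.
  move=> wr; have [wz|wz] := eqVneq w z; last exact/cderivable_ccont/kd.
  rewrite wz => e e0; have [d d0 D] := fl e e0; exists d => // u ud.
  rewrite /k eqxx; case: eqVneq => uz; first by rewrite subrr normc0 ltW.
  have uz0 : u - z != 0 by rewrite subr_eq0.
  rewrite -(@ler_pM2r _ (N (u - z))) ?normc_gt0// -normcM.
  by apply: le_trans (D u ud); rewrite mulrBl mulfVK.
have K0 := rint_punctured zx zy kc kd.
have E : rint (fun w => f w * (w - z)^-1 ^+ 1 + (- f z) * (1 * (w - z)^-1 ^+ 1)) x0 x1 y0 y1 = 0.
  rewrite -K0; apply: eq_rint => // w wb.
  by rewrite /k (negbTE (brect_neq zi wb)) !expr1; ring.
move: E; rewrite rintD//; last 2 first.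
- move=> w wb; apply: cderivable_ccont; apply: cderivableM.
    by apply: fd; case/andP: wb.
  by apply: cderivable_pow; apply: cderivable_inv; exact: brect_neq wb.
- move=> w wb; apply: cderivable_ccont; apply: cderivableM; first exact: cderivable_cst.
  apply: cderivableM; first exact: cderivable_cst.
  by apply: cderivable_pow; apply: cderivable_inv; exact: brect_neq wb.
rewrite rintZ//; last first.
  move=> w wb; apply: cderivable_ccont; apply: cderivableM; first exact: cderivable_cst.
  by apply: cderivable_pow; apply: cderivable_inv; exact: brect_neq wb.
by rewrite mulNr => /eqP; rewrite subr_eq0 => /eqP.
Qed.

End Transform.

End CauchyTheory.

(** * Cauchy integrals, holomorphy of derivatives, identity principle *)

Section CauchyTransform.
Variable R : realType.
Local Notation C := (Cplx R).
Local Notation N := (@normc R).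
Local Notation Re := (@complex.Re R).
Local Notation Im := (@complex.Im R).
Implicit Types (f g : C -> C) (x y t : R) (z w u v : C).

Lemma rcont_bounded (g : R -> C) a b : (forall t, a <= t <= b -> rcont g t) ->
  exists M : R, forall t, a <= t <= b -> N (g t) <= M.
Proof.
move=> gc; have [ab|ab] := leP a b; last first.
  by exists 0 => t /andP[h1 h2]; have := le_trans h1 h2; rewrite leNgt ab.
have [|c _ cP] := @EVT_max R (fun t => N (g t)) a b ab.
  apply: continuous_in_subspaceT => t /set_mem /=; rewrite in_itv/= => tab.
  apply/cvgrPdist_le => /= e e0; have [d d0 dP] := gc t tab e e0.
  near=> s.
  have : N (g s - g t) <= e.
    by apply: dP; near: s; exists d => //= s /=; rewrite distrC.
  have := le_normcD (g s - g t) (g t); have := le_normcD (g t - g s) (g s).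
  rewrite !subrK (normcBC (g t)) => h1 h2 h3.
  by rewrite ler_norml; apply/andP; split; lra.
by exists (N (g c)) => t tab; apply: cP; rewrite in_itv.
Unshelve. all: by end_near. Qed.

Section Fixed.
Variables (x0 x1 y0 y1 : R).
Hypotheses (x01 : x0 <= x1) (y01 : y0 <= y1).
Local Notation rc := (rect x0 x1 y0 y1).
Local Notation br := (brect x0 x1 y0 y1).
Local Notation inr := (intr x0 x1 y0 y1).
Local Notation ct := (ct x0 x1 y0 y1).

Lemma bcont_bounded f : bcont x0 x1 y0 y1 f ->
  exists2 M : R, 0 <= M & forall z, br z -> N (f z) <= M.
Proof.
move=> fc.
have [M1 H1] := @rcont_bounded (fun t => f (t +i* y0)%C) x0 x1
  (fun t ht => ccont_h (fc _ (brect_S y01 ht))).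
have [M2 H2] := @rcont_bounded (fun t => f (t +i* y1)%C) x0 x1
  (fun t ht => ccont_h (fc _ (brect_N y01 ht))).
have [M3 H3] := @rcont_bounded (fun t => f (x0 +i* t)%C) y0 y1
  (fun t ht => ccont_v (fc _ (brect_W x01 ht))).
have [M4 H4] := @rcont_bounded (fun t => f (x1 +i* t)%C) y0 y1
  (fun t ht => ccont_v (fc _ (brect_E x01 ht))).
exists (`|M1| + `|M2| + `|M3| + `|M4|); first by rewrite !addr_ge0.
have := ler_norm M1; have := ler_norm M2; have := ler_norm M3; have := ler_norm M4.
have := normr_ge0 M1; have := normr_ge0 M2; have := normr_ge0 M3; have := normr_ge0 M4.
move: (`|M1|) (`|M2|) (`|M3|) (`|M4|) => m1 m2 m3 m4 a1 a2 a3 a4 b1 b2 b3 b4.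
case=> p q /andP[/andP[/= hx hy] /or4P[] /eqP E]; rewrite E.
- by have := H3 q hy; lra.
- by have := H4 q hy; lra.
- by have := H1 p hx; lra.
- by have := H2 p hx; lra.
Qed.

Lemma brect_dist z : inr z -> exists2 d : R, 0 < d & forall w, br w -> d <= N (w - z).
Proof.
case: z => p q /andP[/andP[/= a b] /andP[/= c e]].
exists (Num.min (Num.min (p - x0) (x1 - p)) (Num.min (q - y0) (y1 - q))).
  by rewrite !lt_min !subr_gt0 a b c e.
move=> [s t]; set n := N _.
have HR : `|s - p| <= n := normc_Re (((s +i* t)%C : C) - (p +i* q)%C).
have HI : `|t - q| <= n := normc_Im (((s +i* t)%C : C) - (p +i* q)%C).
clearbody n; move=> /andP[_ /or4P[] /= /eqP E]; rewrite !ge_min.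
- by move: HR; rewrite E distrC => /(le_trans (ler_norm _)) ->.
- by move: HR; rewrite E => /(le_trans (ler_norm _)) ->; rewrite orbT.
- by move: HI; rewrite E distrC => /(le_trans (ler_norm _)) ->; rewrite !orbT.
- by move: HI; rewrite E => /(le_trans (ler_norm _)) ->; rewrite !orbT.
Qed.

(** Differentiation under the integral sign: a second-order Taylor remainder of the kernel, uniform
    on the boundary, integrates to a remainder of order [N (u - z) ^+ 2]. *)
Lemma rint_kernel_cder (f : C -> C) (k : C -> C -> C) (k' : C -> C) z (r K : R) :
  0 < r -> 0 <= K -> (forall w, br w -> cderivable f w) ->
  (forall u, N (u - z) < r -> forall w, br w -> cderivable (k u) w) ->
  (forall w, br w -> cderivable k' w) ->
  (forall u, N (u - z) < r -> forall w, br w ->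
     N (k u w - k z w - k' w * (u - z)) <= K * N (u - z) ^+ 2) ->
  cder (fun u => rint (fun w => f w * k u w) x0 x1 y0 y1) z
       (rint (fun w => f w * k' w) x0 x1 y0 y1).
Proof.
move=> r0 K0 fd kd k'd kK e e0.
have [M M0 fM] : exists2 M : R, 0 <= M & forall z, br z -> N (f z) <= M.
  by apply: bcont_bounded => w /fd/cderivable_ccont.
pose P := (x1 - x0) + (y1 - y0).
have P0 : 0 <= P by rewrite addr_ge0// subr_ge0.
pose B := 4 * (M * K) * P + 1.
have B0 : 0 < B by rewrite ltr_wpDl// mulr_ge0// mulr_ge0// mulr_ge0.
exists (Num.min r (e / B)); first by rewrite lt_min r0 divr_gt0.
move=> u; rewrite lt_min => /andP[ur]; rewrite ltr_pdivlMr// => uB.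
have zr : N (z - z) < r by rewrite subrr normc0.
have fk v : N (v - z) < r -> forall w, br w -> cderivable (fun w => f w * k v w) w.
  by move=> vr w wb; apply: cderivableM; [exact: fd|exact: kd].
have fk' w : br w -> cderivable (fun w => f w * k' w) w.
  by move=> wb; apply: cderivableM; [exact: fd|exact: k'd].
have bc g : (forall w, br w -> cderivable g w) -> bcont x0 x1 y0 y1 g.
  by move=> gd w /gd/cderivable_ccont.
have cZ (a : C) g w : cderivable g w -> cderivable (fun w => a * g w) w.
  by move=> gd; apply: cderivableM => //; exact: cderivable_cst.
rewrite (_ : _ - _ - _ =
   rint (fun w => f w * k u w + ((- 1) * (f w * k z w) + (- (u - z)) * (f w * k' w)))
     x0 x1 y0 y1); last first.
  rewrite rintD//; [|exact/bc/fk|]; last first.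
    apply: bc => w wb; have [a Ha] := cZ (- 1) _ _ (fk z zr w wb).
    by have [b Hb] := cZ (- (u - z)) _ _ (fk' w wb); exists (a + b); exact: cderD.
  rewrite rintD//; [|by apply: bc => w wb; apply: cZ; exact: fk|
    by apply: bc => w wb; apply: cZ; exact: fk'].
  rewrite rintZ//; last exact/bc/fk.
  rewrite rintZ//; last exact/bc/fk'.
  by ring.
have : N (rint (fun w => f w * k u w + ((- 1) * (f w * k z w) + (- (u - z)) * (f w * k' w)))
     x0 x1 y0 y1) <= 4 * (M * (K * N (u - z) ^+ 2)) * P.
  apply: rint_norm => //.
    apply: bc => w wb; have [a Ha] := cZ (- 1) _ _ (fk z zr w wb).
    have [b Hb] := cZ (- (u - z)) _ _ (fk' w wb).
    by have [c Hc] := fk u ur w wb; exists (c + (a + b)); do 2 apply: cderD => //.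
  move=> w wb.
  rewrite (_ : _ + _ = f w * (k u w - k z w - k' w * (u - z))); last by ring.
  rewrite normcM; apply: ler_pM; rewrite ?normc_ge0 ?fM//; exact: kK.
move=> H; apply: le_trans H _.
have n0 := normc_ge0 (u - z); move: uB n0; set n := N _ => uB n0.
rewrite (_ : 4 * _ * P = 4 * (M * K) * P * n * n); last by ring.
rewrite ler_wpM2r//; apply: le_trans (ltW uB); rewrite mulrC ler_wpM2l//.
by rewrite /B lerDl.
Qed.

Lemma ct1_cder f z : inr z -> (forall w, br w -> cderivable f w) ->
  cder (ct f 1) z (ct f 2 z).
Proof.
move=> zi fd; have [d d0 D] := brect_dist zi.
have dd w u : br w -> N (u - z) < d / 2 -> d / 2 <= N (w - u).
  by move=> /D wd ud; have := normcB3 u w z; lra.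
have nz w u : br w -> N (u - z) < d / 2 -> w != u.
  move=> wb uz; rewrite -subr_eq0 -normc_gt0.
  by apply: lt_le_trans (dd w u wb uz); rewrite divr_gt0.
have zz : N (z - z) < d / 2 by rewrite subrr normc0 divr_gt0.
(* The Taylor remainder is (u - z)^2 / ((w - z)^2 (w - u)), and each of the three factors below has
   modulus at least [d / 2]. *)
apply: (@rint_kernel_cder f (fun u w => (w - u)^-1 ^+ 1) (fun w => (w - z)^-1 ^+ 2)
   z (d / 2) ((2 / d) ^+ 3)) => //.
- by rewrite divr_gt0.
- by rewrite exprn_ge0// divr_ge0// ltW.
- by move=> u uz w wb; apply: cderivable_pow; apply: cderivable_inv; exact: nz.
- by move=> w wb; apply: cderivable_pow; apply: cderivable_inv; exact: nz.
move=> u uz w wb.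
have wu := nz w u wb uz; have wz := nz w z wb zz.
rewrite (_ : _ - _ - _ = ((w - z)^-1 ^+ 2 * (w - u)^-1) * (u - z) ^+ 2); last first.
  by rewrite expr1; field; rewrite !subr_eq0 wz wu.
rewrite normcM [N (_ ^+ 2)]normcX; apply: ler_wpM2r; first by rewrite exprn_ge0// normc_ge0.
have inv v : N (v - z) < d / 2 -> N (w - v)^-1 <= 2 / d.
  move=> vz; rewrite normcV -[2 / d]invrK invf_div lef_pV2; first exact: dd.
    by rewrite posrE normc_gt0 subr_eq0 nz.
  by rewrite posrE divr_gt0.
rewrite normcM normcX [(2 / d) ^+ 3]exprSr; apply: ler_pM; rewrite ?exprn_ge0 ?normc_ge0 ?inv//.
by rewrite lerXn2r ?nnegrE ?normc_ge0 ?inv// divr_ge0// ltW.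
Qed.

Lemma ct2_cder f z : inr z -> (forall w, br w -> cderivable f w) ->
  cder (ct f 2) z (rint (fun w => f w * (2 * (w - z)^-1 ^+ 3)) x0 x1 y0 y1).
Proof.
move=> zi fd; have [d d0 D] := brect_dist zi.
have dd w u : br w -> N (u - z) < d / 2 -> d / 2 <= N (w - u).
  by move=> /D wd ud; have := normcB3 u w z; lra.
have nz w u : br w -> N (u - z) < d / 2 -> w != u.
  move=> wb uz; rewrite -subr_eq0 -normc_gt0.
  by apply: lt_le_trans (dd w u wb uz); rewrite divr_gt0.
have zz : N (z - z) < d / 2 by rewrite subrr normc0 divr_gt0.
(* Here the remainder divided by (u - z)^2 has two terms of degree -4 with weights 1 and 2, whence
   the factor 3. *)
apply: (@rint_kernel_cder f (fun u w => (w - u)^-1 ^+ 2)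
   (fun w => 2 * (w - z)^-1 ^+ 3) z (d / 2) (3 * (2 / d) ^+ 4)) => //.
- by rewrite divr_gt0.
- by rewrite mulr_ge0// exprn_ge0// divr_ge0// ltW.
- by move=> u uz w wb; apply: cderivable_pow; apply: cderivable_inv; exact: nz.
- move=> w wb; apply: cderivableM; first exact: cderivable_cst.
  by apply: cderivable_pow; apply: cderivable_inv; exact: nz.
move=> u uz w wb.
have wu := nz w u wb uz; have wz := nz w z wb zz.
rewrite (_ : _ - _ - _ = ((w - z)^-1 ^+ 2 * (w - u)^-1 ^+ 2 +
    2 * (w - z)^-1 ^+ 3 * (w - u)^-1 ) * (u - z) ^+ 2); last first.
  by field; rewrite !subr_eq0 wz wu.
rewrite normcM [N (_ ^+ 2) in X in X <= _]normcX.
apply: ler_wpM2r; first by rewrite exprn_ge0// normc_ge0.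
have inv v : N (v - z) < d / 2 -> N (w - v)^-1 <= 2 / d.
  move=> vz; rewrite normcV -[2 / d]invrK invf_div lef_pV2; first exact: dd.
    by rewrite posrE normc_gt0 subr_eq0 nz.
  by rewrite posrE divr_gt0.
have d2 : 0 <= 2 / d by rewrite divr_ge0// ltW.
have invX v n : N (v - z) < d / 2 -> N ((w - v)^-1 ^+ n) <= (2 / d) ^+ n.
  by move=> vz; rewrite normcX lerXn2r ?nnegrE ?normc_ge0 ?inv.
apply: le_trans (le_normcD _ _) _.
have -> : 3 * (2 / d) ^+ 4 = (2 / d) ^+ 2 * (2 / d) ^+ 2 + 2 * (2 / d) ^+ 3 * (2 / d) by ring.
apply: lerD.
  by rewrite normcM; apply: ler_pM; rewrite ?normc_ge0 ?invX.
rewrite normcM; apply: ler_pM; rewrite ?normc_ge0 ?inv//.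
rewrite normcM; apply: ler_pM; rewrite ?normc_ge0 ?invX//.
by rewrite (normc_nat _ 2).
Qed.

(** Its imaginary part is positive: no side contributes negatively, and on the bottom side the
    integrand has imaginary part at least (q - y0)/D, where [D] is the squared diagonal. *)
Lemma winding_neq0 z : inr z -> ct (fun=> 1) 1 z != 0.
Proof.
case: z => p q zi; have := zi => /andP[/andP[/= xp px] /andP[/= yq qy]].
set z := (p +i* q)%C : C.
have id w : br w -> cderivable (fun w => 1 * (w - z)^-1 ^+ 1) w.
  move=> wb; apply: cderivableM; first exact: cderivable_cst.
  by apply: cderivable_pow; apply: cderivable_inv; exact: brect_neq zi wb.
have bc : bcont x0 x1 y0 y1 (fun w => 1 * (w - z)^-1 ^+ 1).
  by move=> w /id/cderivable_ccont.
have x01' : x0 < x1 by exact: lt_trans px.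
have sub s t : ((s +i* t)%C : C) - z = ((s - p) +i* (t - q))%C by [].
pose D := (x1 - x0) ^+ 2 + (y1 - y0) ^+ 2.
have D0 : 0 < D by rewrite ltr_wpDr ?sqr_ge0// exprn_gt0// subr_gt0.
suff : 0 < Im (ct (fun=> 1) 1 z).
  by apply: contraTneq => ->; rewrite /= ltxx.
pose m := (q - y0) / D.
have m0 : 0 < m by rewrite divr_gt0// subr_gt0.
have inv_im s t : Im (1 * ((s +i* t)%C : C)^-1 ^+ 1) = - t / (s ^+ 2 + t ^+ 2).
  by rewrite mul1r expr1 /= mulNr.
have inv_re s t : Re (1 * ((s +i* t)%C : C)^-1 ^+ 1) = s / (s ^+ 2 + t ^+ 2).
  by rewrite mul1r expr1 /=.
have ImB (u v : C) : Im (u - v) = Im u - Im v by case: u v => ? ? [].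
have ImD (u v : C) : Im (u + v) = Im u + Im v by case: u v => ? ? [].
have ReB (u v : C) : Re (u - v) = Re u - Re v by case: u v => ? ? [].
have ImI (u : C) : Im (('i%C : C) * u) = Re u by case: u => ? ? /=; rewrite mul0r add0r mul1r.
rewrite /ct /rint -cintZ; last exact: (bcont_v x01 bc).
rewrite ImD; apply: (@lt_le_trans _ _ (m * (x1 - x0) + 0 * (y1 - y0))).
  by rewrite mul0r addr0 mulr_gt0// subr_gt0.
apply: lerD; apply: cint_Im_ge => //.
- exact: (bcont_h y01 bc).
- move=> t /andP[ht1 ht2]; rewrite !sub ImB !inv_im.
  apply: (@le_trans _ _ (m - 0)); first by rewrite subr0.
  apply: lerB.
    rewrite opprB /m; apply: ler_wpM2l; first by rewrite subr_ge0 ltW.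
    rewrite lef_pV2 ?posrE//; last first.
      by rewrite ltr_wpDl ?sqr_ge0// exprn_even_gt0//= subr_eq0 lt_eqF.
    have h1 : 0 <= (x1 - x0 - (t - p)) * (x1 - x0 + (t - p)) by apply: mulr_ge0; lra.
    have h2 : 0 <= (y1 - y0 - (y0 - q)) * (y1 - y0 + (y0 - q)) by apply: mulr_ge0; lra.
    by rewrite /D; move: h1 h2; lra.
  by rewrite mulNr oppr_le0; apply: divr_ge0; [lra|rewrite addr_ge0 ?sqr_ge0].
- move=> t ht.
  have vc := bcont_v x01 bc ht.
  move=> e e0; have [d d0 dP] := vc e e0; exists d => // s sd.
  by rewrite -mulrBr normcM normc_i mul1r; exact: dP.
move=> t _; rewrite ImI ReB !sub !inv_re subr_ge0.
apply: (@le_trans _ _ 0).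
  by apply: mulr_le0_ge0; [lra|rewrite invr_ge0 addr_ge0 ?sqr_ge0].
by apply: divr_ge0; [lra|rewrite addr_ge0 ?sqr_ge0].
Qed.

End Fixed.

Lemma square_rect (p : C) (s : R) z : 0 < s ->
  rect (Re p - s) (Re p + s) (Im p - s) (Im p + s) z -> N (z - p) <= 2 * s.
Proof.
move=> s0 zr; apply: le_trans (normc_le_ReIm _) _.
case: p z zr => a b [c e] /andP[/andP[/= h1 h2] /andP[/= h3 h4]].
rewrite (_ : 2 * s = s + s); last by ring.
by apply: lerD; rewrite ler_norml; apply/andP; split; lra.
Qed.

Lemma square_intr (p : C) (s : R) z : N (z - p) < s ->
  intr (Re p - s) (Re p + s) (Im p - s) (Im p + s) z.
Proof.
move=> zp; have := le_lt_trans (normc_Re _) zp; have := le_lt_trans (normc_Im _) zp.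
case: p z {zp} => a b [c e] /=; rewrite !ltr_norml => /andP[h1 h2] /andP[h3 h4].
by apply/andP; split; apply/andP; split => /=; lra.
Qed.

Section Disc.
Variables (p : C) (r : R).
Hypothesis r0 : 0 < r.
(** The square of half-side [s] around [p] lies in the disc of radius [2 * s < r], and its interior
    contains the disc of radius [s]. *)
Let s := r / 4.
Let s0 : 0 < s. Proof. by rewrite divr_gt0. Qed.
Local Notation ctp := (ct (Re p - s) (Re p + s) (Im p - s) (Im p + s)).
Let x01 : Re p - s <= Re p + s. Proof. by have := s0; lra. Qed.
Let y01 : Im p - s <= Im p + s. Proof. by have := s0; lra. Qed.
Let inD z : rect (Re p - s) (Re p + s) (Im p - s) (Im p + s) z -> N (z - p) < r.
Proof. by move=> /(square_rect s0) H; apply: (le_lt_trans H); have := s0; rewrite /s; lra. Qed.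
Let inB z : brect (Re p - s) (Re p + s) (Im p - s) (Im p + s) z -> N (z - p) < r.
Proof. by case/andP => /inD. Qed.

Lemma disc_formula f : (forall z, N (z - p) < r -> cderivable f z) ->
  forall z, N (z - p) < s -> ctp f 1 z = f z * ctp (fun=> 1) 1 z.
Proof.
by move=> fd z /square_intr zi; apply: cauchy_formula => // w /inD/fd.
Qed.

(** Both sides of Cauchy's formula are differentiated. The last term carries the derivative of the
    winding integral, which need not be known to vanish. *)
Lemma disc_deriv f f' : (forall z, N (z - p) < r -> cder f z (f' z)) ->
  forall z, N (z - p) < s ->
  f' z * ctp (fun=> 1) 1 z = ctp f 2 z - f z * ctp (fun=> 1) 2 z.
Proof.
move=> ff z zs; have fd w : N (w - p) < r -> cderivable f w by move/ff; exists (f' w).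
have zi := square_intr zs.
have H1 := @ct1_cder _ _ _ _ x01 y01 f z zi (fun w wb => fd w (inB wb)).
have H2 := @ct1_cder _ _ _ _ x01 y01 (fun=> 1) z zi (fun w _ => cderivable_cst 1 w).
have zr : N (z - p) < r by apply: (lt_trans zs); have := r0; rewrite /s; lra.
have H3 := cderM (ff z zr) H2.
have H4 : cder (ctp f 1) z (f z * ctp (fun=> 1) 2 z + ctp (fun=> 1) 1 z * f' z).
  apply: cder_near H3; exists (s - N (z - p)); first by rewrite subr_gt0.
  move=> w wz; apply: disc_formula => //.
  by have := normcB3 z w p; lra.
by rewrite (cder_unique H1 H4) addrAC subrr add0r mulrC.
Qed.

Lemma disc_winding z : N (z - p) < s -> ctp (fun=> 1) 1 z != 0.
Proof. by move=> /square_intr; exact: winding_neq0. Qed.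

End Disc.

(** [disc_deriv], divided by the nonzero winding integral, writes [f'] near [p] through [f] and
    Cauchy integrals, all differentiable. *)
Lemma cderivable_deriv f f' (p : C) (r : R) : 0 < r ->
  (forall z, N (z - p) < r -> cder f z (f' z)) -> cderivable f' p.
Proof.
move=> r0 ff; pose s := r / 4.
have s0 : 0 < s by rewrite divr_gt0.
have x01 : Re p - s <= Re p + s by lra.
have y01 : Im p - s <= Im p + s by lra.
have pp : N (p - p) < s by rewrite subrr normc0.
have pi := square_intr pp.
pose T g n z := ct (Re p - s) (Re p + s) (Im p - s) (Im p + s) g n z.
have fd z : brect (Re p - s) (Re p + s) (Im p - s) (Im p + s) z -> cderivable f z.
  move=> /andP[/(square_rect s0) H _]; exists (f' z); apply: ff.
  by apply: (le_lt_trans H); rewrite /s; lra.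
have [a Ha] : cderivable (fun z => (T f 2%N z - f z * T (fun=> 1) 2%N z) * (T (fun=> 1) 1%N z)^-1) p.
  apply: cderivableM.
    apply: cderivableB; first by eexists; apply: ct2_cder.
    apply: cderivableM; first by exists (f' p); apply: ff; rewrite subrr normc0.
    by eexists; apply: ct2_cder => // w _; exact: cderivable_cst.
  eexists; apply: cderV; first exact: (disc_winding r0 pp).
  by apply: ct1_cder => // w _; exact: cderivable_cst.
exists a; apply: cder_near Ha; exists s => // w ws.
by rewrite /T -(disc_deriv r0 ff ws) mulfK// (disc_winding r0 ws).
Qed.

(** Weierstrass's theorem: [disc_deriv] applied to [S n - f] bounds the derivative of the difference
    at [p] by its supremum on the disc. *)
Lemma cderivable_lim_deriv f f' (S S' : nat -> C -> C) (p : C) (r : R) : 0 < r ->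
  (forall z, N (z - p) < r -> cder f z (f' z)) ->
  (forall n z, N (z - p) < r -> cder (S n) z (S' n z)) ->
  (forall e : R, 0 < e -> exists n0 : nat, forall n, (n0 <= n)%N ->
     forall z, N (z - p) < r -> N (S n z - f z) <= e) ->
  forall e : R, 0 < e -> exists n0 : nat, forall n, (n0 <= n)%N -> N (S' n p - f' p) <= e.
Proof.
move=> r0 ff SS unif e e0; pose s := r / 4.
have s0 : 0 < s by rewrite divr_gt0.
have x01 : Re p - s <= Re p + s by lra.
have y01 : Im p - s <= Im p + s by lra.
have pp : N (p - p) < s by rewrite subrr normc0.
have ppr : N (p - p) < r by rewrite subrr normc0.
have pi := square_intr pp.
pose T g n z := ct (Re p - s) (Re p + s) (Im p - s) (Im p + s) g n z.
pose k w := (w - p)^-1 ^+ 2.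
have kd w : brect (Re p - s) (Re p + s) (Im p - s) (Im p + s) w -> cderivable k w.
  by move=> wb; apply: cderivable_pow; apply: cderivable_inv; exact: brect_neq pi wb.
have [M M0 kM] : exists2 M : R, 0 <= M &
    forall w, brect (Re p - s) (Re p + s) (Im p - s) (Im p + s) w -> N (k w) <= M.
  by apply: bcont_bounded => // w /kd/cderivable_ccont.
pose c := N (T (fun=> 1) 1%N p); pose c2 := N (T (fun=> 1) 2%N p).
have c0 : 0 < c by rewrite normc_gt0; exact: (disc_winding r0 pp).
have c20 : 0 <= c2 by exact: normc_ge0.
(* [K] collects the constants of the two terms of [disc_deriv]: [rint_norm] on a square with side
   lengths adding to [4 * s], and the value [c2]; the 1 makes it positive. *)
pose K := 4 * M * (4 * s) + c2 + 1.
have K0 : 0 < K by rewrite ltr_wpDl// addr_ge0// !mulr_ge0// ltW.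
have [n0 Hn] := unif (e * c / K) ltac:(by rewrite divr_gt0// mulr_gt0).
exists n0 => n nn; pose g z := S n z - f z; pose g' z := S' n z - f' z.
have gg z : N (z - p) < r -> cder g z (g' z) by move=> zr; apply: cderB; [exact: SS|exact: ff].
have E := disc_deriv r0 gg pp.
have gb z : N (z - p) < r -> N (g z) <= e * c / K by move=> zr; exact: Hn.
have gt0 : 0 <= e * c / K by rewrite divr_ge0 ?mulr_ge0// ltW.
have H1 : N (T g 2%N p) <= 4 * (e * c / K * M) * (Re p + s - (Re p - s) + (Im p + s - (Im p - s))).
  have inb w : brect (Re p - s) (Re p + s) (Im p - s) (Im p + s) w -> N (w - p) < r.
    by move=> /andP[/(square_rect s0) H _]; apply: (le_lt_trans H); rewrite /s; lra.
  apply: rint_norm => //.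
    move=> w wb; apply: cderivable_ccont; apply: cderivableM; last exact: kd.
    by exists (g' w); apply: gg; exact: inb.
  by move=> w wb; rewrite normcM; apply: ler_pM; rewrite ?normc_ge0 ?kM// gb// inb.
have H2 : N (g' p) * c <= e * c.
  rewrite -normcM E -/(T _ _ _); apply: le_trans (le_normcD _ _) _; rewrite normcN normcM -/c2.
  have H3 := gb p ppr.
  have H4 : N (g p) * c2 <= e * c / K * c2 by rewrite ler_wpM2r.
  have -> : e * c = e * c / K * K by rewrite mulfVK// gt_eqF.
  rewrite /K !mulrDr mulr1.
  apply: (@le_trans _ _ (e * c / K * (4 * M * (4 * s)) + e * c / K * c2)); last by rewrite lerDl.
  by apply: lerD => //; apply: (le_trans H1); rewrite le_eqVlt; apply/orP; left; apply/eqP; ring.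
by move: H2; rewrite ler_pM2r.
Qed.

(* The weight [((p - z) / (w - p))^n] kills the Cauchy integral of [f] as [n] grows,
   and [f w / (w - p)^n] is still holomorphic because [f] vanishes near [p]. *)
Lemma disc_vanish f (p : C) (r d : R) : 0 < d -> (forall z, N (z - p) < r -> cderivable f z) ->
  (forall z, N (z - p) < d -> f z = 0) -> forall z, N (z - p) < r / 16 -> f z = 0.
Proof.
move=> d0 fd fz z zr.
have [->|zp] := eqVneq z p; first by apply: fz; rewrite subrr normc0.
have zp0 : 0 < N (z - p) by rewrite normc_gt0 subr_eq0.
have r0 : 0 < r by move: zr; lra.
pose s := r / 4; have s0 : 0 < s by rewrite divr_gt0.
have x01 : Re p - s <= Re p + s by lra.
have y01 : Im p - s <= Im p + s by lra.
have zs : N (z - p) < s by rewrite /s; lra.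
have zi := square_intr zs.
pose T g n z := ct (Re p - s) (Re p + s) (Im p - s) (Im p + s) g n z.
pose B w := brect (Re p - s) (Re p + s) (Im p - s) (Im p + s) w.
have inb w : B w -> N (w - p) < r.
  by move=> /andP[/(square_rect s0) H _]; apply: (le_lt_trans H); rewrite /s; lra.
have bd w : B w -> s <= N (w - p).
  move=> /andP[_]; rewrite leNgt; apply: contraTN => /square_intr /andP[/andP[a b] /andP[c e]].
  by rewrite !negb_or (gt_eqF a) (lt_eqF b) (gt_eqF c) (lt_eqF e).
pose g n w := f w * (w - p)^-1 ^+ n.
have gd n w : N (w - p) < r -> cderivable (g n) w.
  move=> wr; have [wd|wd] := ltP (N (w - p)) d.
    exists 0; apply: cder_near (cder_cst 0 w).
    exists (d - N (w - p)); first by rewrite subr_gt0.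
    by move=> u uw; rewrite /g fz ?mul0r//; have := normcB3 w u p; lra.
  apply: cderivableM; first exact: fd.
  apply: cderivable_pow; apply: cderivable_inv.
  by rewrite -subr_eq0 -normc_gt0 (lt_le_trans d0).
have F n : T (g n) 1%N z = g n z * T (fun=> 1) 1%N z.
  by apply: (disc_formula r0) => // w wr; exact: gd.
have k0 : T (fun=> 1) 1%N z != 0 by exact: (disc_winding r0 zs).
have h0d w : B w -> cderivable (fun w => f w * (w - z)^-1 ^+ 1) w.
  move=> wb; apply: cderivableM; first exact/fd/inb.
  by apply: cderivable_pow; apply: cderivable_inv; exact: brect_neq zi wb.
have [M M0 HM] : exists2 M : R, 0 <= M & forall w, B w -> N (f w * (w - z)^-1 ^+ 1) <= M.
  by apply: bcont_bounded => // w /h0d/cderivable_ccont.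
pose c := N (T (fun=> 1) 1%N z); have c0 : 0 < c by rewrite normc_gt0.
(* The boundary is at distance at least [s] from [p], while [z] is closer than [s / 4], so the ratio
   is below 1/2. *)
have est n : N (f z) * c <= 16 * M * s * (N (z - p) / s) ^+ n.
  have : N (T (g n) 1%N z) <= 4 * (M * s^-1 ^+ n) *
      (Re p + s - (Re p - s) + (Im p + s - (Im p - s))).
    apply: rint_norm => //.
      move=> w wb; apply: cderivable_ccont; apply: cderivableM; first exact/gd/inb.
      by apply: cderivable_pow; apply: cderivable_inv; exact: brect_neq zi wb.
    move=> w wb; rewrite /g mulrAC normcM; apply: ler_pM; rewrite ?normc_ge0 ?HM//.
    rewrite normcX normcV; apply: lerXn2r; rewrite ?nnegrE ?invr_ge0 ?normc_ge0//.
      exact: ltW.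
    rewrite lef_pV2 ?posrE//; first exact: bd.
    exact: lt_le_trans s0 (bd w wb).
  rewrite F /g !normcM normcX normcV -/c => H.
  have zn : 0 < N (z - p) ^+ n by rewrite exprn_gt0.
  rewrite expr_div_n -(ler_pM2r (x := (N (z - p))^-1 ^+ n)); last by rewrite exprn_gt0// invr_gt0.
  rewrite mulrAC; apply: le_trans H _; rewrite le_eqVlt; apply/orP; left; apply/eqP.
  rewrite !exprVn; field.
  by rewrite !expf_neq0 ?gt_eqF.
apply: eq0_normc; apply/eqP; rewrite eq_le normc_ge0 andbT leNgt; apply/negP => H.
pose A := 16 * M * s.
have A0 : 0 <= A by rewrite !mulr_ge0// ltW.
have fc0 : 0 < N (f z) * c by rewrite mulr_gt0.
have [n Hn] := @ex_half_pow _ A _ fc0.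
have : N (f z) * c <= A / 2 ^+ n.
  apply: le_trans (est n) _; rewrite -/A; apply: ler_wpM2l => //.
  have q0 : 0 <= N (z - p) / s by rewrite divr_ge0// ltW.
  have q1 : N (z - p) / s <= 2^-1 by rewrite ler_pdivrMr// /s; lra.
  by rewrite -exprVn; apply: lerXn2r; rewrite ?nnegrE ?invr_ge0.
by rewrite leNgt Hn.
Qed.

Lemma identity_principle (U : set C) f (p : C) : open U -> connected U ->
  (forall z, U z -> cderivable f z) -> U p ->
  (exists2 d : R, 0 < d & forall z, N (z - p) < d -> f z = 0) ->
  forall z, U z -> f z = 0.
Proof.
move=> Uo Uc fd Up Hp.
pose Z := [set z | exists2 d : R, 0 < d & forall w, N (w - z) < d -> f w = 0].
have opZ : open Z.
  rewrite openE => z [d d0 zd]; apply/nbhsCP; exists (d / 2); first by rewrite divr_gt0.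
  move=> w wz; exists (d / 2); first by rewrite divr_gt0.
  by move=> u uw; apply: zd; have := normcB3 w u z; lra.
have opU z : U z -> exists2 r : R, 0 < r & forall w, N (w - z) < r -> U w.
  by move=> Uz; apply/nbhsCP; move: Uo; rewrite openE => /(_ z Uz).
suff UZ : U `&` Z = U.
  by move=> z Uz; have : (U `&` Z) z by [rewrite UZ]; case=> _ [d d0]; apply; rewrite subrr normc0.
(* [U] meets [Z] in a nonempty set that is open in [U]; it remains to see that it is also the trace
   on [U] of the closure of [Z]. *)
apply: Uc.
- by exists p.
- by exists Z.
exists (closure Z); first exact: closed_closure.
apply/seteqP; split=> z [Uz Zz]; split=> //; first exact: subset_closure.
have [r r0 rU] := opU z Uz.
(* [disc_vanish] is applied around [q] with radius 3r/4, so [f] vanishes within 3r/64 of [q]; any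
   fraction small enough for [z] and a neighbourhood to fall in that disc would do. *)
have : nbhs z [set w | N (w - z) < r / 34].
  by apply/nbhsCP; exists (r / 34) => //; rewrite divr_gt0.
move=> /Zz [q [[d d0 qd] /= qz]].
have qr w : N (w - q) < r / 2 -> U w.
  by move=> wq; apply: rU; have := normcB3 q w z; lra.
exists (r / 34 / 34); first by rewrite !divr_gt0.
move=> w wz; apply: (@disc_vanish f q (r / 2 + r / 4) d) => //.
  by move=> u uq; apply: fd; apply: rU; have := normcB3 q u z; lra.
by have := normcB3 z w q; rewrite (normcBC z q); lra.
Qed.

End CauchyTransform.

(** * Power series and polylogarithms *)

Section SeriesAndLogarithms.
Variable R : realType.
Local Notation C := (Cplx R).
Local Notation N := (@normc R).
Local Notation Re := (@complex.Re R).
Local Notation Im := (@complex.Im R).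
Implicit Types (f g : C -> C) (z w u v : C).

Lemma cvgnCP (u : nat -> C) (l : C) : u @ \oo --> l <->
  forall e : R, 0 < e -> exists n0 : nat, forall n, (n0 <= n)%N -> N (u n - l) < e.
Proof.
rewrite cvgCP; split => h e e0.
  by have [n0 _ H] := h e e0; exists n0.
by have [n0 H] := h e e0; exists n0.
Qed.

(** Bisection of the segment from [p] to [z]: if the increment of [f] exceeds a fixed slope, it does
    so on one half, and so on down to a point where the derivative is 0. *)
Lemma cder0_disc_const f (p : C) (r : R) :
  (forall z, N (z - p) < r -> cder f z 0) -> forall z, N (z - p) < r -> f z = f p.
Proof.
move=> fd z zr; apply/eqP; rewrite -subr_eq0; apply/eqP/eq0_normc/eqP.
rewrite eq_le normc_ge0 andbT leNgt; apply/negP => H.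
pose v := z - p; pose K := N v + 1.
have K0 : 0 < K by rewrite ltr_wpDl// normc_ge0.
pose e := N (f z - f p) / (2 * K).
have e0 : 0 < e by rewrite divr_gt0// mulr_gt0.
pose y (x : R) : C := p + x%:C%C * v.
have yd (s t : R) : N (y s - y t) = `|s - t| * N v.
  rewrite -normc_real -normcM rmorphB; congr N; rewrite /y; ring.
(* The second coordinate is a dummy of height 0. *)
pose P (x _ : R) n := [/\ 0 <= x, x + 1 / 2 ^+ n <= 1 &
  e * (K / 2 ^+ n) < N (f (y (x + 1 / 2 ^+ n)) - f (y x))].
have [||||q [qy Q]] := @nested_quarters _ P 1 0 0 0 => //.
- rewrite /P expr0 !divr1 add0r; split => //.
  rewrite (_ : y 1 = z); last by rewrite /y rmorph1 mul1r /v addrC subrK.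
  rewrite (_ : y 0 = p); last by rewrite /y rmorph0 mul0r addr0.
  rewrite (_ : e * K = N (f z - f p) / 2); last by rewrite /e; field; rewrite gt_eqF.
  by rewrite ltr_pdivrMr// ltr_pMr// ltr1n.
- move=> x y0 n [x0 x1 B].
  have half (a : R) : a / 2 ^+ n = a / 2 ^+ n.+1 + a / 2 ^+ n.+1.
    by rewrite exprS; field; rewrite expf_neq0.
  have h0 : (0 : R) <= 1 / 2 ^+ n.+1 by rewrite divr_ge0// exprn_ge0.
  move: x1 B; rewrite !half; set h := 1 / _ in h0 *; set k := K / _ => x1 B.
  have [hA|hA] := ltP (e * k) (N (f (y (x + h)) - f (y x))).
    by exists x, y0; rewrite /P -/h -/k; split; [split => //; lra|lra|rewrite mul0r addr0 lexx].
  exists (x + h), y0; rewrite /P -/h -/k; split; [split; [lra|lra|]|lra|by rewrite mul0r addr0 lexx].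
  have := normcB3 (f (y (x + h))) (f (y (x + (h + h)))) (f (y x)).
  by move: B hA; rewrite mulrDr -[x + h + h]addrA; lra.
have [x [_ [[x0 x1 _] qx _]]] := Q 0%N.
have q01 : 0 <= q <= 1 by move: qx x1; rewrite expr0 divr1; lra.
have yr : N (y q - p) < r.
  rewrite (_ : y q - p = q%:C%C * v); last by rewrite /y addrAC subrr add0r.
  rewrite normcM normc_real ger0_norm; last by case/andP: q01.
  by apply: le_lt_trans zr; rewrite ler_piMl ?normc_ge0//; case/andP: q01.
have [d d0 D] := fd _ yr e e0.
have [n Kd] := @ex_half_pow R K d d0.
have {x x0 x1 qx} [x [_ [[x0 x1 B] qx _]]] := Q n.
have h0 : (0 : R) <= 1 / 2 ^+ n by rewrite divr_ge0// exprn_ge0.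
have Kh : K / 2 ^+ n = K * (1 / 2 ^+ n) by rewrite mul1r.
rewrite Kh in Kd B; move: x1 B qx h0 Kd; set h := 1 / _ => x1 B qx h0 Kd.
have vK : N v <= K by rewrite lerDl.
have nv := normc_ge0 v.
have near (s : R) : `|s - q| <= h -> N (f (y s) - f (y q)) <= e * (`|s - q| * N v).
  move=> sh; have sd : N (y s - y q) < d.
    rewrite yd; apply: le_lt_trans Kd; rewrite mulrC; apply: ler_pM => //.
  by have := D _ sd; rewrite mul0r subr0 yd.
have h1 : `|x + h - q| <= h by rewrite ger0_norm; lra.
have h2 : `|x - q| <= h by rewrite ler0_norm; lra.
have := near _ h1; have := near _ h2.
rewrite ger0_norm in h1 *; last lra.
rewrite [`|x - q|]ler0_norm; last lra.
have := normcB3 (f (y q)) (f (y (x + h))) (f (y x)); rewrite (normcBC (f (y q)) (f (y x))).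
move=> i1 i2 i3.
have : N (f (y (x + h)) - f (y x)) <= e * (h * N v).
  apply: le_trans i1 _; rewrite (_ : e * (h * N v) = e * ((x + h - q) * N v) + e * (- (x - q) * N v)).
    by lra.
  by ring.
apply/negP; rewrite -ltNge; apply: le_lt_trans B.
by apply: ler_wpM2l; [exact: ltW|rewrite mulrC; exact: ler_wpM2r].
Qed.

Lemma cder0_const (U : set C) f (p : C) : open U -> connected U -> U p ->
  (forall z, U z -> cder f z 0) -> forall z, U z -> f z = f p.
Proof.
move=> Uo Uc Up fd z Uz; apply/eqP; rewrite -subr_eq0; apply/eqP.
apply: (@identity_principle _ U (fun z => f z - f p) p) => //.
  by move=> w /fd fw; apply: cderivableB; [exists 0|exact: cderivable_cst].
have [r r0 rU] : exists2 r : R, 0 < r & forall w, N (w - p) < r -> U w.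
  by apply/nbhsCP; move: Uo; rewrite openE => /(_ p Up).
exists r => // w wr; apply/eqP; rewrite subr_eq0; apply/eqP.
by apply: cder0_disc_const wr => u /rU/fd.
Qed.

Lemma normc_sum (I : Type) (r : seq I) (P : pred I) (F : I -> C) :
  N (\sum_(i <- r | P i) F i) <= \sum_(i <- r | P i) N (F i).
Proof.
elim/big_rec2: _ => [|i x y _ H]; first by rewrite normc0.
by apply: le_trans (le_normcD _ _) _; rewrite lerD2l.
Qed.

(** The n-th partial sum is compared with a later one, close to [f z] at the given point; the
    majorant bounds the gap independently of [z]. *)
Lemma weierstrass (D : C -> Prop) (a : nat -> C -> C) (b : nat -> R) (E : R) f :
  (forall k z, D z -> N (a k z) <= b k) ->
  (fun n => \sum_(k < n) b k) @ \oo --> E ->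
  (forall z, D z -> (fun n => \sum_(k < n) a k z) @ \oo --> f z) ->
  forall e : R, 0 < e -> exists n0 : nat, forall n, (n0 <= n)%N ->
    forall z, D z -> N (\sum_(k < n) a k z - f z) <= e.
Proof.
move=> ab bE af e e0.
have [n0 _ H0] : \forall n \near \oo, `|E - \sum_(k < n) b k| < e / 4.
  by move/cvgrPdist_lt : bE; apply; rewrite divr_gt0.
exists n0 => n nn z Dz.
have [n1 H1] := (cvgnCP _ _).1 (af z Dz) (e / 4) ltac:(by rewrite divr_gt0).
pose m := maxn n n1; have nm : (n <= m)%N by exact: leq_maxl.
have := H1 m (leq_maxr _ _).
have := H0 n nn; have := H0 m (leq_trans nn nm).
have tail (A : nmodType) (F : nat -> A) :
    \sum_(k < m) F k = \sum_(k < n) F k + \sum_(n <= k < m) F k.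
  by rewrite -!(big_mkord xpredT); exact: big_cat_nat.
have : N (\sum_(n <= k < m) a k z) <= \sum_(n <= k < m) b k.
  by apply: le_trans (normc_sum _ _ _) _; apply: ler_sum => k _; exact: ab.
rewrite (tail _ b).
have -> : \sum_(k < m) a k z = \sum_(k < n) a k z + \sum_(n <= k < m) a k z by exact: tail.
set A := \sum_(k < n) a k z; set A' := \sum_(n <= k < m) a k z.
set B := \sum_(k < n) b k; set B' := \sum_(n <= k < m) b k.
rewrite !ltr_norml => h1 /andP[h2 h3] /andP[h4 h5] h6.
have := normcB3 (A + A') A (f z).
have -> : A - (A + A') = - A' by rewrite opprD addrA subrr add0r.
by rewrite normcN; lra.
Qed.

Lemma cder_sum (a a' : nat -> C -> C) z n : (forall k, cder (a k) z (a' k z)) ->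
  cder (fun w => \sum_(k < n) a k w) z (\sum_(k < n) a' k z).
Proof.
move=> ad; elim: n => [|n IH].
  rewrite big_ord0; apply: cder_near (cder_cst 0 z).
  by exists 1 => // w _; rewrite big_ord0.
rewrite big_ord_recr; apply: cder_near (cderD IH (ad n)).
by exists 1 => // w _; rewrite big_ord_recr.
Qed.

(** The sum is known to be differentiable, so what is gained is convergence of the differentiated
    series to its derivative. *)
Lemma series_deriv (p : C) (r : R) (a a' : nat -> C -> C) (b : nat -> R) (E : R) f f' :
  0 < r -> (forall z, N (z - p) < r -> cder f z (f' z)) ->
  (forall k z, N (z - p) < r -> cder (a k) z (a' k z)) ->
  (forall k z, N (z - p) < r -> N (a k z) <= b k) ->
  (fun n => \sum_(k < n) b k) @ \oo --> E ->
  (forall z, N (z - p) < r -> (fun n => \sum_(k < n) a k z) @ \oo --> f z) ->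
  (fun n => \sum_(k < n) a' k p) @ \oo --> f' p.
Proof.
move=> r0 ff ad ab bE af; apply/cvgnCP => e e0.
have [n0 H] := @cderivable_lim_deriv _ f f' (fun n z => \sum_(k < n) a k z)
  (fun n z => \sum_(k < n) a' k z) p r r0 ff
  (fun n z zr => cder_sum n (fun k => ad k z zr))
  (weierstrass ab bE af) (e / 2) ltac:(by rewrite divr_gt0).
by exists n0 => n /H h; apply: le_lt_trans h _; rewrite ltr_pdivrMr// ltr_pMr// ltr1n.
Qed.

Lemma cvg_exp_sum (B : R) : (fun n => \sum_(k < n) B ^+ k / k`!%:R) @ \oo --> expR B.
Proof.
have := is_cvg_series_exp_coeff B; rewrite /expR => H.
rewrite (_ : (fun n => _) = series (exp_coeff B)) //.
by apply/funext => n; rewrite /series/= big_mkord.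
Qed.

(* Differentiate the exponential series of [L] termwise: [L' g = g']. *)
Lemma log_branch_cder (U : set C) (L g : C -> C) z (l : C) : open U ->
  is_log_branch U L g -> (forall w, U w -> cderivable g w) ->
  U z -> g z != 0 -> cder g z l -> cder L z (l / g z).
Proof.
move=> Uo Lg gd Uz gz gl.
have Ld w : U w -> cder L w ('D_1 L w).
  by move=> /Lg[Ld _]; apply/is_derive_cder; exact/derivableP.
have Gd w : U w -> cder g w ('D_1 g w).
  by move=> /gd[k /is_derive_cder[gk _]]; apply/is_derive_cder; exact/derivableP.
have [r r0 rU] : exists2 r : R, 0 < r & forall w, N (w - z) < r -> U w.
  by apply/nbhsCP; move: Uo; rewrite openE => /(_ z Uz).
have [d d0 D] := cder_ccont (Ld z Uz) ltr01.
(* By continuity [B] bounds [L] near [z], and the exponential series of [B] is the majorant. *)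
pose B := N (L z) + 1.
have rd0 : 0 < Num.min r d by rewrite lt_min r0.
have H := @series_deriv z (Num.min r d) (fun k w => L w ^+ k / k`!%:R)
  (fun k w => k%:R * L w ^+ k.-1 * 'D_1 L w / k`!%:R) (fun k => B ^+ k / k`!%:R) (expR B)
  g ('D_1 g) rd0 _ _ _ (@cvg_exp_sum B) _.
have {H}H : (fun n => \sum_(k < n) k%:R * L z ^+ k.-1 * 'D_1 L z / k`!%:R) @ \oo --> 'D_1 g z.
  apply: H.
  - by move=> w; rewrite lt_min => /andP[/rU Uw _]; exact: Gd.
  - move=> k w; rewrite lt_min => /andP[/rU Uw _].
    have := cderM (cder_exprn k (Ld w Uw)) (cder_cst (k`!%:R^-1) w).
    by rewrite mulr0 add0r mulrC.
  - move=> k w; rewrite lt_min => /andP[_ /D H].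
    rewrite normcM normcX normcV normc_nat; apply: ler_wpM2r; first by rewrite invr_ge0.
    apply: lerXn2r; rewrite ?nnegrE ?normc_ge0// ?addr_ge0 ?normc_ge0//.
    by have := le_normcD (L w - L z) (L z); rewrite subrK /B; lra.
  - by move=> w; rewrite lt_min => /andP[/rU/Lg[_ H] _].
(* The term [k = 0] drops out, so the differentiated sum is one term shorter. *)
have E n : \sum_(k < n.+1) k%:R * L z ^+ k.-1 * 'D_1 L z / k`!%:R =
    (\sum_(k < n) L z ^+ k / k`!%:R) * 'D_1 L z.
  rewrite big_ord_recl !mul0r add0r mulr_suml.
  apply: eq_bigr => k _; rewrite lift0 /= factS natrM.
  have n1 : 1 + k%:R != 0 :> C by rewrite addrC natr1 pnatr_eq0.
  have n2 : k`!%:R != 0 :> C by rewrite pnatr_eq0 -lt0n fact_gt0.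
  by field; rewrite ?n1 ?n2.
have H1 : (fun n => (\sum_(k < n) L z ^+ k / k`!%:R) * 'D_1 L z) @ \oo --> 'D_1 g z.
  apply/cvgnCP => e e0; have [n0 Hn] := (cvgnCP _ _).1 H e e0.
  by exists n0 => n nn; rewrite -E; apply: Hn; exact: leqW.
have H2 : (fun n => (\sum_(k < n) L z ^+ k / k`!%:R) * 'D_1 L z) @ \oo --> g z * 'D_1 L z.
  by apply: cvgM; [case: (Lg z Uz)|exact: cvg_cst].
have Dg : 'D_1 g z = l by exact: cder_unique (Gd z Uz) gl.
have := cvg_unique _ H1 H2; rewrite Dg => ->; last exact: norm_hausdorff.
by rewrite [g z * _]mulrC mulfK//; exact: Ld.
Qed.

Lemma slit_diskP (Sigma : seq C) b d z : slit_disk Sigma b d z <->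
  [/\ z != b, (forall c, c \in Sigma -> c != b -> N (z - b) < N (c - b)) &
     forall t : R, 0 <= t -> z <> b + t%:C%C * d].
Proof.
rewrite /slit_disk /=; split.
  move=> [z0 [zc zt]]; split.
  - by rewrite -subr_eq0 -normr_gt0.
  - by move=> c cS cb; have := zc c cS cb; rewrite !normCE ltcR.
  - by move=> t t0 zE; apply: zt; exists t.
move=> [zb zc zt]; split; first by rewrite normr_gt0 subr_eq0.
split; last by move=> [t [t0 zE]]; exact: (zt t).
by move=> c cS cb; have := zc c cS cb; rewrite !normCE ltcR.
Qed.

(** * The slit disk and power series converging on it *)

Section Slit.
Variables (Sigma : seq C) (b d : C).
Hypothesis d0 : d != 0.
Local Notation V := (slit_disk Sigma b d).

(** Finiteness of [Sigma] gives a common margin; at [z = b] it is a positive lower bound for the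
    radius of the disk. *)
Lemma radius_gap z :
  (forall c, c \in Sigma -> c != b -> N (z - b) < N (c - b)) ->
  exists2 e : R, 0 < e & forall c, c \in Sigma -> c != b -> N (z - b) + e <= N (c - b).
Proof.
elim: Sigma => [|c s IH] H; first by exists 1.
have [e e0 He] := IH (fun c' cs => H c' (mem_behead (s := c :: s) cs)).
have [cb|cb] := eqVneq c b.
  exists e => // c'; rewrite inE => /predU1P[->|]; last exact: He.
  by rewrite cb eqxx.
exists (Num.min e (N (c - b) - N (z - b))).
  by rewrite lt_min e0 subr_gt0 H// mem_head.
move=> c'; rewrite inE => /predU1P[-> _|c's c'b].
  by rewrite -lerBrDl ge_min lexx orbT.
by apply: le_trans (He c' c's c'b); rewrite lerD2l ge_min lexx.
Qed.

Lemma slit_ball z : V z -> exists2 r : R, 0 < r & forall w, N (w - z) < r -> V w.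
Proof.
move=> /slit_diskP[zb zc zt]; have [e e0 He] := radius_gap zc.
have nd : 0 < N d by rewrite normc_gt0.
have zb0 : 0 < N (z - b) by rewrite normc_gt0 subr_eq0.
(* In this coordinate the ray is the half-line of nonnegative reals, from which [u] is separated by
   its imaginary part or by its negative real part. *)
pose u := (z - b) / d.
have [r r0 Hr] : exists2 r : R, 0 < r & forall w : C, N (w - z) < r ->
    forall t : R, 0 <= t -> w <> b + t%:C%C * d.
  have Hu (w : C) (t : R) : w = b + t%:C%C * d -> N (t%:C%C - u) * N d = N (w - z).
    by move=> ->; rewrite -normcM mulrBl /u divfK// opprB addrA [_ + b]addrC.
  have [Iu|Iu] := eqVneq (Im u) 0; last first.
    exists (`|Im u| * N d); first by rewrite mulr_gt0// normr_gt0.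
    move=> w wr t t0 /Hu E; move: wr; rewrite -E ltr_pM2r// ltNge.
    rewrite (le_trans _ (normc_Im _))//.
    by rewrite (_ : Im (t%:C%C - u) = - Im u) ?normrN//; case: (u) => ? ? /=; rewrite sub0r.
  have Ru : Re u < 0.
    rewrite ltNge; apply/negP => Ru; apply: (zt _ Ru).
    rewrite (_ : (Re u)%:C%C = u); last by case: (u) Iu => ? ? /= ->.
    by rewrite /u divfK// addrC subrK.
  exists (- Re u * N d); first by rewrite mulr_gt0// oppr_gt0.
  move=> w wr t t0 /Hu E; move: wr; rewrite -E ltr_pM2r// ltNge.
  rewrite (le_trans _ (normc_Re _))//.
  rewrite (_ : Re (t%:C%C - u) = t - Re u); last by case: (u).
  by apply: le_trans (ler_norm _); rewrite lerDr.
exists (Num.min r (Num.min e (N (z - b)))); first by rewrite !lt_min r0 e0.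
move=> w; rewrite !lt_min => /and3P[w1 w2 w3]; apply/slit_diskP; split.
- by apply: contraTneq w3 => ->; rewrite -leNgt normcBC.
- move=> c cS cb; apply: lt_le_trans (He c cS cb).
  by have := normcB3 z w b; lra.
- exact: Hr.
Qed.

(** Convergence at a point farther out on the same half-line gives geometric domination near [z]. *)
Lemma slit_outward z : V z -> exists2 l : R, 1 < l & V (b + l%:C%C * (z - b)).
Proof.
move=> /slit_diskP[zb zc zt]; have [e e0 He] := radius_gap zc.
have zb0 : 0 < N (z - b) by rewrite normc_gt0 subr_eq0.
pose l := 1 + e / 2 / N (z - b).
have l1 : 1 < l by rewrite ltrDl !divr_gt0.
have l0 : 0 < l by exact: lt_trans l1.
have lC : l%:C%C != 0 :> C by rewrite -normc_gt0 normc_real normr_gt0 gt_eqF.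
exists l => //; apply/slit_diskP; split.
- by rewrite -subr_eq0 addrC addKr mulf_neq0// subr_eq0.
- move=> c cS cb; apply: lt_le_trans (He c cS cb).
  rewrite addrC addKr normcM normc_real ger0_norm ?ltW// /l mulrDl mul1r divfK ?gt_eqF//.
  by rewrite ltrD2l ltr_pdivrMr// ltr_pMr// ltr1n.
- move=> t t0 /addrI E; apply: (zt (t / l)); first by rewrite divr_ge0// ltW.
  apply: (canRL (subrKC _)); apply: (mulfI lC); rewrite E mulrA; congr (_ * _).
  by rewrite -rmorphM mulrC divfK// gt_eqF.
Qed.

Lemma slit_near_center (r : R) : 0 < r -> exists2 z, V z & N (z - b) < r.
Proof.
move=> r0; have nd : 0 < N d by rewrite normc_gt0.
have [|e e0 He] := @radius_gap b.
  by move=> c _ cb; rewrite subrr normc0 normc_gt0 subr_eq0.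
(* The point is taken opposite to the ray, at [b - t d]. *)
pose t := Num.min r e / (2 * N d).
have m0 : 0 < Num.min r e by rewrite lt_min r0.
have t0 : 0 < t by rewrite divr_gt0// mulr_gt0.
have tN : N (- t%:C%C * d) = Num.min r e / 2.
  by rewrite normcM normcN normc_real gtr0_norm// /t; field; rewrite gt_eqF.
have tC : - t%:C%C != 0 :> C.
  by rewrite oppr_eq0 -normc_gt0 normc_real normr_gt0 gt_eqF.
have hm : Num.min r e / 2 < Num.min r e by rewrite ltr_pdivrMr// ltr_pMr// ltr1n.
have mr : Num.min r e <= r by rewrite ge_min lexx.
have me : Num.min r e <= e by rewrite ge_min lexx orbT.
exists (b + - t%:C%C * d); last by rewrite addrC addKr tN (lt_le_trans hm).
apply/slit_diskP; split.
- by rewrite -subr_eq0 addrC addKr mulf_neq0.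
- move=> c cS cb; rewrite addrC addKr tN; apply: lt_le_trans hm _.
  by apply: le_trans me _; have := He c cS cb; rewrite subrr normc0 add0r.
- move=> s s0 /addrI/(mulIf d0) /eqP; rewrite -rmorphN.
  by rewrite (inj_eq (@complexI R)) => /eqP; lra.
Qed.

(** Used to carry estimates from the slit disk to every point of [U] near [b]. *)
Lemma slit_dense z (r : R) : z != b -> 
  (forall c, c \in Sigma -> c != b -> N (z - b) < N (c - b)) -> 0 < r ->
  exists2 w, V w & N (w - z) < r.
Proof.
move=> zb zc r0; have nd : 0 < N d by rewrite normc_gt0.
have [[t [t0 zE]]|nray] := pselect (exists t : R, 0 <= t /\ z = b + t%:C%C * d); last first.
  exists z; last by rewrite subrr normc0.
  by apply/slit_diskP; split => // t t0 zE; apply: nray; exists t.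
have [e e0 He] := radius_gap zc.
have zb0 : 0 < N (z - b) by rewrite normc_gt0 subr_eq0.
pose m := Num.min r (Num.min e (N (z - b))).
have m0 : 0 < m by rewrite !lt_min r0 e0.
have mr : m <= r by rewrite ge_min lexx.
have me : m <= e by rewrite !ge_min lexx !orbT.
have mz : m <= N (z - b) by rewrite !ge_min lexx !orbT.
pose s := m / (2 * N d).
have s0 : 0 < s by rewrite divr_gt0// mulr_gt0.
(* A shift perpendicular to the ray leaves it. *)
pose w : C := z + (0 +i* s)%C * d.
have wz : N (w - z) = m / 2.
  rewrite /w addrC addKr normcM (_ : N (0 +i* s)%C = s); last first.
    by rewrite /= expr0n add0r sqrtr_sqr gtr0_norm.
  by rewrite /s; field; rewrite gt_eqF.
have hm : m / 2 < m by rewrite ltr_pdivrMr// ltr_pMr// ltr1n.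
exists w; last by rewrite wz (lt_le_trans hm).
apply/slit_diskP; split.
- apply/eqP => wb; move: hm; rewrite -wz wb ltNge normcBC => /negP; exact.
- move=> c cS cb; apply: lt_le_trans (He c cS cb).
  by have := normcB3 z w b; rewrite wz; lra.
- move=> u u0; rewrite /w zE -addrA => /addrI; rewrite -mulrDl => /(mulIf d0) /eqP.
  by rewrite eq_complex /= add0r (gt_eqF s0) andbF.
Qed.

Section PowerSeries.
Variables (e : nat -> C) (f : C -> C).
Hypothesis ef : forall z, V z -> (fun n => \sum_(m < n) e m * (z - b) ^+ m) @ \oo --> f z.

Lemma power_series_bound z : V z ->
  exists2 B : R, 0 <= B & forall m, N (e m) * N (z - b) ^+ m <= B.
Proof.
move=> /ef /cvgnCP /(_ 1 ltr01) [n0 H].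
(* From [n0] on, consecutive partial sums are within 1 of the limit, so a term is at most 2; the
   finite sum covers the earlier terms. *)
exists (2 + \sum_(m < n0) N (e m) * N (z - b) ^+ m).
  by rewrite addr_ge0// sumr_ge0// => m _; rewrite mulr_ge0 ?exprn_ge0 ?normc_ge0.
move=> m; have [mn|nm] := ltnP m n0.
  rewrite (bigD1 (Ordinal mn))//= addrCA lerDl addr_ge0// sumr_ge0// => k _.
  by rewrite mulr_ge0 ?exprn_ge0 ?normc_ge0.
apply: (@le_trans _ _ 2); last first.
  by rewrite lerDl sumr_ge0// => k _; rewrite mulr_ge0 ?exprn_ge0 ?normc_ge0.
have := H m.+1 (leq_trans nm (leqnSn m)); have := H m nm.
rewrite big_ord_recr -normcX -normcM; set S := \sum_(k < m) _; set a := e m * _ => /= h1 h2.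
have := normcB3 (f z - S) a 0; rewrite subr0.
have -> : a - (f z - S) = S + a - f z by ring.
have -> : f z - S - 0 = - (S - f z) by ring.
by rewrite normcN; lra.
Qed.

Lemma power_series_deriv f' : (forall z, V z -> cder f z (f' z)) ->
  forall z, V z -> (fun n => \sum_(m < n) e m * m%:R * (z - b) ^+ m.-1) @ \oo --> f' z.
Proof.
move=> ff z Vz; have [l l1 Vl] := slit_outward Vz.
have [B B0 HB] := power_series_bound Vl.
have [r r0 Hr] := slit_ball Vz.
have zb0 : 0 < N (z - b) by case/slit_diskP: Vz => zb _ _; rewrite normc_gt0 subr_eq0.
have l0 : 0 < l by exact: lt_trans l1.
(* As [mu] lies strictly between 1 and [l], the points w near [z] satisfy |w - b| <= mu |z - b|,
   while the coefficients are controlled at radius l |z - b|: the ratio is [th < 1]. *)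
pose mu := (1 + l) / 2.
have mu0 : 0 < mu by rewrite divr_gt0// addr_gt0.
pose th := mu / l.
have th0 : 0 <= th by rewrite divr_ge0// ltW.
have th1 : th < 1 by rewrite ltr_pdivrMr// mul1r ltr_pdivrMr//; lra.
have rho0 : 0 < Num.min r ((mu - 1) * N (z - b)).
  by rewrite lt_min r0 mulr_gt0// subr_gt0 ltr_pdivlMr//; lra.
apply: (@series_deriv z _ (fun m w => e m * (w - b) ^+ m)
  (fun m w => e m * m%:R * (w - b) ^+ m.-1) (fun k => B * th ^+ k) (B / (1 - th)) f f' rho0).
- by move=> w; rewrite lt_min => /andP[/Hr/ff].
- move=> k w _.
  have h1 : cder (fun w => w - b) w 1.
    by have := cderB (cder_id w) (cder_cst b w); rewrite subr0.
  have := cderM (cder_cst (e k) w) (cder_exprn k h1).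
  by rewrite mulr0 addr0 mulr1 mulrA.
- move=> k w; rewrite lt_min => /andP[_ wz].
  have wb : N (w - b) <= th * N (l%:C%C * (z - b)).
    rewrite normcM normc_real gtr0_norm// mulrA divfK ?gt_eqF//.
    by have := normcB3 z w b; lra.
  have := HB k; rewrite addrC addKr => H.
  rewrite normcM normcX; apply: (@le_trans _ _ (N (e k) * (th * N (l%:C%C * (z - b))) ^+ k)).
    rewrite ler_wpM2l ?normc_ge0// lerXn2r ?nnegrE ?normc_ge0//.
    by rewrite mulr_ge0 ?normc_ge0.
  by rewrite exprMn mulrCA mulrC ler_wpM2r// exprn_ge0.
- have -> : (fun n => \sum_(k < n) B * th ^+ k) = series (geometric B th).
    by apply/funext => n; rewrite /series/= big_mkord.
  by apply: cvg_geometric_series; rewrite ger0_norm.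
- by move=> w; rewrite lt_min => /andP[/Hr/ef].
Qed.

Lemma power_series_small : e 0%N = 0 -> exists K, exists2 r : R, 0 < r &
  forall z, V z -> N (z - b) < r -> N (f z) <= K * N (z - b).
Proof.
move=> e00; have [z1 V1 _] := slit_near_center ltr01.
have [B B0 HB] := power_series_bound V1.
have zb0 : 0 < N (z1 - b) by case/slit_diskP: V1 => zb _ _; rewrite normc_gt0 subr_eq0.
exists (2 * B / N (z1 - b)), (N (z1 - b) / 2); first by rewrite divr_gt0.
move=> z Vz zr; pose th := N (z - b) / N (z1 - b).
have th0 : 0 <= th by rewrite divr_ge0 ?normc_ge0.
have th2 : th <= 1 / 2 by rewrite ler_pdivrMr//; lra.
have S n : N (\sum_(m < n) e m * (z - b) ^+ m) <= 2 * B * th.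
  (* The sharper bound makes the induction close; the predecessor accounts for the vanishing
     constant term. *)
  have : N (\sum_(m < n) e m * (z - b) ^+ m) <= 2 * B * th * (1 - (1 / 2) ^+ n.-1).
    case: n => [|n]; first by rewrite big_ord0 normc0 subrr mulr0.
    rewrite /=; elim: n => [|n IH].
      by rewrite big_ord_recr big_ord0 /= e00 mul0r addr0 normc0 subrr mulr0.
    have h1 : N (e n.+1 * (z - b) ^+ n.+1) <= B * th ^+ n.+1.
      rewrite normcM normcX (_ : N (z - b) = N (z1 - b) * th); last first.
        by rewrite mulrC divfK// gt_eqF.
      by rewrite exprMn mulrA ler_wpM2r// exprn_ge0.
    have h2 : B * th ^+ n.+1 <= B * th * (1 / 2) ^+ n.
      rewrite exprS mulrA; apply: ler_wpM2l; first exact: mulr_ge0.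
      by apply: lerXn2r; rewrite ?nnegrE.
    rewrite big_ord_recr; apply: le_trans (le_normcD _ _) _.
    apply: (@le_trans _ _ (2 * B * th * (1 - (1 / 2) ^+ n) + B * th * (1 / 2) ^+ n)).
      by apply: lerD; [exact: IH|exact: le_trans h1 h2].
    by rewrite exprS le_eqVlt; apply/orP; left; apply/eqP; field.
  move/le_trans; apply; rewrite -subr_ge0 mulrBr mulr1 opprB addrC subrK.
  have p0 : 0 <= (1 / 2 : R) ^+ n.-1 by apply: exprn_ge0; lra.
  have q0 : 0 <= 2 * B * th by apply: mulr_ge0 => //; apply: mulr_ge0.
  exact: mulr_ge0.
rewrite leNgt; apply/negP => H.
have [|n0 Hn] := (cvgnCP _ _).1 (ef Vz) (N (f z) - 2 * B / N (z1 - b) * N (z - b)).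
  by rewrite subr_gt0.
have := Hn n0 (leqnn _); have := S n0; set A := \sum_(m < n0) _.
have := normcB3 A (f z) 0; rewrite !subr0 normcBC.
by rewrite /th; move: H; rewrite mulrA [2 * B / _ * _]mulrAC; lra.
Qed.

End PowerSeries.
End Slit.

End SeriesAndLogarithms.

(** * Series coefficients of Li^b and their continuation to U *)

Section Polylogarithm.
Variable R : realType.
Local Notation C := (Cplx R).
Local Notation N := (@normc R).
Implicit Types (b c z : C) (w : seq C) (s : seq (nat * C)).

Lemma inAbE b w : inAb b w = (w == [::]) || (last b w != b).
Proof.
case/lastP: w => [|w c]; rewrite /inAb ?rev_rcons //= last_rcons.
by rewrite -size_eq0 size_rcons.
Qed.

Lemma inAb_cons b c w : inAb b (c :: w) = (last c w != b).
Proof. by rewrite inAbE. Qed.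

Lemma parse_neq0 b k w : last b w != b -> Defs.parse b k w != [::].
Proof.
elim: w k => [|c w IH] k /=; first by rewrite eqxx.
by case: (eqVneq c b) => [->|_] //; exact: IH.
Qed.

Lemma parse_shift b k w :
  Defs.parse b k.+1 w = if Defs.parse b k w is (k1, c1) :: s then (k1.+1, c1) :: s else [::].
Proof. by elim: w k => [|c w IH] k //=; case: eqVneq => // _; rewrite IH. Qed.

Definition lib_coef b s m : C := Eterm [seq (kc.1, (kc.2 - b)^-1) | kc <- s] m.

(** The exponents m_i - m_{i+1} telescope to [m], so each nested sum is a coefficient times a power
    of [z - b]. *)
Lemma Eterm_scale b s (t : C) m :
  Eterm [seq (kc.1, t / (kc.2 - b)) | kc <- s] m = lib_coef b s m * t ^+ m.
Proof.
rewrite /lib_coef; elim: s m => [|[k c] s IH] m /=.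
  by case: m => [|m] /=; rewrite ?mulr1// mul0r.
case: m => [|m]; first by rewrite mul0r.
rewrite -mulrA mulr_suml; congr (_ * _); apply: eq_bigr => i _; rewrite IH.
rewrite exprMn (_ : t ^+ m.+1 = t ^+ (m.+1 - i) * t ^+ i); last first.
  by rewrite -exprD subnK// ltnW.
by move: (t ^+ (m.+1 - i)) (_ ^+ (m.+1 - i)) (Eterm _ _) (t ^+ i) => x1 x2 x3 x4; ring.
Qed.

Lemma LibSumE b s z n : LibSum b s z n = \sum_(m < n) lib_coef b s m * (z - b) ^+ m.
Proof. by apply: eq_bigr => m _; exact: Eterm_scale. Qed.

Lemma lib_coef0 b s : s != [::] -> lib_coef b s 0 = 0.
Proof. by case: s => [//|[k c] s _]. Qed.

(** Coefficient form of (z - b) d/dz Li^b(x_b w) = Li^b(w). *)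
Lemma lib_coef_shift b k c s m :
  lib_coef b ((k.+1, c) :: s) m * m%:R = lib_coef b ((k, c) :: s) m.
Proof.
case: m => [|m]; rewrite /lib_coef /=; first by rewrite mul0r.
have m0 : m.+1%:R != 0 :> C by rewrite pnatr_eq0.
by rewrite mulrAC exprSr invfM divfK.
Qed.

(** Splitting off the largest inner index [m' = m] gives the coefficient form of (c - b) L' = (z -
    b) L' + S, where L and S are the unsigned series of x_c w and w. *)
Lemma lib_coef_cons b c s m :
  lib_coef b ((1%N, c) :: s) m.+1 * m.+1%:R =
  (c - b)^-1 * (lib_coef b ((1%N, c) :: s) m * m%:R) + (c - b)^-1 * lib_coef b s m.
Proof.
rewrite /lib_coef /=.
have D j : (j.+1%:R ^+ 1)^-1 * j.+1%:R = 1 :> C by rewrite expr1 mulVf// pnatr_eq0.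
rewrite mulrAC D mul1r big_ord_recr /= subSnn expr1; congr (_ + _).
case: m => [|m]; first by rewrite big_ord0 !mul0r mulr0.
rewrite [in RHS]mulrAC D mul1r mulr_sumr; apply: eq_bigr => i _.
by rewrite subSn ?exprS ?mulrA// ltnW.
Qed.

Section Continuation.
Variables (Sigma : seq C) (b d : C) (U : set C) (G : seq C -> C -> C).
Hypotheses (bS : b \in Sigma) (Uo : open U) (Uc : connected U)
  (US : forall z, U z -> z \notin Sigma) (d0 : d != 0)
  (VU : slit_disk Sigma b d `<=` U) (GL : is_Lib Sigma b d U G).
Local Notation V := (slit_disk Sigma b d).

Lemma Lib_derive w : sigword Sigma w -> inAb b w -> forall z, U z -> cder (G w) z ('D_1 (G w) z).
Proof.
move=> wS wb z Uz; have [H _] := GL wS wb.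
by apply/is_derive_cder; exact/derivableP/H.
Qed.

Lemma Lib_series w : sigword Sigma w -> inAb b w -> forall z, V z ->
  (fun n => \sum_(m < n) lib_coef b (Defs.parse b 0 w) m * (z - b) ^+ m) @ \oo -->
  (-1) ^+ size (Defs.parse b 0 w) * G w z.
Proof.
move=> wS wb z Vz; have [_ H] := GL wS wb.
rewrite (_ : (fun n => _) = LibSum b (Defs.parse b 0 w) z); first exact: H.
by apply/funext => n; rewrite LibSumE.
Qed.

Lemma Lib_series_derive w : sigword Sigma w -> inAb b w -> forall z, V z ->
  (fun n => \sum_(m < n) lib_coef b (Defs.parse b 0 w) m * m%:R * (z - b) ^+ m.-1) @ \oo -->
  (-1) ^+ size (Defs.parse b 0 w) * 'D_1 (G w) z.
Proof.
move=> wS wb z Vz; have sg : forall z, V z -> cder (fun z => (-1) ^+ size (Defs.parse b 0 w) * G w z) z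
    ((-1) ^+ size (Defs.parse b 0 w) * 'D_1 (G w) z).
  move=> u /VU Uu; have := cderM (cder_cst ((-1) ^+ size (Defs.parse b 0 w)) u) (Lib_derive wS wb Uu).
  by rewrite mulr0 addr0.
exact: (power_series_deriv d0 (Lib_series wS wb) sg Vz).
Qed.

Lemma Lib_derive_slit c w : c \in Sigma -> sigword Sigma w -> inAb b w -> inAb b (c :: w) ->
  forall z, V z -> 'D_1 (G (c :: w)) z = G w z / (z - c).
Proof.
move=> cS wS wb cwb z Vz.
have cwS : sigword Sigma (c :: w) by rewrite /sigword/= cS.
have H1 := Lib_series wS wb Vz; have H2 := Lib_series_derive cwS cwb Vz.
have zc : z - c != 0.
  by rewrite subr_eq0; apply: contraTneq cS => <-; exact/US/VU.
have zb : z - b != 0.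
  by rewrite subr_eq0; apply: contraTneq bS => <-; exact/US/VU.
have s0 n : (-1) ^+ n != 0 :> C by rewrite expf_neq0// oppr_eq0 oner_eq0.
have hd := @norm_hausdorff _ C.
have [cb|cb] := eqVneq c b.
  move: cwb zc H2; rewrite {c cS cwS}cb inAb_cons => lw zc H2.
  have wn : last b w != b by [].
  have [k [c1 [s pw]]] : exists k c1 s, Defs.parse b 0 w = (k, c1) :: s.
    by move: (parse_neq0 0 wn); case: (Defs.parse b 0 w) => [//|[k c1] s] _; exists k, c1, s.
  have pbw : Defs.parse b 0 (b :: w) = (k.+1, c1) :: s by rewrite /= eqxx parse_shift pw.
  move: H1 H2; rewrite pbw pw /= => H1 H2.
  have E n : \sum_(m < n) lib_coef b ((k, c1) :: s) m * (z - b) ^+ m =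
      (\sum_(m < n) lib_coef b ((k.+1, c1) :: s) m * m%:R * (z - b) ^+ m.-1) * (z - b).
    rewrite mulr_suml; apply: eq_bigr => -[[|m] mn] _ /=.
      by rewrite lib_coef0// !mul0r.
    by rewrite lib_coef_shift exprSr mulrA.
  have H3 : (fun n => \sum_(m < n) lib_coef b ((k, c1) :: s) m * (z - b) ^+ m) @ \oo -->
      ((-1) ^+ (size s).+1 * 'D_1 (G (b :: w)) z) * (z - b).
    rewrite (_ : (fun n => _) = (fun n =>
      (\sum_(m < n) lib_coef b ((k.+1, c1) :: s) m * m%:R * (z - b) ^+ m.-1) * (z - b))).
      by apply: cvgM H2 _; exact: cvg_cst.
    by apply/funext => n; exact: E.
  apply: (mulIf zb); rewrite divfK//; apply: (mulfI (s0 (size s).+1)).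
  by rewrite mulrA; exact/esym/(cvg_unique hd H1 H3).
have pcw : Defs.parse b 0 (c :: w) = (1%N, c) :: Defs.parse b 0 w by rewrite /= (negbTE cb).
move: H2; rewrite pcw /=; set s := Defs.parse b 0 w in H1 *; set D := 'D_1 _ z => H2.
have cbn : c - b != 0 by rewrite subr_eq0.
have E n : \sum_(m < n.+1) lib_coef b ((1%N, c) :: s) m * m%:R * (z - b) ^+ m.-1 =
    (c - b)^-1 * (z - b) * (\sum_(m < n) lib_coef b ((1%N, c) :: s) m * m%:R * (z - b) ^+ m.-1) +
    (c - b)^-1 * (\sum_(m < n) lib_coef b s m * (z - b) ^+ m).
  rewrite big_ord_recl mulr0 mul0r add0r !mulr_sumr -big_split; apply: eq_bigr => i _.
  rewrite lift0 lib_coef_cons mulrDl; congr (_ + _); last by rewrite mulrA.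
  case: i => -[|i] /= _; first by rewrite mulr0 !(mul0r, mulr0).
  by rewrite exprS; ring.
have H3 : (fun n => \sum_(m < n.+1) lib_coef b ((1%N, c) :: s) m * m%:R * (z - b) ^+ m.-1) @ \oo -->
    (-1) ^+ (size s).+1 * D.
  apply/cvgnCP => e e0; have [n0 Hn] := (cvgnCP _ _).1 H2 e e0.
  by exists n0 => n nn; apply: Hn; exact: leqW.
have H4 : (fun n => \sum_(m < n.+1) lib_coef b ((1%N, c) :: s) m * m%:R * (z - b) ^+ m.-1) @ \oo -->
    (c - b)^-1 * (z - b) * ((-1) ^+ (size s).+1 * D) + (c - b)^-1 * ((-1) ^+ size s * G w z).
  rewrite (_ : (fun n => _) = (fun n => (c - b)^-1 * (z - b) *
    (\sum_(m < n) lib_coef b ((1%N, c) :: s) m * m%:R * (z - b) ^+ m.-1) +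
    (c - b)^-1 * (\sum_(m < n) lib_coef b s m * (z - b) ^+ m))); last first.
    by apply/funext => n; exact: E.
  apply: cvgD; first by apply: cvgM; [exact: cvg_cst|exact: H2].
  by apply: cvgM; [exact: cvg_cst|exact: H1].
(* In the limit (c - z) X = Y; the extra letter contributes a sign -1, which turns c - z into z -
   c. *)
have gen (X Y : C) : X = (c - b)^-1 * (z - b) * X + (c - b)^-1 * Y ->
    X * (c - b) = (z - b) * X + Y.
  by move=> XY; rewrite [in LHS]XY; field.
have Q := gen ((-1) ^+ (size s).+1 * D) ((-1) ^+ size s * G w z) (cvg_unique hd H3 H4).
move: Q; rewrite exprS mulN1r; set S := (-1) ^+ size s => Q.
apply: (mulfI zc); rewrite [X in _ = X]mulrC divfK//; apply: (mulfI (s0 (size s))); rewrite -/S.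
rewrite (_ : S * G w z = - S * D * (c - b) - (z - b) * (- S * D)); first by ring.
by rewrite Q addrAC subrr add0r.
Qed.

Lemma slit_point : exists2 p, V p & U p.
Proof.
by have [p Vp _] := slit_near_center Sigma b d0 ltr01; exists p => //; exact: VU.
Qed.

Lemma slit_identity f : (forall z, U z -> cderivable f z) -> (forall z, V z -> f z = 0) ->
  forall z, U z -> f z = 0.
Proof.
move=> fd fV; have [p Vp Up] := slit_point.
apply: identity_principle Uo Uc fd Up _.
by have [r r0 Hr] := slit_ball d0 Vp; exists r => // z /Hr/fV.
Qed.

Lemma Lib_cons_cder c w : c \in Sigma -> sigword Sigma w -> inAb b w -> inAb b (c :: w) ->
  forall z, U z -> cder (G (c :: w)) z (G w z / (z - c)).
Proof.
move=> cS wS wb cwb z Uz.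
have cwS : sigword Sigma (c :: w) by rewrite /sigword/= cS.
have cd := Lib_derive cwS cwb.
suff <- : 'D_1 (G (c :: w)) z = G w z / (z - c) by exact: cd.
apply/eqP; rewrite -subr_eq0; apply/eqP.
apply: (@slit_identity (fun z => 'D_1 (G (c :: w)) z - G w z / (z - c))) => // {z Uz} z zU.
(* The identity principle needs the derivative itself to be holomorphic on [U]. *)
- apply: cderivableB.
    have [r r0 rU] : exists2 r : R, 0 < r & forall u, N (u - z) < r -> U u.
      by apply/nbhsCP; move: Uo; rewrite openE => /(_ z zU).
    by apply: (cderivable_deriv r0) => u /rU; exact: cd.
  apply: cderivableM; first by eexists; exact: Lib_derive.
  by apply: cderivable_inv; apply: contraTneq cS => <-; exact: US.
- by rewrite Lib_derive_slit// subrr.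
Qed.

Lemma Lib_nil z : U z -> G [::] z = 1.
Proof.
move=> Uz; apply/eqP; rewrite -subr_eq0; apply/eqP.
apply: (@slit_identity (fun z => G [::] z - 1)) => // {z Uz} z zU.
  by apply: cderivableB; [eexists; exact: Lib_derive|exact: cderivable_cst].
have H := @Lib_series [::] isT isT z zU; rewrite /= mul1r in H.
apply/eqP; rewrite subr_eq0; apply/eqP; apply: (cvg_unique (@norm_hausdorff _ C) H).
apply/cvgnCP => e e0; exists 1%N => -[//|n] _.
rewrite big_ord_recl big1 => [|i _]; last by rewrite /lib_coef/= mul0r.
by rewrite addr0 /lib_coef [Eterm _ _]/= expr0 mulr1 subrr normc0.
Qed.

(** The series has no constant term, hence is O(z - b) on the slit disk; continuity of [G w] extends
    the smallness to points of [U] near [b]. *)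
Lemma Lib_lim w : sigword Sigma w -> inAb b w -> w != [::] ->
  G w @ within U (nbhs b) --> 0.
Proof.
move=> wS wb wn; apply/cvgCP => e e0.
have pn : Defs.parse b 0 w != [::].
  by apply: parse_neq0; move: wb; rewrite inAbE (negbTE wn).
have [K [r r0 HK]] := power_series_small d0 (Lib_series wS wb) (lib_coef0 b pn).
have [|q q0 Hq] := @radius_gap R Sigma b b.
  by move=> c _ cb; rewrite subrr normc0 normc_gt0 subr_eq0.
have K0 : 0 < `|K| + 1 by rewrite ltr_wpDl.
pose t := Num.min (Num.min r q) (e / 4 / (`|K| + 1)).
have t0 : 0 < t by rewrite !lt_min r0 q0 !divr_gt0.
rewrite near_withinE; apply/nbhsCP; exists t => // z zt Uz.
have zb : z != b by apply: contraTneq bS => <-; exact: US.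
have e4 : 0 < e / 4 by rewrite divr_gt0.
have [g g0 Hg] := cder_ccont (Lib_derive wS wb Uz) e4.
have [||v Vv vz] := @slit_dense R Sigma b d d0 z (Num.min g (t - N (z - b))) zb.
- move=> c cS cb; apply: (@lt_le_trans _ _ q); last first.
    by have := Hq c cS cb; rewrite subrr normc0 add0r.
  by apply: lt_le_trans zt _; rewrite !ge_min lexx orbT.
- by rewrite lt_min g0 subr_gt0.
move: vz; rewrite lt_min => /andP[vg vt].
have vb : N (v - b) < t by have := normcB3 z v b; lra.
have vr : N (v - b) < r by apply: lt_le_trans vb _; rewrite !ge_min lexx.
have := HK v Vv vr; rewrite normcM normcX normcN normc1 expr1n mul1r => H.
have H2 : N (G w v) <= e / 4.
  apply: le_trans H _; apply: (@le_trans _ _ ((`|K| + 1) * N (v - b))).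
    by rewrite ler_wpM2r ?normc_ge0//; have := ler_norm K; lra.
  rewrite mulrC -ler_pdivlMr//; apply: (le_trans (ltW vb)).
  by rewrite ge_min lexx orbT.
have := Hg v vg; have := normcB3 (G w v) (G w z) 0.
rewrite !subr0 (normcBC (G w z)); lra.
Qed.

End Continuation.
End Polylogarithm.

(** * Shuffle characters *)

Section ShuffleCharacters.
Variable R : realType.
Local Notation C := (Cplx R).
Implicit Types (c : C) (u v w x : seq C).

Lemma shuffleN u : shuffle u [::] = [:: u].
Proof. by case: u. Qed.

Lemma shuffle_cons c u c' v : shuffle (c :: u) (c' :: v) =
  [seq c :: x | x <- shuffle u (c' :: v)] ++ [seq c' :: x | x <- shuffle (c :: u) v].
Proof. by []. Qed.

(** The induction that follows the two recursive calls of [shuffle]. *)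
Lemma shuffle_ind (P : seq C -> seq C -> Prop) :
  (forall v, P [::] v) -> (forall u, P u [::]) ->
  (forall c u c' v, P u (c' :: v) -> P (c :: u) v -> P (c :: u) (c' :: v)) ->
  forall u v, P u v.
Proof.
move=> P1 P2 P3; elim=> [//|c u IHu]; elim=> [//|c' v IHv].
exact: P3.
Qed.

Lemma big_shuffle_cons (F : seq C -> C) c u c' v :
  \sum_(x <- shuffle (c :: u) (c' :: v)) F x =
  \sum_(x <- shuffle u (c' :: v)) F (c :: x) + \sum_(x <- shuffle (c :: u) v) F (c' :: x).
Proof. by rewrite shuffle_cons big_cat !big_map. Qed.

Lemma shuffle_perm u v x : x \in shuffle u v -> perm_eq x (u ++ v).
Proof.
move: u v x; apply: shuffle_ind => [v|u|c u c' v IH1 IH2] x.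
- by rewrite mem_seq1 => /eqP ->.
- by rewrite shuffleN mem_seq1 cats0 => /eqP ->.
rewrite shuffle_cons mem_cat => /orP[] /mapP[y yu ->].
  by rewrite /= perm_cons; exact: IH1.
rewrite -cat1s perm_sym perm_catC /= perm_cons perm_sym.
by rewrite (perm_trans (IH2 _ yu))// perm_catC.
Qed.

Lemma shuffle_size u v x : x \in shuffle u v -> size x = (size u + size v)%N.
Proof. by move=> /shuffle_perm/perm_size; rewrite size_cat. Qed.

Lemma shuffle_sigword (Sigma : seq C) u v x : sigword Sigma u -> sigword Sigma v ->
  x \in shuffle u v -> sigword Sigma x.
Proof.
move=> uS vS /shuffle_perm/perm_all E.
by rewrite /sigword E all_cat; apply/andP.
Qed.

Definition char_on (Sigma : seq C) (A : Defs.series R) := forall u v,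
  sigword Sigma u -> sigword Sigma v -> \sum_(x <- shuffle u v) A x = A u * A v.

(** The deconcatenations of [w], as a list that satisfies a recursion on [w], unlike the indexed sum
    in [smul]. *)
Definition splits w : seq (seq C * seq C) :=
  [seq (take i w, drop i w) | i <- iota 0 (size w).+1].

Lemma splits_cons c w : splits (c :: w) = ([::], c :: w) :: [seq (c :: p.1, p.2) | p <- splits w].
Proof.
rewrite /splits -map_comp [size (c :: w)]/= -[iota 0 (size w).+2]/(0%N :: iota 1 (size w).+1).
by rewrite map_cons take0 drop0 -[1%N]addn0 iotaDl -map_comp.
Qed.

Lemma big_splits_cons (f : seq C * seq C -> C) c w :
  \sum_(p <- splits (c :: w)) f p =
  f ([::], c :: w) + \sum_(p <- splits w) f (c :: p.1, p.2).
Proof. by rewrite splits_cons big_cons big_map. Qed.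

Lemma splits_nil : splits [::] = [:: ([::], [::])].
Proof. by []. Qed.

Lemma splits_sigword (Sigma : seq C) w p : sigword Sigma w -> p \in splits w ->
  sigword Sigma p.1 && sigword Sigma p.2.
Proof.
move=> wS /mapP[i _ -> /=]; rewrite -all_cat cat_take_drop; exact: wS.
Qed.

Lemma smulE (A B : Defs.series R) w : smul A B w = \sum_(p <- splits w) A p.1 * B p.2.
Proof.
rewrite /smul /splits big_map -(big_mkord xpredT (fun i => A (take i w) * B (drop i w))).
by rewrite /index_iota subn0.
Qed.

(* Deconcatenation is a morphism for the shuffle product. *)
Lemma big_shuffle_splits (f : seq C -> seq C -> C) u v :
  \sum_(x <- shuffle u v) \sum_(p <- splits x) f p.1 p.2 =
  \sum_(p <- splits u) \sum_(q <- splits v)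
    \sum_(y <- shuffle p.1 q.1) \sum_(z <- shuffle p.2 q.2) f y z.
Proof.
move: u v f; apply: shuffle_ind => [v|u|c u c' v IH1 IH2] f.
- rewrite /= big_seq1 splits_nil big_seq1 /=.
  by apply: eq_bigr => q _; rewrite !big_seq1.
- rewrite shuffleN big_seq1; apply: eq_bigr => p _.
  by rewrite splits_nil big_seq1 !shuffleN !big_seq1.
pose T (f : seq C -> seq C -> C) (p q : seq C * seq C) :=
  \sum_(y <- shuffle p.1 q.1) \sum_(z <- shuffle p.2 q.2) f y z.
have E (l : C) (s : seq (seq C)) : \sum_(x <- s) \sum_(p <- splits (l :: x)) f p.1 p.2 =
    \sum_(x <- s) f [::] (l :: x) +
    \sum_(x <- s) \sum_(p <- splits x) f (l :: p.1) p.2.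
  by rewrite -big_split; apply: eq_bigr => x _; rewrite big_splits_cons.
rewrite (big_shuffle_cons (fun x => \sum_(p <- splits x) f p.1 p.2)) !E.
rewrite (IH1 (fun y z => f (c :: y) z)) (IH2 (fun y z => f (c' :: y) z)).
rewrite addrACA -(big_shuffle_cons (fun x => f [::] x)).
rewrite (big_splits_cons (fun p => \sum_(q <- splits (c' :: v)) T f p q)).
rewrite (big_splits_cons (fun p => T f ([::], c :: u) p)) -addrA.
congr (_ + _); first by rewrite /T /= big_seq1.
rewrite (big_splits_cons (fun p => \sum_(q <- splits v) T (fun y z => f (c' :: y) z) p q)).
rewrite addrCA; congr (_ + _).
  by apply: eq_bigr => q _; rewrite /T /= !big_seq1.
rewrite -big_split; apply: eq_bigr => p _.
rewrite (big_splits_cons (fun q => T (fun y z => f (c :: y) z) p q)).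
rewrite /= (big_splits_cons (fun q => T f (c :: p.1, p.2) q)) -addrA; congr (_ + _).
  by rewrite /T /= shuffleN !big_seq1.
rewrite -big_split; apply: eq_bigr => q _.
by rewrite /T /= (big_shuffle_cons (fun y => \sum_(z <- shuffle p.2 q.2) f y z)).
Qed.

Lemma char_smul (Sigma : seq C) (A B : Defs.series R) :
  char_on Sigma A -> char_on Sigma B -> char_on Sigma (smul A B).
Proof.
move=> Ac Bc u v uS vS; rewrite !smulE mulr_suml.
under eq_bigr => x _ do rewrite smulE.
rewrite (big_shuffle_splits (fun y z => A y * B z)); apply: eq_big_seq => p pu.
rewrite mulr_sumr; apply: eq_big_seq => q qv.
have /andP[p1 p2] := splits_sigword uS pu; have /andP[q1 q2] := splits_sigword vS qv.
under eq_bigr => y _ do rewrite -mulr_sumr.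
by rewrite -mulr_suml Ac// Bc// mulrACA.
Qed.

Lemma sexp_nil c (L : C) : sexp c L [::] = 1.
Proof. by rewrite /sexp /= expr0 divr1. Qed.

Lemma sexp_cons c (L : C) l w :
  sexp c L (l :: w) = (l == c)%:R * L / (size w).+1%:R * sexp c L w.
Proof.
rewrite /sexp /= eqseq_cons; case: eqVneq => _; last by rewrite !mul0r.
case: eqP => _ /=; last by rewrite mulr0.
rewrite mul1r exprS factS natrM invfM mulrACA; congr (_ * _).
Qed.

(** All words of a shuffle have the same length, so the induction reduces to (1/p + 1/q)/(p + q) =
    1/(pq) for the lengths p and q. *)
Lemma char_sexp (Sigma : seq C) c (L : C) : char_on Sigma (sexp c L).
Proof.
move=> u v _ _; move: u v; apply: shuffle_ind => [v|u|l u l' v IH1 IH2].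
- by rewrite big_seq1 sexp_nil mul1r.
- by rewrite shuffleN big_seq1 sexp_nil mulr1.
have E (k : C) (s : seq (seq C)) (n : nat) : (forall x, x \in s -> size x = n) ->
    \sum_(x <- s) sexp c L (k :: x) = (k == c)%:R * L / n.+1%:R * \sum_(x <- s) sexp c L x.
  by move=> sn; rewrite mulr_sumr; apply: eq_big_seq => x /sn xn; rewrite sexp_cons xn.
rewrite big_shuffle_cons (E l _ _ (fun x => @shuffle_size u (l' :: v) x)).
rewrite (E l' _ _ (fun x => @shuffle_size (l :: u) v x)) IH1 IH2 !sexp_cons /=.
have -> : (((size u).+1 + size v).+1%:R : C) = (size u).+1%:R + (size v).+1%:R.
  by rewrite -natrD addnS.
have -> : ((size u + (size v).+1).+1%:R : C) = (size u).+1%:R + (size v).+1%:R.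
  by rewrite -natrD addSn.
have p0 : (size u).+1%:R != 0 :> C by rewrite pnatr_eq0.
have q0 : (size v).+1%:R != 0 :> C by rewrite pnatr_eq0.
have pq0 : (size u).+1%:R + (size v).+1%:R != 0 :> C by rewrite -natrD pnatr_eq0.
move: ((size u).+1%:R) ((size v).+1%:R) p0 q0 pq0 => p q p0 q0 pq0.
by field; rewrite p0 q0 pq0.
Qed.

Lemma eq_smul (Sigma : seq C) (A A' B B' : Defs.series R) w : sigword Sigma w ->
  (forall u, sigword Sigma u -> A u = A' u) -> (forall u, sigword Sigma u -> B u = B' u) ->
  smul A B w = smul A' B' w.
Proof.
move=> wS AA BB; rewrite !smulE; apply: eq_big_seq => p pw.
by have /andP[p1 p2] := splits_sigword wS pw; rewrite AA// BB.
Qed.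

Lemma smul_nil (A B : Defs.series R) : smul A B [::] = A [::] * B [::].
Proof. by rewrite smulE big_seq1. Qed.

Lemma smul_cons (A B : Defs.series R) c w :
  smul A B (c :: w) = A [::] * B (c :: w) + smul (fun x => A (c :: x)) B w.
Proof. by rewrite !smulE (big_splits_cons (fun p => A p.1 * B p.2)). Qed.

Lemma smulA (A B D : Defs.series R) w : smul (smul A B) D w = smul A (smul B D) w.
Proof.
elim: w A B => [|c w IH] A B; first by rewrite !smul_nil mulrA.
rewrite !smul_cons -IH.
have -> : smul (fun x => smul A B (c :: x)) D w =
    A [::] * smul (fun x => B (c :: x)) D w + smul (smul (fun x => A (c :: x)) B) D w.
  rewrite !smulE mulr_sumr -big_split; apply: eq_bigr => p _.
  by rewrite smul_cons mulrDl mulrA.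
by rewrite smul_nil mulrDr !mulrA addrA.
Qed.

Lemma smul1l (A : Defs.series R) w : smul (@sone R) A w = A w.
Proof.
case: w => [|c w]; first by rewrite smul_nil mul1r.
rewrite smul_cons mul1r [X in _ + X](_ : _ = 0) ?addr0//.
by rewrite smulE big1// => p _; rewrite mul0r.
Qed.

Lemma smul1r (A : Defs.series R) w : smul A (@sone R) w = A w.
Proof.
elim: w A => [|c w IH] A; first by rewrite smul_nil mulr1.
by rewrite smul_cons mulr0 add0r IH.
Qed.

(** On powers of x_c the binomial theorem gives (L + M)^n / n!; any other word has a prefix or
    suffix that is not a power of x_c. *)
Lemma sexp_inv c (L M : C) w : L + M = 0 -> smul (sexp c L) (sexp c M) w = @sone R w.
Proof.
move=> LM0; have [/eqP wc|wc] := boolP (w == nseq (size w) c); last first.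
  rewrite /sone (_ : w == [::] = false); last by apply: contraNF wc => /eqP ->.
  rewrite smulE big_seq big1// => p /mapP[i iw -> /=]; rewrite /sexp.
  case: eqP => // E1; last by rewrite mul0r.
  case: eqP => // E2; last by rewrite mulr0.
  move: wc; rewrite -{1}(cat_take_drop i w) E1 E2 -nseqD.
  by rewrite -size_cat cat_take_drop eqxx.
have -> : smul (sexp c L) (sexp c M) w = (L + M) ^+ size w / (size w)`!%:R.
  set n := size w in wc *; rewrite wc /smul size_nseq addrC exprDn mulr_suml.
  apply: eq_bigr => i _; have ni : (i <= n)%N by rewrite -ltnS.
  rewrite drop_nseq take_nseq// /sexp !size_nseq !eqxx mulrC -[_ *+ 'C(n, i)]mulr_natr.
  rewrite -(bin_fact ni) !natrM.
  have i0 : i`!%:R != 0 :> C by rewrite pnatr_eq0 -lt0n fact_gt0.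
  have j0 : (n - i)`!%:R != 0 :> C by rewrite pnatr_eq0 -lt0n fact_gt0.
  have k0 : ('C(n, i))%:R != 0 :> C by rewrite pnatr_eq0 -lt0n bin_gt0.
  move: (i`!%:R) ((n - i)`!%:R) (('C(n, i))%:R) i0 j0 k0 => x y t x0 y0 t0.
  by field; rewrite x0 y0 t0.
rewrite LM0 /sone; case: w {wc} => [|l w]; first by rewrite expr0 divr1.
by rewrite /= expr0n mul0r.
Qed.

Lemma nseq_last c n : last c (nseq n c) = c.
Proof. by elim: n. Qed.

(** The only suffix of [w] that is a power of x_b is the empty one. *)
Lemma smul_sexpr (A : Defs.series R) b (L : C) w : inAb b w -> smul A (sexp b L) w = A w.
Proof.
move=> wb; rewrite smulE; case/lastP: w wb => [|w c]; first by rewrite big_seq1 sexp_nil mulr1.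
rewrite inAbE last_rcons -size_eq0 size_rcons /= => cb.
rewrite /splits big_map size_rcons -addn1 iotaD big_cat big_seq1 /=.
rewrite take_oversize ?size_rcons// drop_oversize ?size_rcons// sexp_nil mulr1.
rewrite -[0%N :: iota 1 (size w)]/(iota 0 (size w).+1) big_seq big1 ?add0r// => i.
rewrite mem_iota add0n => /andP[_ iw].
rewrite /sexp drop_rcons//; case: eqP; last by rewrite mulr0.
move=> /(congr1 (last b)); rewrite last_rcons nseq_last => E.
by rewrite E eqxx in cb.
Qed.

Lemma smul_sexpl (A : Defs.series R) a (L : C) w : ohead w != Some a -> smul (sexp a L) A w = A w.
Proof.
case: w => [|c w]; first by rewrite smul_nil sexp_nil mul1r.
move=> /= ca; rewrite smul_cons sexp_nil mul1r smulE big1 ?addr0// => p _.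
rewrite sexp_cons (_ : c == a = false) ?mul0r//.
by apply: contraNF ca => /eqP ->.
Qed.

Definition trail b w := find (predC1 b) (rev w).

Lemma trail_rcons b w c : trail b (rcons w c) = if c == b then (trail b w).+1 else 0%N.
Proof. by rewrite /trail rev_rcons /=; case: eqP. Qed.

Lemma trail_cons b c w :
  trail b (c :: w) = if all (pred1 b) w then (size w + (c == b))%N else trail b w.
Proof.
elim/last_ind: w c => [|w l IH] c; first by rewrite /trail /=; case: eqP.
rewrite -rcons_cons trail_rcons IH trail_rcons all_rcons size_rcons /=.
by case: eqVneq => //= _; case: all.
Qed.

Lemma trail_size b w : (trail b w <= size w)%N.
Proof. by rewrite /trail -(size_rev w) find_size. Qed.

(** A letter [b] inserted after the last letter other than [b] yields [rcons w b]; inserted before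
    it, the final run is unchanged. *)
Lemma shuffle1_trail b w x : x \in shuffle w [:: b] ->
  x = rcons w b \/ (trail b x <= trail b w)%N.
Proof.
elim: w x => [|c w IH] x; first by rewrite mem_seq1 => /eqP ->; left.
have all_nseq (s : seq C) : all (pred1 b) s -> s = nseq (size s) b by move/all_pred1P.
rewrite shuffle_cons mem_cat shuffleN map_cons mem_seq1 => /orP[/mapP[y /[dup] ys /IH yw ->]|/eqP ->].
  case: yw => [->|yw]; first by left.
  right; rewrite !trail_cons.
  have sy : size y = (size w).+1 by rewrite (shuffle_size ys) addn1.
  case: ifP => [yb|_].
    have : trail b y = size y.
      rewrite /trail -(size_rev y); apply/eqP; rewrite eqn_leq find_size leqNgt -has_find.
      by rewrite has_predC all_rev yb.
    by move=> E; have := leq_trans (leq_trans (leqnn _) yw) (trail_size b w); rewrite E sy ltnn.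
  by case: ifP => // _; apply: (leq_trans yw); rewrite (leq_trans (trail_size b w))// leq_addr.
rewrite [trail b (b :: _)]trail_cons; case: ifP => [/all_nseq E|_]; last by right.
have H n : b :: nseq n b = rcons (nseq n b) b by elim: n => //= n {1}->.
by left; rewrite -[[:: b, c & w]]/(b :: (c :: w)) E; exact: H.
Qed.

Lemma rcons_shuffle1 b w : rcons w b \in shuffle w [:: b].
Proof.
elim: w => [|c w IH]; first by rewrite mem_seq1.
by rewrite shuffle_cons mem_cat rcons_cons map_f.
Qed.

(* The shuffle of [w] with [x_b] contains [w x_b]; every other word in it has no
   more trailing letters [x_b] than [w]. *)
Lemma trail_ind (Sigma : seq C) b (P : seq C -> Prop) : b \in Sigma ->
  (forall w, sigword Sigma w -> inAb b w -> P w) ->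
  (forall w, sigword Sigma w -> P w ->
     (forall x, x \in shuffle w [:: b] -> x != rcons w b -> P x) -> P (rcons w b)) ->
  forall w, sigword Sigma w -> P w.
Proof.
move=> bS P0 P1 w; move: {2}(trail b w) (leqnn (trail b w)) => n.
elim: n w => [|n IH] w; case/lastP: w => [|w c].
- by move=> _ _; exact: P0.
- rewrite trail_rcons; case: eqVneq => // cb _ wS; apply: P0 => //.
  by rewrite inAbE last_rcons cb orbT.
- by move=> _ _; exact: P0.
rewrite trail_rcons; case: eqVneq => [->|cb _ wS]; last first.
  by apply: P0 => //; rewrite inAbE last_rcons cb orbT.
rewrite ltnS => wn; rewrite /sigword all_rcons => /andP[_ wS]; apply: P1 => //.
  exact: IH.
move=> x xs xw; apply: IH.
  by case: (shuffle1_trail xs) => [xE|/leq_trans]; [rewrite xE eqxx in xw|apply].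
by apply: (shuffle_sigword wS _ xs); rewrite /sigword /= bS.
Qed.

(** Isolates [rcons w b] in a shuffle; its multiplicity is a nonzero integer, so a shuffle relation
    can be solved for the value there. *)
Lemma big_count_neq (s : seq (seq C)) (y : seq C) (f : seq C -> C) :
  \sum_(x <- s) f x = (count_mem y s)%:R * f y + \sum_(x <- s | x != y) f x.
Proof.
rewrite (bigID (pred1 y)) /=; congr (_ + _).
rewrite (eq_bigr (fun=> f y)) => [|x /eqP -> //].
by rewrite big_const_seq iter_addr_0 mulr_natl.
Qed.

Implicit Types (p q : ncpoly R) (F : seq C -> C -> C) (z : C).

(** Makes [lin] well defined on polynomials: regularizations and decompositions are specified by
    coefficients only. *)
Lemma lin_coef F p q z : (forall w, coef p w = coef q w) -> lin F p z = lin F q z.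
Proof.
move=> pq; pose S := undup [seq t.2 | t <- p ++ q].
have E r : {subset [seq t.2 | t <- r] <= S} -> lin F r z = \sum_(w <- S) coef r w * F w z.
  move=> rS; rewrite /lin.
  under [RHS]eq_bigr => w _ do rewrite /coef mulr_suml big_mkcond.
  rewrite exchange_big; apply: eq_big_seq => t tr.
  have tS : t.2 \in S by apply: rS; exact: map_f.
  rewrite (bigD1_seq t.2)//= ?undup_uniq// eqxx big1 ?addr0// => w wt.
  by rewrite eq_sym (negbTE wt).
rewrite !E; first by apply: eq_bigr => w _; rewrite pq.
- by move=> w wq; rewrite mem_undup map_cat mem_cat wq orbT.
- by move=> w wp; rewrite mem_undup map_cat mem_cat wp.
Qed.

Lemma lin_pword F w z : lin F (pword w) z = F w z.
Proof. by rewrite /lin big_seq1 mul1r. Qed.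

Lemma lin_flatten F (ps : seq (ncpoly R)) z : lin F (flatten ps) z = \sum_(p <- ps) lin F p z.
Proof. by rewrite /lin big_flatten. Qed.

Lemma lin_pshuffle_sum F p q z : lin F (pshuffle p q) z =
  \sum_(t <- p) \sum_(s <- q) t.1 * s.1 * \sum_(x <- shuffle t.2 s.2) F x z.
Proof.
rewrite /pshuffle lin_flatten big_allpairs_dep; apply: eq_bigr => t _; apply: eq_bigr => s _.
by rewrite /lin big_map mulr_sumr.
Qed.

Lemma sigpoly_pshuffle (Sigma : seq C) p q : sigpoly Sigma p -> sigpoly Sigma q ->
  sigpoly Sigma (pshuffle p q).
Proof.
move=> /allP pS /allP qS; apply/allP => t /flattenP[s] /allpairsP[[u v] /= [up vq ->]].
by move=> /mapP[x xs ->] /=; apply: shuffle_sigword xs; [exact: pS|exact: qS].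
Qed.

Lemma lin_pshuffle (Sigma : seq C) F p q z : char_on Sigma (F^~ z) ->
  sigpoly Sigma p -> sigpoly Sigma q ->
  lin F (pshuffle p q) z = lin F p z * lin F q z.
Proof.
move=> Fc /allP pS /allP qS; rewrite lin_pshuffle_sum [RHS]mulr_suml.
apply: eq_big_seq => t /pS tS; rewrite mulr_sumr; apply: eq_big_seq => s /qS sS.
by rewrite Fc// mulrACA.
Qed.

Lemma sigpoly_pshpow (Sigma : seq C) p n : sigpoly Sigma p -> sigpoly Sigma (pshpow p n).
Proof. by move=> pS; elim: n => //= n IH; exact: sigpoly_pshuffle. Qed.

Lemma lin_pshpow (Sigma : seq C) F p n z : char_on Sigma (F^~ z) -> F [::] z = 1 ->
  sigpoly Sigma p -> lin F (pshpow p n) z = lin F p z ^+ n.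
Proof.
move=> Fc F1 pS; elim: n => [|n IH]; first by rewrite lin_pword F1 expr0.
by rewrite /= (lin_pshuffle Fc)// ?IH ?exprS//; exact: sigpoly_pshpow.
Qed.

(* A shuffle character killing [x_a] and [x_b] only sees the term [i = j = 0]. *)
Lemma lin_ab_decomp (Sigma : seq C) F (a b : C) p n (v : nat -> nat -> ncpoly R) z : a \in Sigma -> b \in Sigma ->
  char_on Sigma (F^~ z) -> F [::] z = 1 -> F [:: a] z = 0 -> F [:: b] z = 0 ->
  ab_decomp Sigma a b p n v -> lin F p z = lin F (v 0%N 0%N) z.
Proof.
move=> aS bS Fc F1 Fa Fb [n0 vS] /lin_coef ->; rewrite lin_flatten.
have sg c : c \in Sigma -> sigpoly Sigma (pword [:: c]) by move=> cS; rewrite /sigpoly /= /sigword /= cS.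
rewrite big_allpairs_dep (eq_bigr (fun i => \sum_(j <- iota 0 n) 0 ^+ i * lin F (v i j) z * 0 ^+ j)); last first.
  move=> i _; apply: eq_bigr => j _; have /andP[vij _] := vS i j.
  rewrite (lin_pshuffle Fc) ?(lin_pshuffle Fc) ?sigpoly_pshuffle ?sigpoly_pshpow ?sg//.
  by rewrite !(lin_pshpow _ Fc) ?sg// !lin_pword Fa Fb.
case: n n0 {vS} => // n _; rewrite /= big_cons [X in _ + X]big1_seq; last first.
  move=> i /andP[_]; rewrite mem_iota => /andP[i0 _].
  by rewrite big1// => j _; rewrite expr0n -[_ == _]negbK -lt0n i0 /= !mul0r.
rewrite addr0 big_cons [X in _ + X]big1_seq; last first.
  move=> i /andP[_]; rewrite mem_iota => /andP[i0 _].
  by rewrite [0 ^+ i]expr0n -[_ == _]negbK -lt0n i0 /= mulr0.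
by rewrite addr0 !expr0 mul1r mulr1.
Qed.

End ShuffleCharacters.

(** * Multiple polylogarithms in all words *)

Section ComplexLimits.
Variables (R : realType) (T : Type) (F : set_system T).
Context {FF : Filter F}.
Local Notation C := (Cplx R).
Local Notation N := (@normc R).
Implicit Types (f g : T -> C) (k l m : C).

Lemma cvgC_add f g l m : f @ F --> l -> g @ F --> m -> (fun t => f t + g t) @ F --> l + m.
Proof.
move=> /cvgCP fl /cvgCP gm; apply/cvgCP => e e0.
have e2 : 0 < e / 2 by rewrite divr_gt0.
have := fl _ e2; have := gm _ e2; apply: filterS2 => t gt ft.
rewrite opprD addrACA; have := le_normcD (f t - l) (g t - m).
by lra.
Qed.

Lemma cvgC_scale k f l : f @ F --> l -> (fun t => k * f t) @ F --> k * l.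
Proof.
move=> /cvgCP fl; apply/cvgCP => e e0.
have k0 : 0 < N k + 1 by rewrite ltr_wpDl// normc_ge0.
have := fl _ (divr_gt0 e0 k0); apply: filterS => t; rewrite ltr_pdivlMr// => H.
rewrite -mulrBr normcM; apply: le_lt_trans H.
by rewrite mulrC ler_wpM2l ?normc_ge0// lerDl.
Qed.

Lemma cvgC_sub f g l m : f @ F --> l -> g @ F --> m -> (fun t => f t - g t) @ F --> l - m.
Proof.
move=> fl gm; have := cvgC_add fl (cvgC_scale (k := - 1) gm); rewrite mulN1r.
by rewrite (_ : (fun t => _ + _) = fun t => f t - g t)//; apply/funext => t; rewrite mulN1r.
Qed.

Lemma cvgC_sum0 (I : eqType) (s : seq I) (P : pred I) (f : I -> T -> C) :
  (forall i, i \in s -> P i -> f i @ F --> (0 : C)) ->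
  (fun t => \sum_(i <- s | P i) f i t) @ F --> (0 : C).
Proof.
elim: s => [|i s IH] H.
  rewrite (_ : (fun t => _) = fun=> 0); first exact: cvg_cst.
  by apply/funext => t; rewrite big_nil.
have {}IH := IH (fun j js => H j (mem_behead (s := i :: s) js)).
have [Pi|nPi] := boolP (P i); last first.
  rewrite (_ : (fun t => _) = fun t => \sum_(i <- s | P i) f i t) //.
  by apply/funext => t; rewrite big_cons (negbTE nPi).
have := cvgC_add (H i (mem_head _ _) Pi) IH; rewrite addr0.
rewrite (_ : (fun t => \sum_(i <- _ :: _ | _) _) = fun t => f i t + \sum_(i <- s | P i) f i t)//.
by apply/funext => t; rewrite big_cons Pi.
Qed.

End ComplexLimits.

(** * Differential equation, behaviour at b and factorization *)

Section MainTheorem.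
Variable R : realType.
Local Notation C := (Cplx R).
Local Notation N := (@normc R).
Variables (Sigma : seq C) (a b d : C) (U : set C) (G F : seq C -> C -> C) (La Lb : C -> C).
Hypotheses (aS : a \in Sigma) (bS : b \in Sigma) (ab : a != b)
  (Uo : open U) (Uc : connected U) (US : forall z, U z -> z \notin Sigma)
  (d0 : d != 0) (VU : slit_disk Sigma b d `<=` U)
  (HLb : is_log_branch U Lb (fun z => (z - b) / (a - b)))
  (HLa : is_log_branch U La (fun z => (z - a) / (b - a)))
  (La0 : La @ within U (nbhs b) --> 0)
  (GL : is_Lib Sigma b d U G) (FL : is_Liab Sigma b U G Lb F).
Implicit Types (c z : C) (w x : seq C).

Lemma Liab_char z : U z -> char_on Sigma (F^~ z).
Proof.
move=> Uz u v uS vS; have [H _ _] := FL.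
have := H u v uS vS z Uz; rewrite lin_pshuffle_sum !big_seq1 /= mul1r mul1r => <- //.
Qed.

Lemma Liab_Lib w : sigword Sigma w -> inAb b w -> forall z, U z -> F w z = G w z.
Proof. by have [_ H _] := FL; exact: H. Qed.

Lemma Liab_nil z : U z -> F [::] z = 1.
Proof. by move=> Uz; rewrite Liab_Lib//; exact: (Lib_nil Uo Uc d0 VU GL). Qed.

Lemma Liab_b z : U z -> F [:: b] z = Lb z.
Proof. by have [_ _ H] := FL; exact: H. Qed.

Lemma U_sub_neq0 c z : c \in Sigma -> U z -> z - c != 0.
Proof. by move=> cS Uz; rewrite subr_eq0; apply: contraTneq cS => <-; exact: US. Qed.

Lemma log_ratio_cder (L : C -> C) c c' z : c \in Sigma -> c' != c ->
  is_log_branch U L (fun z => (z - c) / (c' - c)) -> U z -> cder L z (z - c)^-1.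
Proof.
move=> cS cc HL Uz; have cc0 : c' - c != 0 by rewrite subr_eq0.
have gd (w : C) : cder (fun z => (z - c) / (c' - c)) w (c' - c)^-1.
  have := cderM (cderB (cder_id w) (cder_cst c w)) (cder_cst (c' - c)^-1 w).
  by rewrite mulr0 add0r subr0 mulr1.
have zc := U_sub_neq0 cS Uz.
have := @log_branch_cder _ U L _ z _ Uo HL (fun (w : C) _ => ex_intro _ _ (gd w)) Uz _ (gd z).
rewrite mulf_neq0 ?invr_neq0// => /(_ isT).
by rewrite invfM invrK mulrCA mulVf// mulr1.
Qed.

Lemma U_ball z : U z -> exists2 r : R, 0 < r & forall u, N (u - z) < r -> U u.
Proof. by move=> Uz; apply/nbhsCP; move: Uo; rewrite openE => /(_ z Uz). Qed.

Lemma cder_on_U (f g : C -> C) z l : (forall u, U u -> f u = g u) -> U z -> cder g z l ->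
  cder f z l.
Proof. by move=> fg Uz; apply: cder_near; have [r r0 rU] := U_ball Uz; exists r => // w /rU/fg. Qed.

(** The coefficient of [w] on the right-hand side of the differential equation, and the candidate
    for the derivative of [F w]. *)
Definition Liab_der w z : C := if w is c :: w' then F w' z / (z - c) else 0.

(** Leibniz rule: removing the first letter is a derivation of the shuffle product. *)
Lemma big_Liab_der_shuffle w z : sigword Sigma w -> U z ->
  \sum_(x <- shuffle w [:: b]) Liab_der x z = Liab_der w z * Lb z + F w z * (z - b)^-1.
Proof.
case: w => [|c w] wS Uz; first by rewrite big_seq1 /= mul0r add0r.
have bw : sigword Sigma [:: b] by rewrite /sigword/= bS.
have [cS {}wS] : c \in Sigma /\ sigword Sigma w by apply/andP.
rewrite (big_shuffle_cons (Liab_der^~ z)) shuffleN big_seq1 /=; congr (_ + _).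
by rewrite -mulr_suml (Liab_char Uz)// Liab_b// mulrAC.
Qed.

(** The shuffle relation of [w] with x_b is solved for [F (rcons w b)] and differentiated; the
    Leibniz rule gives the same relation for [Liab_der]. *)
Lemma Liab_cder w : sigword Sigma w -> forall z, U z -> cder (F w) z (Liab_der w z).
Proof.
move: w; apply: (trail_ind bS) => [w wS wb z Uz|w wS IHw IH z Uz].
  apply: (cder_on_U (Liab_Lib wS wb)) => //.
  case: w wS wb => [|c w] wS wb.
    apply: (cder_on_U (g := fun=> 1)) => //; last exact: cder_cst.
    by move=> u Uu; exact: (Lib_nil Uo Uc d0 VU GL).
  have [cS wS'] : c \in Sigma /\ sigword Sigma w by apply/andP.
  have [wb'|wb'] := boolP (inAb b w).
    by rewrite /= (Liab_Lib wS' wb' Uz); exact: (Lib_cons_cder bS Uo Uc US d0 VU GL).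
  by move: wb wb'; rewrite inAb_cons inAbE; case: w {wS wS'} => //= e w ->.
have bw : sigword Sigma [:: b] by rewrite /sigword/= bS.
pose y := rcons w b; pose s := shuffle w [:: b].
pose k : C := (count_mem y s)%:R.
have k0 : k != 0.
  by rewrite pnatr_eq0 -lt0n -has_count has_pred1; exact: rcons_shuffle1.
have yE u : U u -> F y u = k^-1 * (F w u * Lb u - \sum_(x <- s | x != y) F x u).
  move=> Uu; rewrite -(Liab_b Uu) -(Liab_char Uu wS bw) (big_count_neq _ y) addrK.
  by rewrite mulKf.
have dE : Liab_der y z =
    k^-1 * ((F w z * (z - b)^-1 + Lb z * Liab_der w z) - \sum_(x <- s | x != y) Liab_der x z).
  rewrite (_ : F w z * _ + _ = \sum_(x <- s) Liab_der x z); last first.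
    by rewrite (big_Liab_der_shuffle wS Uz) addrC [Lb z * _]mulrC.
  rewrite (big_count_neq _ y) addrK.
  by rewrite mulKf.
have bsum : cder (fun u => \sum_(x <- s | x != y) F x u) z (\sum_(x <- s | x != y) Liab_der x z).
  have : forall x, x \in s -> x != y -> cder (F x) z (Liab_der x z) by move=> x xs xy; exact: IH.
  elim: (s) => [|x t IHt] H.
    rewrite big_nil; apply: cder_near (cder_cst 0 z).
    by exists 1 => // u _; rewrite big_nil.
  have {IHt}IHt := IHt (fun x' xt => H x' (mem_behead (s := x :: t) xt)).
  rewrite big_cons; case: ifP => xy.
    apply: cder_near (cderD (H x (mem_head _ _) xy) IHt).
    by exists 1 => // u _; rewrite big_cons xy.
  by apply: cder_near IHt; exists 1 => // u _; rewrite big_cons xy.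
rewrite dE; apply: (cder_on_U yE) => //.
have Lbd : cder Lb z (z - b)^-1 by exact: log_ratio_cder ab HLb Uz.
have H := cderB (cderM (IHw z Uz) Lbd) bsum.
have := cderM (cder_cst k^-1 z) H.
by rewrite mulr0 addr0.
Qed.

Lemma Aser_smul (A : Defs.series R) w z : sigword Sigma w ->
  smul (Aser Sigma z) A w = if w is c :: w' then A w' / (z - c) else 0.
Proof.
case: w => [|c w] wS; first by rewrite smul_nil mul0r.
have [cS _] : c \in Sigma /\ sigword Sigma w by apply/andP.
rewrite smul_cons mul0r add0r; case: w {wS} => [|e w].
  by rewrite smul_nil /= cS mulrC.
rewrite smul_cons /= cS mulrC [X in _ + X](_ : _ = 0) ?addr0//.
by rewrite smulE big1// => p _; rewrite mul0r.
Qed.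

Lemma lin_cons_cder c p : c \in Sigma -> sigpoly Sigma p -> forall z, U z ->
  cder (lin F (plcons c p)) z (lin F p z / (z - c)).
Proof.
move=> cS; elim: p => [|[k w] p IH] pS z Uz.
  rewrite /lin big_nil mul0r; apply: cder_near (cder_cst 0 z).
  by exists 1 => // u _; rewrite big_nil.
have [wS {}pS] : sigword Sigma w /\ sigpoly Sigma p by apply/andP.
have cwS : sigword Sigma (c :: w) by rewrite /sigword /= cS.
have H := cderD (cderM (cder_cst k z) (Liab_cder cwS Uz)) (IH pS z Uz).
rewrite mulr0 addr0 /= mulrA -mulrDl in H.
rewrite [X in X / _](_ : _ = k * F w z + lin F p z); last by rewrite /lin big_cons.
apply: cder_near H; exists 1 => // u _.
by rewrite /lin /= big_cons.
Qed.

(** The slit disk reaches [b], so limits at [b] within [U] are not vacuous. *)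
Lemma near_b (P : C -> Prop) : (\forall z \near within U (nbhs b), P z) ->
  exists2 z, U z & P z.
Proof.
rewrite near_withinE => /nbhsCP[r r0 H].
have [z Vz zr] := slit_near_center Sigma b d0 r0.
by exists z; [exact: VU|apply: H => //; exact: VU].
Qed.

Lemma cder0_lim0 (f : C -> C) : (forall z, U z -> cder f z 0) ->
  f @ within U (nbhs b) --> 0 -> forall z, U z -> f z = 0.
Proof.
move=> fd /cvgCP fl z Uz; apply/eq0_normc/eqP; rewrite eq_le normc_ge0 andbT leNgt.
apply/negP => /fl /near_b[u Uu]; rewrite subr0.
by rewrite (cder0_const Uo Uc Uz fd Uu) ltxx.
Qed.

(** Both have derivative 1/(z - a) and tend to 0 at [b]; the limit of [La] selects the branch. *)
Lemma Liab_a z : U z -> F [:: a] z = La z.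
Proof.
have aw : sigword Sigma [:: a] by rewrite /sigword/= aS.
have awb : inAb b [:: a] by rewrite inAb_cons.
move=> Uz; apply/eqP; rewrite -subr_eq0; apply/eqP.
apply: (cder0_lim0 (f := fun z => F [:: a] z - La z)) => // {z Uz}.
  move=> z Uz; rewrite -(subrr ((z - a)^-1)); apply: cderB.
    by have := Liab_cder aw Uz; rewrite /= Liab_nil// mul1r.
  by apply: log_ratio_cder HLa Uz; rewrite // eq_sym.
rewrite -(subr0 (0 : C)); apply: (cvgC_sub _ La0).
have := @Lib_lim _ _ _ _ _ _ bS US d0 GL [:: a] aw awb isT.
move=> /cvgCP H; apply/cvgCP => e /H; rewrite !near_withinE; apply: filterS => u Hu Uu.
by rewrite Liab_Lib//; exact: Hu.
Qed.

(** On words not ending in x_b the exponential has no effect. Otherwise, as the character kills x_b,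
    its values over a shuffle with x_b sum to 0, so the value at [rcons w b] is a fixed combination
    of values tending to 0. *)
Lemma Phi_lim w : sigword Sigma w ->
  (fun z => smul (F^~ z) (sexp b (- Lb z)) w) @ within U (nbhs b) --> @sone R w.
Proof.
move: w; apply: (trail_ind bS) => [w wS wb|w wS IHw IH].
  apply/cvgCP => e e0; have [->|wn] := eqVneq w [::].
    rewrite near_withinE; apply/nbhsCP; exists 1 => // z _ Uz.
    by rewrite smul_nil sexp_nil mulr1 Liab_nil// subrr normc0.
  have /cvgCP/(_ e e0) := Lib_lim bS US d0 GL wS wb wn.
  rewrite !near_withinE; apply: filterS => z Hz Uz.
  by rewrite smul_sexpr// Liab_Lib// /sone (negbTE wn); exact: Hz.
have bw : sigword Sigma [:: b] by rewrite /sigword/= bS.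
pose y := rcons w b; pose s := shuffle w [:: b].
pose P z x := smul (F^~ z) (sexp b (- Lb z)) x.
pose k : C := (count_mem y s)%:R.
have k0 : k != 0.
  by rewrite pnatr_eq0 -lt0n -has_count has_pred1; exact: rcons_shuffle1.
have yE u : U u -> P u y = - k^-1 * (\sum_(x <- s | x != y) P u x).
  move=> Uu; have := char_smul (Liab_char Uu) (@char_sexp R Sigma b (- Lb u)) wS bw.
  rewrite (big_count_neq _ y) -/(P u y) -/s -/k.
  have -> : smul (F^~ u) (sexp b (- Lb u)) [:: b] = 0.
    rewrite smul_cons smul_nil sexp_cons !sexp_nil eqxx Liab_nil// Liab_b//=.
    by rewrite !mul1r !mulr1 divr1 addNr.
  rewrite mulr0 => /eqP; rewrite addr_eq0 => /eqP E.
  by apply: (mulfI k0); rewrite E mulrA mulrN mulfV// mulN1r.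
have -> : @sone R y = - k^-1 * 0.
  by rewrite mulr0 /sone /y -size_eq0 size_rcons.
have H : (fun u => \sum_(x <- s | x != y) P u x) @ within U (nbhs b) --> (0 : C).
  apply: (@cvgC_sum0 R _ _ _ _ s (fun x => x != y) (fun x u => P u x)) => x xs xy.
  have := IH x xs xy; rewrite {1}/sone.
  have -> : (x == [::]) = false by rewrite -size_eq0 (shuffle_size xs) addnS.
  exact.
have FU : Filter (within U (nbhs b)) by exact: _.
have {}H := @cvgC_scale R C _ FU (- k^-1) _ _ H.
move/cvgCP : H => H; apply/cvgCP => e /H; rewrite !near_withinE; apply: filterS => u Hu Uu.
by rewrite -/(P u y) yE//; exact: Hu.
Qed.

Lemma Hab_solution : is_Hab_solution Sigma b U Lb (fun z w => F w z).
Proof.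
split=> w wS; last exact: Phi_lim.
move=> z Uz; apply/is_derive_cder; rewrite Aser_smul//.
by have := Liab_cder wS Uz; case: (w).
Qed.

(** Induction on length: the equation involves a shorter word, so the difference has derivative 0,
    and the condition at [b] makes it tend to 0. *)
Lemma Hab_solution_unique H : is_Hab_solution Sigma b U Lb H ->
  forall w, sigword Sigma w -> forall z, U z -> H z w = F w z.
Proof.
move=> [H1 H2] w; have [n] := ubnP (size w); elim: n w => // n IH w /ltnSE wn wS z Uz.
apply/eqP; rewrite -subr_eq0; apply/eqP.
apply: (cder0_lim0 (f := fun z => H z w - F w z)) => // {z Uz}.
  move=> z Uz; have := H1 w wS z Uz; rewrite is_derive_cder Aser_smul// => Hd.
  have := cderB Hd (Liab_cder wS Uz).
  rewrite (_ : _ - Liab_der w z = 0)//.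
  case: w wn wS {Hd} => [|c w] wn wS; first by rewrite subrr.
  by rewrite /= (IH w) ?subrr//; case/andP: wS.
have FU : Filter (within U (nbhs b)) by exact: _.
have L := @cvgC_sub R C _ FU _ _ _ _ (H2 w wS) (Phi_lim wS); rewrite subrr in L.
move/cvgCP : L => L; apply/cvgCP => e /L; rewrite !near_withinE; apply: filterS => u Hu Uu.
have {}Hu := Hu Uu; move: Hu; congr (is_true (N (_ - 0) < e)).
(* The split with all of [w] as prefix is isolated; in the others the prefix is shorter and the
   terms cancel by induction. *)
rewrite !smulE /splits !big_map -[(size w).+1]addn1 iotaD !big_cat !big_seq1 add0n.
rewrite [fst _]/= [snd _]/= take_size drop_size sexp_nil !mulr1 opprD addrACA.
rewrite [X in X + _](_ : _ = 0) ?add0r//; apply/eqP; rewrite subr_eq0; apply/eqP.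
apply: eq_big_seq => i; rewrite mem_iota add0n => /andP[_ iw].
congr (_ * _); apply: IH => //.
- by rewrite size_take iw (leq_trans iw).
- by move: wS; rewrite /sigword -{1}(cat_take_drop i w) all_cat => /andP[].
Qed.

Lemma Hab_factorization reg : is_reg_ab Sigma a b reg ->
  forall z w, U z -> sigword Sigma w ->
  F w z = smul (smul (sexp a (La z)) (fun u => lin F (reg u) z)) (sexp b (Lb z)) w.
Proof.
move=> Hreg z w Uz wS.
pose K : Defs.series R := smul (smul (sexp a (- La z)) (F^~ z)) (sexp b (- Lb z)).
have Kc : char_on Sigma K.
  by apply: char_smul (@char_sexp R _ _ _); apply: char_smul (@char_sexp R _ _ _) (Liab_char Uz).
have K1 : K [::] = 1 by rewrite /K !smul_nil !sexp_nil Liab_nil// !mulr1.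
have L1 c (L : C) : sexp c L [:: c] = L by rewrite sexp_cons sexp_nil eqxx /= divr1 mul1r mulr1.
have Ka : K [:: a] = 0.
  rewrite /K smul_sexpr ?inAb_cons// smul_cons smul_nil sexp_nil mul1r L1 Liab_a//.
  by rewrite Liab_nil// mulr1 subrr.
have Kb : K [:: b] = 0.
  rewrite /K smulA smul_sexpl; last by rewrite /= eq_sym; apply: contraNneq ab => -[->].
  by rewrite smul_cons smul_nil sexp_nil L1 Liab_nil// Liab_b// mulr1 mul1r addNr.
have Kreg u : sigword Sigma u -> K u = lin F (reg u) z.
  move=> uS; have [n [v [Hv Hr]]] := Hreg u uS.
  rewrite (lin_coef F z Hr) -(lin_pword (fun w _ => K w) u z).
  rewrite (@lin_ab_decomp R Sigma (fun w _ => K w) a b _ n v z aS bS Kc K1 Ka Kb Hv).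
  have [_ /(_ 0%N 0%N) /andP[_ /allP vA] _] := Hv.
  (* On words that neither start with x_a nor end with x_b both exponentials act trivially, so [K]
     and [F] agree. *)
  apply: eq_big_seq => t /vA /andP[ta tb]; congr (_ * _).
  by rewrite /K smul_sexpr// smul_sexpl.
rewrite -(eq_smul wS (A := smul (sexp a (La z)) K) (B := sexp b (Lb z))) //; last first.
  by move=> u uS; apply: eq_smul uS _ _.
(* The exponentials are multiplied back and cancel those in [K], here on the left. *)
have E1 u : smul (sexp a (La z)) K u = smul (F^~ z) (sexp b (- Lb z)) u.
  rewrite -smulA -[RHS]smul1l -smulA.
  rewrite !smulE; apply: eq_bigr => p _; congr (_ * _).
  rewrite -smulA !smulE; apply: eq_bigr => q _; congr (_ * _).
  by apply: sexp_inv; rewrite subrr.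
transitivity (smul (F^~ z) (@sone R) w); first by rewrite smul1r.
transitivity (smul (smul (F^~ z) (sexp b (- Lb z))) (sexp b (Lb z)) w); last first.
  by rewrite !smulE; apply: eq_bigr => p _; rewrite E1.
rewrite smulA !smulE; apply: eq_bigr => p _; congr (_ * _).
by rewrite sexp_inv// addNr.
Qed.

End MainTheorem.

Unset Implicit Arguments.
Set Strict Implicit.

Theorem mainTheorem3 (R : realType) (Sigma : seq (Cplx R)) (a b d : Cplx R)
    (U : set (Cplx R)) (G F : seq (Cplx R) -> Cplx R -> Cplx R)
    (La Lb : Cplx R -> Cplx R) :
  a \in Sigma -> b \in Sigma -> a != b ->
  open U -> connected U -> simply_connected U ->
  (forall z, U z -> z \notin Sigma) ->
  d != 0 -> slit_disk Sigma b d `<=` U ->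
  is_log_branch U Lb (fun z => (z - b) / (a - b)) ->
  is_log_branch U La (fun z => (z - a) / (b - a)) ->
  La @ within U (nbhs b) --> 0 ->
  is_Lib Sigma b d U G ->
  is_Liab Sigma b U G Lb F ->
  [/\ (* d/dz Li^{ab}(x_c w; z) = Li^{ab}(w; z) / (z - c) *)
      (forall c p, c \in Sigma -> sigpoly Sigma p -> forall z, U z ->
         is_derive z 1 (lin F (plcons c p)) (lin F p z / (z - c))),
      (* the generating series sum_W Li^{ab}(w; z) W is the solution H^{ab} ... *)
      is_Hab_solution Sigma b U Lb (fun z w => F w z),
      (* ... which is unique *)
      (forall H, is_Hab_solution Sigma b U Lb H ->
         forall z w, U z -> sigword Sigma w -> H z w = F w z)
    & (* H^{ab}(z) = ((z-a)/(b-a))^{X_a} (sum_W Li^{ab}(reg^{ab} w; z) W) ((z-b)/(a-b))^{X_b} *)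
      (forall reg, is_reg_ab Sigma a b reg ->
         forall z w, U z -> sigword Sigma w ->
           F w z = smul (smul (sexp a (La z)) (fun u => lin F (reg u) z))
                        (sexp b (Lb z)) w)].
Proof.
move=> aS bS ab Uo Uc _ US d0 VU HLb HLa La0 GL FL; split.
- move=> c p cS pS z Uz; apply/is_derive_cder.
  exact: (lin_cons_cder bS ab Uo Uc US d0 VU HLb GL FL).
- exact: (Hab_solution bS ab Uo Uc US d0 VU HLb GL FL).
- move=> H HH z w Uz wS.
  exact: (Hab_solution_unique bS ab Uo Uc US d0 VU HLb GL FL HH).
- move=> reg Hreg z w Uz wS.
  exact: (Hab_factorization aS bS ab Uo Uc US d0 VU HLb HLa La0 GL FL Hreg).
Qed.
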